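(* There exists an algorithm that, given an instance $(G, A, \mathcal{U}, p)$ of Envy-Free Incomplete Connected Fair Division (optional setting) with input numbers in binary representation, and a positive real number $\varepsilon$, runs in time $\left(\frac{1}{\varepsilon}\log\frac{p}{\varepsilon}\right)^{\mathcal{O}(|\mathcal{A}|p^2)}(mn)^{\mathcal{O}(1)}$ and either outputs a valid and $\varepsilon$-envy-free allocation $\Pi$, or correctly states that $(G, A, \mathcal{U}, p)$ does not admit a valid and envy-free allocation.
   Context: An instance of Envy-Free Incomplete Connected Fair Division is a tuple $(G, A, \mathcal{U}, p)$ where $G$ is a finite simple undirected graph on $m$ vertices (items), $p \in \{0,\dots,m\}$, $A = [n]$ is the set of agents, and $\mathcal{U} = \{u_i : V(G) \to \mathbb{N}_{\geq 0}\}_{i \in A}$ are valuation functions extended additively to subsets. An allocation is a tuple $\Pi = (\pi_1,\dots,\pi_n)$ of subsets of $V(G)$ (empty bundles allowed). It is valid if bundles are pairwise disjoint, $\sum_i|\pi_i| = p$, and each $G[\pi_i]$ is connected. It is envy-free if $u_i(\pi_i) \geq u_i(\pi_j)$ for all $i,j \in A$, and $\varepsilon$-envy-free if $(1+\varepsilon)u_i(\pi_i) \geq u_i(\pi_j)$ for all $i,j \in A$. Two agents $i,j$ have the same type if $u_i = u_j$; $\mathcal{A}$ denotes the partition of $A$ into agent types, so $|\mathcal{A}|$ is the number of distinct valuation functions. Binary representation means valuations are encoded in binary.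
   Formalization: In the running time, the base (1/ε)log(p/ε) is replaced by max(2, (1/ε)log(p/ε)) and m, n by max(1,m), max(1,n): for ε ≥ p, p = 0, or m or n zero, the stated bound is zero, negative or undefined. Time counts machine-word operations. *)

(* Defs.v *)
(* MathComp / MathComp-Analysis; the real numbers are an arbitrary realType. *)
From HB Require Import structures.
From mathcomp Require Export all_boot all_order all_algebra.
From mathcomp Require Export reals exp.

Set Implicit Arguments.
Unset Strict Implicit.
Unset Printing Implicit Defensive.

Import Order.TTheory GRing.Theory Num.Theory.

Local Open Scope nat_scope.

Record instance := Instance {
  items : nat;
  agents : nat;
  adj : rel 'I_items;
  adj_sym : symmetric adj;
  adj_irr : irreflexive adj;
  valuation : 'I_agents -> {ffun 'I_items -> nat};
  budget : 'I_items.+1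
}.

Section Allocations.
Variable I : instance.
Implicit Types (i j : 'I_(agents I)) (S : {set 'I_(items I)}).

Definition utility i S : nat := \sum_(v in S) valuation i v.

Definition induced S : rel 'I_(items I) :=
  [rel x y | [&& x \in S, y \in S & adj x y]].

(* The empty set counts as connected. *)
Definition connected_bundle S : Prop :=
  {in S &, forall x y, connect (induced S) x y}.

Definition allocation := {ffun 'I_(agents I) -> {set 'I_(items I)}}.

Definition valid (Pi : allocation) : Prop :=
  [/\ forall i j, i != j -> [disjoint Pi i & Pi j],
      \sum_i #|Pi i| = budget I
    & forall i, connected_bundle (Pi i)].

Definition envy_free (Pi : allocation) : Prop :=
  forall i j, utility i (Pi j) <= utility i (Pi i).

Definition eps_envy_free (R : realType) (eps : R) (Pi : allocation) : Prop :=
  forall i j,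
    ((utility i (Pi j))%:R <= (1 + eps) * (utility i (Pi i))%:R)%R.

Definition agent_types : {set {set 'I_(agents I)}} :=
  preim_partition (@valuation I) [set: 'I_(agents I)].

Definition max_val : nat := \max_i \max_v @valuation I i v.

End Allocations.

(* Algorithms are programs for a word RAM: the memory is an array of words of
   w bits, arithmetic on words has unit cost, and a program is a fixed finite
   text that depends neither on the input nor on w.  A result that does not fit
   in w bits makes the evaluation fail, so the unit cost never applies to
   numbers longer than one word. *)
Inductive binop := Add | Sub | Mul | Div | Leq.

Definition binop_eval (o : binop) (a b : nat) : nat :=
  match o with
  | Add => a + b
  | Sub => a - b
  | Mul => a * b
  | Div => a %/ b
  | Leq => a <= b
  end.

(* A real eps has no finite encoding: the machine reads it through its Dedekind
   cut, EpsGe a b being 1 if b <= a * eps and 0 otherwise.  For a rational eps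
   given by numerator and denominator the query is two multiplications and a
   comparison. *)
Inductive expr :=
| Cst of nat
| Deref of expr
| Bin of binop & expr & expr
| EpsGe of expr & expr.

Inductive com :=
| Skip
| Store of expr & expr (* Store a e writes the value of e at address a. *)
| Seq of com & com
| If of expr & com & com
| While of expr & com.

Definition memory := nat -> nat.

Definition upd (M : memory) (a x : nat) : memory :=
  fun b => if b == a then x else M b.

Definition fit (w x : nat) : option nat := if x < 2 ^ w then Some x else None.

Fixpoint eval (R : realType) (eps : R) (w : nat) (M : memory) (e : expr) :
    option nat :=
  match e with
  | Cst k => fit w k
  | Deref e1 => obind (fun a => fit w (M a)) (eval eps w M e1)
  | Bin o e1 e2 =>
      obind (fun a => obind (fun b => fit w (binop_eval o a b))
        (eval eps w M e2)) (eval eps w M e1)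
  | EpsGe e1 e2 =>
      obind (fun a => obind (fun b => fit w (b%:R <= a%:R * eps)%R)
        (eval eps w M e2)) (eval eps w M e1)
  end.

(* Number of elementary operations performed when evaluating e. *)
Fixpoint cost (e : expr) : nat :=
  match e with
  | Cst _ => 1
  | Deref e1 => (cost e1).+1
  | Bin _ e1 e2 => (cost e1 + cost e2).+1
  | EpsGe e1 e2 => (cost e1 + cost e2).+1
  end.

(* exec eps w c M t M': started in memory M, c halts without overflow after t
   elementary operations, leaving memory M'. *)
Inductive exec (R : realType) (eps : R) (w : nat) :
    com -> memory -> nat -> memory -> Prop :=
| ExecSkip M : exec eps w Skip M 1 M
| ExecStore ea ev M a x :
    eval eps w M ea = Some a -> eval eps w M ev = Some x ->
    exec eps w (Store ea ev) M (cost ea + cost ev).+1 (upd M a x)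
| ExecSeq c1 c2 M t1 M1 t2 M2 :
    exec eps w c1 M t1 M1 -> exec eps w c2 M1 t2 M2 ->
    exec eps w (Seq c1 c2) M (t1 + t2) M2
| ExecIfTrue e c1 c2 M x t M1 :
    eval eps w M e = Some x -> x != 0 -> exec eps w c1 M t M1 ->
    exec eps w (If e c1 c2) M (cost e + t).+1 M1
| ExecIfFalse e c1 c2 M t M1 :
    eval eps w M e = Some 0 -> exec eps w c2 M t M1 ->
    exec eps w (If e c1 c2) M (cost e + t).+1 M1
| ExecWhileTrue e c M x t1 M1 t2 M2 :
    eval eps w M e = Some x -> x != 0 -> exec eps w c M t1 M1 ->
    exec eps w (While e c) M1 t2 M2 ->
    exec eps w (While e c) M (cost e + t1 + t2).+1 M2
| ExecWhileFalse e c M :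
    eval eps w M e = Some 0 ->
    exec eps w (While e c) M (cost e).+1 M.

(* Input layout: m, n, p, the adjacency matrix (m x m, row by row), the
   valuations (n x m, row by row); all other words are 0. *)
Definition input_words (I : instance) : seq nat :=
  [:: items I; agents I; nat_of_ord (budget I)]
    ++ [seq nat_of_bool (adj x y) | x <- enum 'I_(items I), y <- enum 'I_(items I)]
    ++ [seq valuation i v | i <- enum 'I_(agents I), v <- enum 'I_(items I)].

Definition input_memory (I : instance) : memory := nth 0 (input_words I).

(* Output layout: word 0 is 1 (an allocation follows) or 0 (no valid envy-free
   allocation exists); word 1 + i * m + v is nonzero iff agent i gets item v. *)
Definition output_allocation (I : instance) (M : memory) : allocation I :=
  [ffun i : 'I_(agents I) =>
    [set v : 'I_(items I) | M (1 + i * items I + v) != 0]].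

Definition correct_output (R : realType) (eps : R) (I : instance) (M : memory) :
    Prop :=
  (M 0 = 1 /\ valid (output_allocation I M)
           /\ eps_envy_free eps (output_allocation I M))
  \/ (M 0 = 0 /\ ~ exists Pi : allocation I, valid Pi /\ envy_free Pi).

Definition log2 (R : realType) (x : R) : R := (ln x / ln 2)%R.

(* (1/eps * log(p/eps))^(O(|A|p^2)) * (mn)^(O(1)), with C as the constant of
   each O().  As usual for asymptotic bounds, the base is read as at least 2
   (1/eps * log(p/eps) tends to 0 as eps grows and is negative for eps > p),
   and m, n as at least 1. *)
Definition time_bound (R : realType) (C : nat) (eps : R) (I : instance) : R :=
  (C%:R
   * Num.max 2 (eps^-1 * log2 ((budget I : nat)%:R / eps))
       ^+ (C * (#|agent_types I| * budget I ^ 2))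
   * ((maxn 1 (items I) * maxn 1 (agents I)) ^ C)%:R)%R.

(* Word length w >= C * log2 ((1 + U) * T), where U is the largest valuation and
   T the time bound: a word can hold O(1) input numbers and memory addresses. *)
Definition word_length_ok (R : realType) (C : nat) (eps : R) (I : instance)
    (w : nat) : Prop :=
  (((max_val I).+1%:R * time_bound C eps I) ^+ C <= 2 ^+ w)%R.

(* Main.v *)
(* Color the items by [x |-> ((a * x) mod N) / (m + 1)] with N = (4 p^2 + 1)(m + 1):
   each pair of items collides for at most 4 (m + 1) values of [a], so some [a < N]
   separates the p items of a given solution. The algorithm tries every [a] together
   with every description of a solution that gives, for each of p slots, its color, its
   parent in a spanning tree of its bundle, the type owning it and, for each type, the
   value of its item as a multiple of tau / K, where K is about p + 2 p / eps and tau is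
   the largest value that the type assigns to an item of the solution. There are
   (1/eps * log (p/eps))^O(|A| p^2) descriptions up to a factor polynomial in m n.

   The thresholds tau themselves are too many to be guessed. But once colors make the
   bundles disjoint, the tuples of thresholds for which items fitting the description
   exist are closed under pointwise maximum: take the bundles of each type from the tuple
   with the larger entry. So one starts from the largest item values and, as long as the
   bundles of some type cannot be filled, lowers its threshold to the next item value;
   this never passes below the thresholds of a solution. Filling is a bottom-up search
   on the guessed trees, and the rounding loses a factor 1 + eps at most. What is found
   is checked directly, so only completeness depends on this argument. *)
Require Import Defs.
From mathcomp Require Import zify lra ring.
Set Implicit Arguments.
Unset Strict Implicit.
Unset Printing Implicit Defensive.
Import Order.TTheory GRing.Theory Num.Theory.
Local Open Scope nat_scope.

(** * Bounded loop programs over the word RAM *)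

(** Time and word length belong to the claim. To get both from the syntax, the search is written in
    a language whose loops all run over polynomial ranges; only raising [K] and running through the
    codes need real [while] loops.

    [eps] can be compared but not inverted, so [K] is raised until [2 p <= (K - p) eps]. This is
    what rounding requires: if the levels of an agent's own bundle sum to [H], the bundle is worth
    at least [(H - p) tau / K] and any other at most [(H + p) tau / K], while [H >= K] because
    without envy the own bundle is worth as much as any single allocated item.

    A code holds one level per slot and type, hence [|A| p] of them; the further factor [p] in the
    exponent pays for the range [O(p (1 + 1/eps))] of a level when the base is as small as 2. Which
    agent of its type receives a tree is not guessed: agents of one type are interchangeable, but it
    must be shown that the type does not run out of agents and that, if its scale is positive, none
    of them stays empty-handed. *)

Inductive range := RC of nat | RM | RN | RP | RAdd of range & range | RMul of range & range.

Inductive term :=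
| TRange of range
| TInput of term
| TCell of nat & term
| TVar of nat
| TBin of binop & term & term
| TEps of term & term
| TSum of range & term
| TMax of range & term.

Inductive stmt :=
| SSkip
| SStore of nat & term & term
| SSeq of stmt & stmt
| SIf of term & stmt & stmt
| SFor of range & stmt.

(* [state] is seen as infinitely many registers [u a i]: array [a], index [i]. *)
Definition state := nat -> nat -> nat.

Definition setc (u : state) a i x : state :=
  fun b => if b == a then fun j => if j == i then x else u b j else u b.

Fixpoint erange (I : instance) (r : range) : nat :=
  match r with
  | RC k => k
  | RM => items I
  | RN => agents I
  | RP => budget I
  | RAdd r1 r2 => erange I r1 + erange I r2
  | RMul r1 r2 => erange I r1 * erange I r2
  end.

(** An exponent: a range is at most [(m + n + 2) ^ rsz r]. A constant [k] weighs [k.+1], as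
    [k < 2 ^ k.+1]. *)
Fixpoint rsz (r : range) : nat :=
  match r with
  | RC k => k.+1
  | RM | RN | RP => 1
  | RAdd r1 r2 | RMul r1 r2 => (rsz r1 + rsz r2).+1
  end.

(** The length of the input, hence the first address of the work space. *)
Definition base (I : instance) :=
  3 + (items I * items I + agents I * items I).

Section Semantics.
Variables (R : realType) (eps : R) (I : instance).

(* Reads outside the input are redirected to word 0, so that no read of the
   input can reach the work space. *)
Fixpoint ev (u : state) (env : seq nat) (t : term) : nat :=
  match t with
  | TRange r => erange I r
  | TInput t => let a := ev u env t in input_memory I (a * (a < base I))
  | TCell a t => u a (ev u env t)
  | TVar l => nth 0 env l
  | TBin o t1 t2 => binop_eval o (ev u env t1) (ev u env t2)
  | TEps t1 t2 => ((ev u env t2)%:R <= (ev u env t1)%:R * eps)%R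
  | TSum r t => \sum_(i < erange I r) ev u (rcons env i) t
  | TMax r t => \max_(i < erange I r) ev u (rcons env i) t
  end.

Variable X : nat.

(* Besides the postcondition this asks that no stored value or index exceeds [X]. *)
Fixpoint wp (s : stmt) (env : seq nat) (u : state) (Q : state -> Prop) : Prop :=
  match s with
  | SSkip => Q u
  | SStore a t1 t2 =>
      [/\ ev u env t1 <= X, ev u env t2 <= X
        & Q (setc u a (ev u env t1) (ev u env t2))]
  | SSeq s1 s2 => wp s1 env u (fun u' => (forall a i, u' a i <= X) -> wp s2 env u' Q)
  | SIf t s1 s2 =>
      (ev u env t != 0 -> wp s1 env u Q) /\ (ev u env t = 0 -> wp s2 env u Q)
  | SFor r s =>
      exists Inv : nat -> state -> Prop,
      [/\ Inv 0 u,
          forall i u', i < erange I r -> (forall a j, u' a j <= X) -> Inv i u' ->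
            wp s (rcons env i) u' (Inv i.+1)
        & forall u', (forall a j, u' a j <= X) -> Inv (erange I r) u' -> Q u']
  end.

Lemma wp_mono s env u (Q Q' : state -> Prop) :
  (forall u', Q u' -> Q' u') -> wp s env u Q -> wp s env u Q'.
Proof.
elim: s env u Q Q' => [|a t1 t2|s1 IH1 s2 IH2|t s1 IH1 s2 IH2|r s IH] env u Q Q' QQ' /=.
- exact: QQ'.
- by case=> h1 h2 h3; split=> //; apply: QQ'.
- by apply: IH1 => u' h bu; apply: IH2 (h bu).
- by case=> h1 h2; split=> h; [apply: IH1 (h1 h)|apply: IH2 (h2 h)].
- by case=> Inv [h1 h2 h3]; exists Inv; split=> // u' bu /h3 h; apply/QQ'/h.
Qed.

Fixpoint mods (s : stmt) : seq nat :=
  match s with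
  | SSkip => [::]
  | SStore a _ _ => [:: a]
  | SSeq s1 s2 | SIf _ s1 s2 => mods s1 ++ mods s2
  | SFor _ s => mods s
  end.

Definition same_but (l : seq nat) (u u' : state) := forall a, a \notin l -> u' a = u a.

(** Through [wp_seq], every stage of the search learns from this which arrays the stage before it
    left alone. *)
Lemma wp_frame s env u (Q : state -> Prop) :
  wp s env u Q -> wp s env u (fun u' => Q u' /\ same_but (mods s) u u').
Proof.
elim: s env u Q => [|a t1 t2|s1 IH1 s2 IH2|t s1 IH1 s2 IH2|r s IH] env u Q /=.
- by move=> h; split.
- case=> h1 h2 h3; split=> //; split=> // b; rewrite inE /setc => /negbTE hb.
  by rewrite hb.
- move=> /IH1; apply: wp_mono => u1 [h f1] bu; move: (h bu) => /IH2; apply: wp_mono => u2 [hQ f2].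
  by split=> // a; rewrite mem_cat negb_or => /andP[a1 a2]; rewrite f2 // f1.
- case=> h1 h2; split=> h.
    apply: wp_mono (IH1 _ _ _ (h1 h)) => u' [hQ f]; split=> // a.
    by rewrite mem_cat negb_or => /andP[a1 _]; apply: f.
  apply: wp_mono (IH2 _ _ _ (h2 h)) => u' [hQ f]; split=> // a.
  by rewrite mem_cat negb_or => /andP[_ a2]; apply: f.
- case=> Inv [h1 h2 h3].
  exists (fun i u' => Inv i u' /\ same_but (mods s) u u'); split.
  + by split.
  + move=> i u' hi bu [hI f]; apply: wp_mono (IH _ _ _ (h2 i u' hi bu hI)).
    by move=> u2 [hI2 f2]; split=> // a ha; rewrite f2 // f.
  + by move=> u' bu [hI f]; split=> //; apply: h3.
Qed.

End Semantics.

(** * Sizes and well-formedness *)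

(** One measure for everything: with [Z = m + n + 2], a term has value at most [X.+2 ^ tsz t], takes
    time at most [Z ^ (16 * tsz t)] and occupies at most [tsz t] temporaries. *)
Fixpoint tsz (t : term) : nat :=
  match t with
  | TRange r => rsz r
  | TInput t => (tsz t).+1
  | TCell a t => (a + tsz t).+1
  | TVar l => l.+1
  | TBin _ t1 t2 | TEps t1 t2 => (tsz t1 + tsz t2).+1
  | TSum r t | TMax r t => (rsz r + tsz t).+1
  end.

(* [l] is the number of enclosing binders. *)
Fixpoint wft (l : nat) (t : term) : bool :=
  match t with
  | TRange r => rsz r <= 8
  | TInput t => wft l t
  | TCell a t => (a < 30) && wft l t
  | TVar k => k < l
  | TBin _ t1 t2 | TEps t1 t2 => wft l t1 && wft l t2
  | TSum r t | TMax r t => (rsz r <= 8) && wft l.+1 t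
  end.

Fixpoint ssz (s : stmt) : nat :=
  match s with
  | SSkip => 1
  | SStore a t1 t2 => (a + tsz t1 + tsz t2).+1
  | SSeq s1 s2 => (ssz s1 + ssz s2).+1
  | SIf t s1 s2 => (tsz t + ssz s1 + ssz s2).+1
  | SFor r s => (rsz r + ssz s).+1
  end.

Fixpoint wfs (l : nat) (s : stmt) : bool :=
  match s with
  | SSkip => true
  | SStore a t1 t2 => [&& a < 30, wft l t1 & wft l t2]
  | SSeq s1 s2 => wfs l s1 && wfs l s2
  | SIf t s1 s2 => [&& wft l t, wfs l s1 & wfs l s2]
  | SFor r s => (rsz r <= 8) && wfs l.+1 s
  end.

(** * Compilation to word RAM programs *)

Definition Ebase : expr :=
  Bin Add (Cst 3) (Bin Add (Bin Mul (Deref (Cst 0)) (Deref (Cst 0)))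
                           (Bin Mul (Deref (Cst 1)) (Deref (Cst 0)))).

(* Arrays are interleaved in the work space with stride 32, hence unbounded;
   array 30 holds temporaries and array 31 the loop variables. *)
Definition addr (a : nat) (e : expr) : expr :=
  Bin Add Ebase (Bin Add (Bin Mul (Cst 32) e) (Cst a)).
Definition cell a e : expr := Deref (addr a e).
Definition tmp d : expr := cell 30 (Cst d).
Definition var l : expr := cell 31 (Cst l).
Definition set_tmp d e : com := Store (addr 30 (Cst d)) e.
Definition set_var l e : com := Store (addr 31 (Cst l)) e.

Fixpoint crange (r : range) : expr :=
  match r with
  | RC k => Cst k
  | RM => Deref (Cst 0)
  | RN => Deref (Cst 1)
  | RP => Deref (Cst 2)
  | RAdd r1 r2 => Bin Add (crange r1) (crange r2)
  | RMul r1 r2 => Bin Mul (crange r1) (crange r2)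
  end.

Definition loop l r (c : com) : com :=
  Seq (set_var l (Cst 0))
    (While (Bin Leq (Bin Add (var l) (Cst 1)) (crange r))
       (Seq c (set_var l (Bin Add (var l) (Cst 1))))).

(* Leaves the value of the term in temporary [d]. *)
Fixpoint cterm (l d : nat) (t : term) : com :=
  match t with
  | TRange r => set_tmp d (crange r)
  | TInput t => Seq (cterm l d t)
      (set_tmp d (Deref (Bin Mul (tmp d) (Bin Leq (Bin Add (tmp d) (Cst 1)) Ebase))))
  | TCell a t => Seq (cterm l d t) (set_tmp d (cell a (tmp d)))
  | TVar k => set_tmp d (var k)
  | TBin o t1 t2 => Seq (cterm l d t1) (Seq (cterm l d.+1 t2)
      (set_tmp d (Bin o (tmp d) (tmp d.+1))))
  | TEps t1 t2 => Seq (cterm l d t1) (Seq (cterm l d.+1 t2)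
      (set_tmp d (EpsGe (tmp d) (tmp d.+1))))
  | TSum r t => Seq (set_tmp d (Cst 0)) (loop l r (Seq (cterm l.+1 d.+1 t)
      (set_tmp d (Bin Add (tmp d) (tmp d.+1)))))
  | TMax r t => Seq (set_tmp d (Cst 0)) (loop l r (Seq (cterm l.+1 d.+1 t)
      (set_tmp d (Bin Add (tmp d) (Bin Sub (tmp d.+1) (tmp d))))))
  end.

Fixpoint cstmt (l : nat) (s : stmt) : com :=
  match s with
  | SSkip => Skip
  | SStore a t1 t2 => Seq (cterm l 0 t1) (Seq (cterm l 1 t2)
      (Store (addr a (tmp 0)) (tmp 1)))
  | SSeq s1 s2 => Seq (cstmt l s1) (cstmt l s2)
  | SIf t s1 s2 => Seq (cterm l 0 t) (If (tmp 0) (cstmt l s1) (cstmt l s2))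
  | SFor r s => loop l r (cstmt l.+1 s)
  end.

(** * Correctness and cost of the compiled code *)

Lemma add_le_mul a b A B z : a <= A -> b <= B -> 0 < A -> 0 < B -> 2 <= z -> a + b <= z * (A * B).
Proof.
move=> ha hb hA hB hz; apply: leq_trans (leq_add ha hb) _.
apply: leq_trans (_ : 2 * (A * B) <= _); last by rewrite leq_mul2r hz orbT.
by rewrite mul2n -addnn leq_add // ?leq_pmulr ?leq_pmull.
Qed.

Lemma mul_le_mul a b A B z : a <= A -> b <= B -> 0 < z -> a * b <= z * (A * B).
Proof. by move=> ha hb hz; apply: leq_trans (leq_mul ha hb) _; rewrite leq_pmull. Qed.

Section Compilation.
Variables (R : realType) (eps : R) (w : nat) (I : instance) (X S : nat).
Let Z := items I + agents I + 2.
Hypothesis ZX : Z ^ 8 <= X.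
Hypothesis X32 : 32 <= X.
Hypothesis baseX : base I <= X.
Hypothesis inputX : forall b, input_memory I b <= X.
Hypothesis fitw : X.+2 ^ S.+2 <= 2 ^ w.

Definition ad a i := base I + (32 * i + a).

Definition input_ok (M : memory) := forall b, b < base I -> M b = input_memory I b.

Definition represents (u : state) (env : seq nat) (M : memory) :=
  [/\ input_ok M,
      forall a i, a < 30 -> M (ad a i) = u a i
    & forall l, l < size env -> M (ad 31 l) = nth 0 env l].

Lemma budget_le : budget I <= items I.
Proof. by rewrite -ltnS. Qed.

Lemma Z2 : 2 <= Z. Proof. rewrite /Z; lia. Qed.

Lemma Z_le_X : Z <= X.
Proof. by apply: leq_trans ZX; rewrite -{1}(expn1 Z) leq_pexp2l //; have := Z2; lia. Qed.

Lemma erange_le r : erange I r <= Z ^ rsz r.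
Proof.
have h2 := Z2.
elim: r => [k||||r1 IH1 r2 IH2|r1 IH1 r2 IH2] //=; rewrite ?expn1.
- by apply: leq_trans (ltnW (ltn_expl k.+1 h2)).
- by rewrite /Z; lia.
- by rewrite /Z; lia.
- by have := budget_le; rewrite /Z; lia.
- by rewrite expnS expnD add_le_mul // expn_gt0; lia.
- by rewrite expnS expnD mul_le_mul //; lia.
Qed.

Lemma erangeX r : rsz r <= 8 -> erange I r <= X.
Proof.
move=> h; apply: leq_trans ZX; apply: leq_trans (erange_le r) _.
by rewrite leq_pexp2l //; have := Z2; lia.
Qed.

Lemma expX_gt0 k : 0 < X.+2 ^ k. Proof. by rewrite expn_gt0. Qed.

(** For bounds [A, B >= 1] both the sum and the product are at most [X.+2 * (A * B)], so a node adds
    one to the exponent and the sizes of its subterms add up. A [TSum] counts as a product with its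
    range. *)
Lemma ev_le u env t : (forall a i, u a i <= X) -> (forall l, nth 0 env l <= X) ->
  wft (size env) t -> ev eps I u env t <= X.+2 ^ tsz t.
Proof.
move=> hu; elim: t env => [r|t IH|a t IH|l|o t1 IH1 t2 IH2|t1 IH1 t2 IH2|r t IH|r t IH] env he /=.
- move=> hr; apply: leq_trans (erange_le r) _; rewrite leq_exp2r; last by case: r hr.
  by have := Z_le_X; lia.
- move=> _; apply: leq_trans (inputX _) _; rewrite expnS.
  by have := expX_gt0 (tsz t); nia.
- move=> _; apply: leq_trans (hu _ _) _; rewrite expnS.
  by have := expX_gt0 (a + tsz t); nia.
- move=> _; apply: leq_trans (he l) _; rewrite expnS.
  by have := expX_gt0 l; nia.
- case/andP=> /(IH1 _ he) h1 /(IH2 _ he) h2.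
  rewrite expnS expnD; have p1 := expX_gt0 (tsz t1); have p2 := expX_gt0 (tsz t2).
  have sum := add_le_mul h1 h2 p1 p2 (isT : 2 <= X.+2).
  case: o => /=.
  + exact: sum.
  + by apply: leq_trans sum; lia.
  + exact: mul_le_mul.
  + by apply: leq_trans (leq_div _ _) _; lia.
  + by apply: leq_trans (leq_b1 _) _; rewrite !muln_gt0 p1 p2.
- case/andP=> _ _; have := expX_gt0 (tsz t1 + tsz t2); rewrite expnS.
  by case: (_ <= _)%R => /=; nia.
- case/andP=> hr ht.
  have hs (i : 'I_(erange I r)) : ev eps I u (rcons env i) t <= X.+2 ^ tsz t.
    apply: IH; last by rewrite size_rcons.
    move=> l; rewrite nth_rcons; case: ltnP => // _; case: eqP => // _.
    by apply: leq_trans (ltnW (ltn_ord i)) (erangeX hr).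
  apply: leq_trans (leq_sum _ (fun i _ => hs i)) _.
  rewrite sum_nat_const card_ord expnS expnD.
  have := erange_le r; have p1 := expX_gt0 (tsz t); have p2 := expX_gt0 (rsz r) => hZ.
  have hE : erange I r <= X.+2 ^ rsz r.
    by apply: leq_trans hZ _; rewrite leq_exp2r; [have := Z_le_X; lia|case: (r)].
  exact: mul_le_mul.
- case/andP=> hr ht; apply/bigmax_leqP => i _.
  apply: leq_trans (_ : X.+2 ^ tsz t <= _); last by rewrite leq_pexp2l // ; lia.
  apply: IH; last by rewrite size_rcons.
  move=> l; rewrite nth_rcons; case: ltnP => // _; case: eqP => // _.
  by apply: leq_trans (ltnW (ltn_ord i)) (erangeX hr).
Qed.

Lemma fitE x : x <= X.+2 ^ S -> fit w x = Some x.
Proof.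
move=> h; rewrite /fit (leq_trans _ fitw) // !expnS.
by have := expX_gt0 S; nia.
Qed.

Lemma XS x : 0 < S -> x <= X.+2 -> x <= X.+2 ^ S.
Proof. by move=> S0 h; apply: leq_trans h _; rewrite -{1}(expn1 X.+2) leq_pexp2l. Qed.

Hypothesis S0 : 1 < S.

Lemma fitX x : x <= X.+2 -> fit w x = Some x.
Proof. by move=> h; apply/fitE/XS => //; lia. Qed.

Lemma size_input_words : size (input_words I) = base I.
Proof. by rewrite /input_words !size_cat /= !size_allpairs !size_enum_ord. Qed.

Lemma input_ok0 M : input_ok M -> [/\ M 0 = items I, M 1 = agents I & M 2 = budget I].
Proof. by move=> h; split; rewrite h //= /base; lia. Qed.

(** All that the computation of an address reads. It outlives [input_ok] while [emit] writes the
    output over the input. *)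
Definition dims_ok (M : memory) := M 0 = items I /\ M 1 = agents I.

Lemma input_dims M : input_ok M -> dims_ok M.
Proof. by case/input_ok0. Qed.

#[local] Hint Extern 0 (dims_ok _) => (apply: input_dims; assumption) : core.

Lemma eval_Ebase M : dims_ok M -> eval eps w M Ebase = Some (base I).
Proof.
move=> [h0 h1]; rewrite /Ebase /=.
have hb := baseX; rewrite /base in hb.
rewrite (fitX (x := 3)) /= ; last by lia.
rewrite (fitX (x := 0)) //= h0 (fitX (x := items I)) /=; last by nia.
rewrite (fitX (x := 1)) /=; last by lia.
rewrite h1 (fitX (x := agents I)) /=; last first.
  by have := Z_le_X; rewrite /Z; lia.
rewrite (fitX (x := items I * items I)) /=; last by nia.
rewrite (fitX (x := agents I * items I)) /=; last by nia.
rewrite (fitX (x := _ + _)) /=; last by nia.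
by rewrite fitX //; rewrite /base; lia.
Qed.

(** Addresses exceed term values by the factor 32 and the offset [base I]; thanks to [32 <= X] they
    stay below [34 * X.+2 ^ S.+1 <= X.+2 ^ S.+2]. Hence the two spare factors in [fitw]. *)
Lemma eval_addr M a e i : dims_ok M -> a < 32 -> i <= X.+2 ^ S ->
  eval eps w M e = Some i -> eval eps w M (addr a e) = Some (ad a i).
Proof.
move=> hM ha hi he; rewrite /addr /= -/Ebase.
have fit32 x : x <= base I + 32 * X.+2 ^ S + 32 -> fit w x = Some x.
  move=> h; rewrite /fit (leq_trans _ fitw) // !expnS.
  move: (X.+2 ^ S) (expX_gt0 S) baseX X32 h => P P0 hb h32 h.
  apply: (@leq_trans (34 * (X.+2 * P))); last by rewrite leq_mul2r; apply/orP; right; lia.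
  have : X.+2 <= X.+2 * P by rewrite leq_pmulr.
  have : P <= X.+2 * P by rewrite leq_pmull.
  lia.
change (obind (fun a0 : nat => obind (fun b : nat => fit w (a0 + b)) 
  (obind (fun a1 => obind (fun b => fit w (a1 + b)) (fit w a)) (obind (fun a1 => obind (fun b => fit w (a1 * b)) (eval eps w M e)) (fit w 32)))) (eval eps w M Ebase) = Some (ad a i)).
move: (X.+2 ^ S) hi fit32 => P hi fit32.
rewrite eval_Ebase // he /= (fit32 32) /=; last by lia.
rewrite (fit32 a) /=; last by lia.
rewrite (fit32 (32 * i)) /=; last by lia.
rewrite (fit32 (32 * i + a)) /=; last by lia.
by rewrite fit32 //; lia.
Qed.

Lemma eval_cell M a e i : dims_ok M -> a < 32 -> i <= X.+2 ^ S ->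
  eval eps w M e = Some i -> M (ad a i) <= X.+2 ^ S ->
  eval eps w M (cell a e) = Some (M (ad a i)).
Proof.
move=> h1 h2 h3 h4 h5; change (obind (fun b => fit w (M b)) (eval eps w M (addr a e)) = Some (M (ad a i))).
by rewrite (eval_addr h1 h2 h3 h4) /= fitE.
Qed.

Lemma eval_reg M a k : dims_ok M -> a < 32 -> k <= X.+2 ^ S -> M (ad a k) <= X.+2 ^ S ->
  eval eps w M (cell a (Cst k)) = Some (M (ad a k)).
Proof. by move=> h1 h2 h3 h4; apply: eval_cell => //=; rewrite fitE. Qed.

Lemma eval_crange M r : input_ok M -> rsz r <= 8 -> eval eps w M (crange r) = Some (erange I r).
Proof.
move=> hM hr; have [h0 h1 h2] := input_ok0 hM; have fitr r' : rsz r' <= 8 -> fit w (erange I r') = Some (erange I r').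
  by move=> h; apply: fitX; have := erangeX h; lia.
elim: r hr => [k||||r1 IH1 r2 IH2|r1 IH1 r2 IH2] /= hr.
- exact: (fitr (RC k)).
- by rewrite fitX //= h0; exact: (fitr RM).
- by rewrite fitX //= h1; exact: (fitr RN).
- by rewrite fitX //= h2; exact: (fitr RP).
- rewrite IH1 ?IH2 /=; try lia; exact: (fitr (RAdd r1 r2)).
- rewrite IH1 ?IH2 /=; try lia; exact: (fitr (RMul r1 r2)).
Qed.

Lemma cost_crange r : cost (crange r) <= 2 * rsz r.
Proof. by elim: r => [k||||r1 IH1 r2 IH2|r1 IH1 r2 IH2] //=; lia. Qed.

Lemma ad_inj a i a' i' : a < 32 -> a' < 32 -> (ad a i == ad a' i') = (a == a') && (i == i').
Proof. by move=> h1 h2; rewrite /ad; lia. Qed.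

Lemma input_ok_upd M a i x : input_ok M -> input_ok (upd M (ad a i) x).
Proof. by move=> h b hb; rewrite /upd; case: eqP => [e|_]; [move: hb; rewrite e /ad; lia|apply: h]. Qed.

Lemma upd_ad M a i x a' i' : a < 32 -> a' < 32 ->
  upd M (ad a i) x (ad a' i') = if (a' == a) && (i' == i) then x else M (ad a' i').
Proof. by move=> h1 h2; rewrite /upd ad_inj. Qed.

Lemma represents_tmp u env M d x : represents u env M -> represents u env (upd M (ad 30 d) x).
Proof.
case=> h1 h2 h3; split; first exact: input_ok_upd.
- by move=> a i ha; rewrite upd_ad ?(ltn_eqF ha) ?h2 //; lia.
- by move=> l hl; rewrite upd_ad //= h3.
Qed.

Lemma represents_var u env M i : represents u env M ->
  represents u (rcons env i) (upd M (ad 31 (size env)) i).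
Proof.
case=> h1 h2 h3; split; first exact: input_ok_upd.
- by move=> a j ha; rewrite upd_ad //=; [case: eqP => [|_] /=; [lia|apply: h2]|lia].
- move=> l; rewrite size_rcons ltnS => hl; rewrite upd_ad //= nth_rcons.
  by case: (ltngtP l (size env)) hl => [h _|//|h _] //; rewrite h3.
Qed.

Lemma represents_rcons u env i M : represents u (rcons env i) M -> represents u env M.
Proof.
case=> h1 h2 h3; split=> // l hl; rewrite h3 ?size_rcons; last lia.
by rewrite nth_rcons hl.
Qed.

Lemma represents_var_last u env i M : represents u (rcons env i) M -> M (ad 31 (size env)) = i.
Proof. by case=> _ _ h; rewrite h ?size_rcons // nth_rcons ltnn eqxx. Qed.

Lemma exec_set M a k x e : dims_ok M -> a < 32 -> k <= X.+2 ^ S -> eval eps w M e = Some x ->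
  exec eps w (Store (addr a (Cst k)) e) M (cost e + 20) (upd M (ad a k) x).
Proof.
move=> hM ha hk he; have -> : cost e + 20 = (cost (addr a (Cst k)) + cost e).+1 by rewrite /=; lia.
by apply: ExecStore => //; apply: eval_addr => //=; rewrite fitE.
Qed.

(* [M] below is the memory at the start of an iteration, loop variable included. *)
Lemma exec_loop l r c (Inv : nat -> memory -> Prop) T M :
  rsz r <= 8 -> l <= X.+2 ^ S -> input_ok M ->
  (forall i M, i < erange I r -> input_ok M -> M (ad 31 l) = i -> Inv i M ->
    exists k M', [/\ exec eps w c M k M', k <= T, input_ok M', M' (ad 31 l) = i
      & Inv i.+1 (upd M' (ad 31 l) i.+1)]) ->
  Inv 0 (upd M (ad 31 l) 0) ->
  exists k M', [/\ exec eps w (loop l r c) M k M', k <= (erange I r).+1 * (T + 200),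
    input_ok M' & Inv (erange I r) M'].
Proof.
move=> hr hl hM hc h0.
have hE := erangeX hr.
have S1 : 0 < S by lia.
have hcond M1 i : input_ok M1 -> M1 (ad 31 l) = i -> i <= erange I r ->
    eval eps w M1 (Bin Leq (Bin Add (var l) (Cst 1)) (crange r)) = Some (i < erange I r : nat).
  move=> hM1 hi ile.
  change (obind (fun a => obind (fun b => fit w (a <= b)) (eval eps w M1 (crange r)))
    (obind (fun a => obind (fun b => fit w (a + b)) (fit w 1)) (eval eps w M1 (var l))) = Some (i < erange I r : nat)).
  have eX : M1 (ad 31 l) <= X.+2 ^ S by rewrite hi; apply: XS => //; lia.
  rewrite eval_reg // hi fitX /=; last by lia.
  rewrite fitX /=; last by lia.
  rewrite eval_crange //= addn1 fitX //; by case: (_ < _).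
have main j : forall i M1, j + i = erange I r -> input_ok M1 -> M1 (ad 31 l) = i -> Inv i M1 ->
    exists k M', [/\ exec eps w (While (Bin Leq (Bin Add (var l) (Cst 1)) (crange r))
       (Seq c (set_var l (Bin Add (var l) (Cst 1))))) M1 k M', k <= j.+1 * (T + 100) + j * 80,
    input_ok M' & Inv (erange I r) M'].
  have cc : cost (Bin Leq (Bin Add (var l) (Cst 1)) (crange r)) <= 60.
    by have := cost_crange r; rewrite /=; lia.
  elim: j => [|j IH] i M1 ji hM1 hi hI.
    exists (cost (Bin Leq (Bin Add (var l) (Cst 1)) (crange r))).+1, M1; split=> //.
    - apply: ExecWhileFalse; rewrite (hcond _ i) //; last by lia.
      by rewrite -ji add0n ltnn.
    - by lia.
    - by rewrite -ji.
  have ilt : i < erange I r by lia.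
  have [k [M' [e1 k1 hM' hi' hI']]] := hc i M1 ilt hM1 hi hI.
  have hM2 := input_ok_upd 31 l i.+1 hM'.
  have hi2 : upd M' (ad 31 l) i.+1 (ad 31 l) = i.+1 by rewrite upd_ad // !eqxx.
  have e2 : exec eps w (set_var l (Bin Add (var l) (Cst 1))) M' 42 (upd M' (ad 31 l) i.+1).
    have eX : M' (ad 31 l) <= X.+2 ^ S by rewrite hi'; apply: XS => //; lia.
    have eE : eval eps w M' (Bin Add (var l) (Cst 1)) = Some i.+1.
      change (obind (fun a => obind (fun b => fit w (a + b)) (fit w 1)) (eval eps w M' (var l)) = Some i.+1).
      rewrite eval_reg // hi' fitX /=; last by lia.
      by rewrite addn1 fitX //; lia.
    exact: (exec_set (input_dims hM') _ hl eE).
  have ji' : j + i.+1 = erange I r by lia.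
  have [k3 [M3 [e3 h3 hM3 hI3]]] := IH i.+1 _ ji' hM2 hi2 hI'.
  exists (cost (Bin Leq (Bin Add (var l) (Cst 1)) (crange r)) + (k + 42) + k3).+1, M3; split=> //.
    apply: (ExecWhileTrue (x := 1)) e3 => //; last exact: ExecSeq e1 e2.
    by rewrite (hcond _ i) ?ilt //; lia.
  by lia.
have hM1 := input_ok_upd 31 l 0 hM.
have hi : upd M (ad 31 l) 0 (ad 31 l) = 0 by rewrite upd_ad // !eqxx.
have [k [M' [e1 k1 hM' hI]]] := main (erange I r) 0 _ (addn0 _) hM1 hi h0.
exists (21 + k), M'; split=> //; last by nia.
apply: ExecSeq e1; apply: (exec_set (e := Cst 0)) => //=; by rewrite fitX.
Qed.

(** One unit of size contributes the factor [Z ^ 16 >= 2 ^ 16], which pays for the constant overhead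
    of a construct: the origin of the 16 in all time bounds. *)
Lemma Z16 k : 4096 * Z ^ k <= Z ^ (k + 16).
Proof.
have z4 : 16 <= Z ^ 4 by apply: (@leq_trans (2 ^ 4)); rewrite // leq_exp2r ?Z2.
have -> : 4096 * Z ^ k = Z ^ k * 1 * 16 * 16 * 16 by lia.
rewrite (_ : k + 16 = k + 4 + 4 + 4 + 4) ?expnD; last by lia.
by rewrite !leq_mul //; apply: leq_trans z4.
Qed.

Lemma Zexp_gt0 k : 0 < Z ^ k. Proof. by rewrite expn_gt0; have := Z2; lia. Qed.

Lemma bound_seq a b k1 k2 k3 : a <= Z ^ (16 * k1) -> b <= Z ^ (16 * k2) -> k1 + k2 < k3 ->
  a + b + 1000 <= Z ^ (16 * k3).
Proof.
move=> ha hb hk; apply: (@leq_trans (Z ^ (16 * (k1 + k2) + 16))); last first.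
  by rewrite leq_pexp2l //; have := Z2; lia.
apply: leq_trans (Z16 _); rewrite (mulnDr 16) expnD.
move: (Zexp_gt0 (16 * k1)) (Zexp_gt0 (16 * k2)) ha hb.
move: (Z ^ (16 * k1)) (Z ^ (16 * k2)) => A B A0 B0 ha hb.
have : A <= A * B by rewrite leq_pmulr.
have : B <= A * B by rewrite leq_pmull.
lia.
Qed.

Lemma bound_loop a r k : a <= Z ^ (16 * k) ->
  (erange I r).+1 * (a + 1000) + 1000 <= Z ^ (16 * (rsz r + k).+1).
Proof.
move=> ha; apply: (@leq_trans (Z ^ (16 * (rsz r + k) + 16))); last first.
  by rewrite leq_pexp2l //; have := Z2; lia.
apply: leq_trans (Z16 _); rewrite (mulnDr 16) expnD.
have : erange I r <= Z ^ (16 * rsz r).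
  by apply: leq_trans (erange_le r) _; rewrite leq_pexp2l //; have := Z2; lia.
move: (Zexp_gt0 (16 * rsz r)) (Zexp_gt0 (16 * k)) ha.
move: (Z ^ (16 * rsz r)) (Z ^ (16 * k)) => A B A0 B0 ha hb.
have : (erange I r).+1 * (a + 1000) <= (2 * A) * (1001 * B) by apply: leq_mul; lia.
have : 0 < A * B by rewrite muln_gt0 A0.
have -> : 2 * A * (1001 * B) = 2002 * (A * B) by lia.
lia.
Qed.

Lemma leS k : k <= S -> k <= X.+2 ^ S.
Proof. by move=> h; apply: leq_trans h (ltnW (ltn_expl _ _)). Qed.

Lemma valS k x : k <= S -> x <= X.+2 ^ k -> x <= X.+2 ^ S.
Proof. by move=> h hx; apply: leq_trans hx _; rewrite leq_pexp2l. Qed.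

Lemma env_rcons env i r : (forall l, nth 0 env l <= X) -> rsz r <= 8 -> i < erange I r ->
  forall l, nth 0 (rcons env i) l <= X.
Proof.
move=> he hr hi l; rewrite nth_rcons; case: ltnP => // _; case: eqP => // _.
by apply: leq_trans (ltnW hi) (erangeX hr).
Qed.

Lemma exec_set_tmp M d x e : input_ok M -> d <= S -> eval eps w M e = Some x -> 
  exec eps w (set_tmp d e) M (cost e + 20) (upd M (ad 30 d) x).
Proof. by move=> hM hd he; apply: exec_set => //; apply: leS. Qed.

(** Serves [TSum] and [TMax] alike: temporary [d] accumulates, temporary [d.+1] receives the current
    term, and [o] is addition or maximum. *)
Lemma exec_fold l d r c e0 (o : nat -> nat -> nat) (f : nat -> nat) (F : nat -> nat) env u M k :
  size env = l -> l <= S -> d < S -> rsz r <= 8 ->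
  represents u env M ->
  F 0 = 0 -> (forall i, i < erange I r -> F i.+1 = o (F i) (f i)) ->
  (forall i, i <= erange I r -> F i <= X.+2 ^ S) ->
  (forall i, i < erange I r -> f i <= X.+2 ^ S) ->
  (forall M x y, input_ok M -> M (ad 30 d) = x -> M (ad 30 d.+1) = y ->
     x <= X.+2 ^ S -> y <= X.+2 ^ S -> o x y <= X.+2 ^ S -> eval eps w M e0 = Some (o x y)) ->
  cost e0 <= 100 ->
  (forall i M, i < erange I r -> represents u (rcons env i) M -> exists t M',
    [/\ exec eps w c M t M', t <= Z ^ (16 * k), represents u (rcons env i) M',
        M' (ad 30 d.+1) = f i & forall d', d' <= d -> M' (ad 30 d') = M (ad 30 d')]) ->
  exists t M', [/\ exec eps w (Seq (set_tmp d (Cst 0)) (loop l r (Seq c (set_tmp d e0)))) M t M',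
    t <= Z ^ (16 * (rsz r + k).+1), represents u env M', M' (ad 30 d) = F (erange I r)
    & forall d', d' < d -> M' (ad 30 d') = M (ad 30 d')].
Proof.
move=> sz lS dS hr hM F0 FS Fle fle he0 ce0 hc.
have hM0 : input_ok M by case: hM.
have e0x := exec_set_tmp hM0 (ltnW dS) (fitX (leq0n X.+2) : eval eps w M (Cst 0) = Some 0).
pose Inv i M' := [/\ represents u (rcons env i) M', M' (ad 30 d) = F i
  & forall d', d' < d -> M' (ad 30 d') = M (ad 30 d')].
have [t [M' [ex ht _ [h1 h2 h3]]]] : exists t M', [/\ exec eps w (loop l r (Seq c (set_tmp d e0))) (upd M (ad 30 d) 0) t M',
    t <= (erange I r).+1 * (Z ^ (16 * k) + 120 + 200), input_ok M' & Inv (erange I r) M'].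
  apply: exec_loop => //; first exact: leS.
  - exact: input_ok_upd.
  - move=> i M1 hi iM1 vi [r1 acc pres].
    have [t [M2 [e2 t2 r2 v2 p2]]] := hc i M1 hi r1.
    have iM2 : input_ok M2 by case: r2.
    have acc2 : M2 (ad 30 d) = F i by rewrite p2.
    have oF : o (F i) (f i) <= X.+2 ^ S by rewrite -FS //; apply: Fle.
    have ee := he0 M2 _ _ iM2 acc2 v2 (Fle _ (ltnW hi)) (fle _ hi) oF.
    exists (t + (cost e0 + 20)), (upd M2 (ad 30 d) (o (F i) (f i))); split.
    + by apply: ExecSeq e2 _; apply: exec_set_tmp => //; apply: ltnW.
    + lia.
    + exact: input_ok_upd.
    + rewrite upd_ad //=; case: r2 => _ _ -> //; last by rewrite size_rcons sz.
      by rewrite nth_rcons sz ltnn eqxx.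
    + split.
      * rewrite -sz; apply: represents_var; apply: represents_rcons; apply: represents_tmp; exact: r2.
      * by rewrite upd_ad // upd_ad //= eqxx FS.
      * move=> d' hd'; rewrite upd_ad // upd_ad //= (ltn_eqF hd') p2 ?pres //; lia.
  - split.
    + by rewrite -sz; apply/represents_var/represents_tmp.
    + by rewrite upd_ad // upd_ad //= eqxx F0.
    + by move=> d' hd'; rewrite upd_ad // upd_ad //= (ltn_eqF hd').
exists (21 + t), M'; split=> //.
- by apply: ExecSeq ex; exact: e0x.
- have hb := bound_loop r (leqnn (Z ^ (16 * k))); apply: leq_trans hb.
  rewrite addnC; apply: leq_add => //; apply: leq_trans ht _.
  by rewrite leq_mul2l; apply/orP; right; lia.
- exact: represents_rcons h1.
Qed.

(** The temporaries form a stack: code for depth [d] leaves those below [d] alone, so the first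
    operand survives the evaluation of the second, and an accumulator survives the folds nested in
    it. *)
Lemma cterm_correct t u env d M : (forall a i, u a i <= X) -> (forall l, nth 0 env l <= X) ->
  wft (size env) t -> d + tsz t <= S -> size env + tsz t <= S -> represents u env M ->
  exists k M', [/\ exec eps w (cterm (size env) d t) M k M', k <= Z ^ (16 * tsz t),
    represents u env M', M' (ad 30 d) = ev eps I u env t
    & forall d', d' < d -> M' (ad 30 d') = M (ad 30 d')].
Proof.
move=> bu.
have leaf M0 c1 k1 M1 d1 e x (s s1 : nat) env1 : exec eps w c1 M0 k1 M1 -> k1 <= Z ^ (16 * s1) -> s1 < s -> s <= S -> d1 <= S -> 
    represents u env1 M1 -> x <= X.+2 ^ S -> eval eps w M1 e = Some x -> cost e <= 300 ->
    (forall d', d' < d1 -> M1 (ad 30 d') = M0 (ad 30 d')) ->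
    exists k M', [/\ exec eps w (Seq c1 (set_tmp d1 e)) M0 k M', k <= Z ^ (16 * s),
      represents u env1 M', M' (ad 30 d1) = x & forall d', d' < d1 -> M' (ad 30 d') = M0 (ad 30 d')].
  move=> ex1 hk1 hs hS hd hM1 hx he ce pres.
  have iM1 : input_ok M1 by case: hM1.
  exists (k1 + (cost e + 20)), (upd M1 (ad 30 d1) x); split.
  - by apply: ExecSeq ex1 _; apply: exec_set_tmp.
  - have := bound_seq hk1 (leq0n (Z ^ (16 * 0))) (_ : s1 + 0 < s); rewrite addn0 => /(_ hs); lia.
  - exact: represents_tmp.
  - by rewrite upd_ad //= eqxx.
  - by move=> d' hd'; rewrite upd_ad //= (ltn_eqF hd') pres.
have tv d1 x M1 : M1 (ad 30 d1) = x -> x <= X.+2 ^ S -> d1 <= S -> input_ok M1 ->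
    eval eps w M1 (tmp d1) = Some x.
  by move=> <- h1 h2 h3; apply: eval_reg => //; apply: leS.
elim: t env d M => [r|t IH|a t IH|l|o t1 IH1 t2 IH2|t1 IH1 t2 IH2|r t IH|r t IH] env d M he wf hd hl hM; have iM : input_ok M by [case: hM]; rewrite /= in wf hd hl.
- have hx := ev_le bu he (wf : wft (size env) (TRange r)).
  have hS : erange I r <= X.+2 ^ S by apply: (valS (k := rsz r)) => //; lia.
  exists (cost (crange r) + 20), (upd M (ad 30 d) (erange I r)); split.
  + by apply: exec_set_tmp; rewrite ?eval_crange //; lia.
  + have h1 : Z ^ (16 * 0) <= Z ^ (16 * 0) by [].
    have := bound_seq h1 h1 (_ : 0 + 0 < rsz r); have := cost_crange r.
    by move=> h2 h3; have {}h3 := h3 ltac:(by case: (r)); change (tsz (TRange r)) with (rsz r); lia.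
  + exact: represents_tmp.
  + by rewrite upd_ad //= eqxx.
  + by move=> d' hd'; rewrite upd_ad //= (ltn_eqF hd').
- have [||k [M1 [e1 k1 r1 v1 p1]]] := IH env d M he wf _ _ hM; [lia|lia|].
  have iM1 : input_ok M1 by case: r1.
  have hx := ev_le bu he wf; have hS : ev eps I u env t <= X.+2 ^ S by apply: valS hx; lia.
  have et : eval eps w M1 (tmp d) = Some (ev eps I u env t) by apply: tv => //; lia.
  apply: (leaf _ _ _ M1 d _ _ _ (tsz t) _ e1) => //; try by rewrite /=; lia.
    by apply: XS; [lia|apply: leq_trans (inputX _) _; lia].
  change (obind (fun a => fit w (M1 a)) (obind (fun a => obind (fun b => fit w (a * b)) 
    (obind (fun a => obind (fun b => fit w (a <= b)) (eval eps w M1 Ebase))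
       (obind (fun a => obind (fun b => fit w (a + b)) (fit w 1)) (eval eps w M1 (tmp d)))))
     (eval eps w M1 (tmp d))) = Some (input_memory I (ev eps I u env t * (ev eps I u env t < base I)))).
  rewrite et eval_Ebase // (fitX (x := 1)) //= addn1.
  have hS1 : (ev eps I u env t).+1 <= X.+2 ^ S.
    have h : (X.+2 ^ tsz t).+1 <= X.+2 ^ (tsz t).+1.
      by rewrite expnS; have := expX_gt0 (tsz t); move: (X.+2 ^ _) => P; nia.
    apply: leq_trans (_ : X.+2 ^ (tsz t).+1 <= _); first by lia.
    by rewrite leq_pexp2l //; lia.
  rewrite fitE //= (fitX (x := _ < _)) /=; last by case: (_ < _).
  have bb : ev eps I u env t * (ev eps I u env t < base I) < base I.
    by case: (ltnP (ev eps I u env t)) => h; rewrite ?muln1 ?muln0 // /base.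
  rewrite fitE /=; last by apply: leq_trans hS; case: (ev eps I u env t < base I); rewrite ?muln1 ?muln0.
  by rewrite iM1 // fitX //; apply: leq_trans (inputX _) _; lia.
- case/andP: wf => ha wf.
  have [||k [M1 [e1 k1 r1 v1 p1]]] := IH env d M he wf _ _ hM; [lia|lia|].
  have iM1 : input_ok M1 by case: r1.
  have hx := ev_le bu he wf; have hS : ev eps I u env t <= X.+2 ^ S by apply: valS hx; lia.
  have et : eval eps w M1 (tmp d) = Some (ev eps I u env t) by apply: tv => //; lia.
  have uS : u a (ev eps I u env t) <= X.+2 ^ S by apply: XS; [lia|apply: leq_trans (bu _ _) _; lia].
  apply: (leaf _ _ _ M1 d _ _ _ (tsz t) _ e1) => //; try by rewrite /=; lia.
  rewrite (eval_cell (input_dims iM1) (i := ev eps I u env t)) //; try lia.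
    by case: r1 => _ -> .
  by case: r1 => _ ->.
- have vS : nth 0 env l <= X.+2 ^ S by apply: XS; [lia|apply: leq_trans (he _) _; lia].
  have vM : M (ad 31 l) = nth 0 env l by case: hM => _ _ ->.
  exists (20 + 20), (upd M (ad 30 d) (nth 0 env l)); split.
  + apply: (exec_set_tmp (e := var l)) => //; first by lia.
    by rewrite /var eval_reg ?vM //; apply: leS; lia.
  + have h1 : Z ^ (16 * 0) <= Z ^ (16 * 0) by [].
    have := bound_seq h1 h1 (_ : 0 + 0 < tsz (TVar l)); move=> h3; have := h3 isT; lia.
  + exact: represents_tmp.
  + by rewrite upd_ad //= eqxx.
  + by move=> d' hd'; rewrite upd_ad //= (ltn_eqF hd').
- case/andP: (wf) => wf1 wf2.
  have [||k1 [M1 [e1 t1k r1 v1 p1]]] := IH1 env d M he wf1 _ _ hM; [lia|lia|].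
  have [||k2 [M2 [e2 t2k r2 v2 p2]]] := IH2 env d.+1 M1 he wf2 _ _ r1; [lia|lia|].
  have iM2 : input_ok M2 by case: r2.
  have h1 := ev_le bu he wf1; have h2 := ev_le bu he wf2.
  have h3 : ev eps I u env (TBin o t1 t2) <= X.+2 ^ S.
    by apply: (valS (k := (tsz t1 + tsz t2).+1)); [lia|exact: (ev_le bu he (wf : wft (size env) (TBin o t1 t2)))].
  pose x := ev eps I u env t1; pose y := ev eps I u env t2; rewrite -/x -/y in h1 h2.
  have hx : x <= X.+2 ^ S by apply: valS h1; lia.
  have hy : y <= X.+2 ^ S by apply: valS h2; lia.
  have et1 : eval eps w M2 (tmp d) = Some x by apply: tv => //; [rewrite p2 // v1|lia].
  have et2 : eval eps w M2 (tmp d.+1) = Some y by apply: tv => //; lia.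
  exists (k1 + (k2 + (cost (Bin o (tmp d) (tmp d.+1)) + 20))), (upd M2 (ad 30 d) (binop_eval o x y)); split.
  + apply: ExecSeq e1 _; apply: ExecSeq e2 _; apply: exec_set_tmp => //; first by lia.
    change (obind (fun a => obind (fun b => fit w (binop_eval o a b)) (eval eps w M2 (tmp d.+1))) (eval eps w M2 (tmp d)) = Some (binop_eval o x y)).
    by rewrite et1 et2 /= fitE.
  + have := bound_seq t1k t2k (ltnSn _).
    have -> : cost (Bin o (tmp d) (tmp d.+1)) = 41 by [].
    rewrite [tsz (TBin _ _ _)]/=; lia.
  + exact: represents_tmp.
  + by rewrite upd_ad //= eqxx.
  + by move=> d' hd'; rewrite upd_ad //= (ltn_eqF hd') p2 ?p1 //; lia.
- case/andP: (wf) => wf1 wf2.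
  have [||k1 [M1 [e1 t1k r1 v1 p1]]] := IH1 env d M he wf1 _ _ hM; [lia|lia|].
  have [||k2 [M2 [e2 t2k r2 v2 p2]]] := IH2 env d.+1 M1 he wf2 _ _ r1; [lia|lia|].
  have iM2 : input_ok M2 by case: r2.
  have h1 := ev_le bu he wf1; have h2 := ev_le bu he wf2.
  pose x := ev eps I u env t1; pose y := ev eps I u env t2; rewrite -/x -/y in h1 h2.
  have hx : x <= X.+2 ^ S by apply: valS h1; lia.
  have hy : y <= X.+2 ^ S by apply: valS h2; lia.
  have et1 : eval eps w M2 (tmp d) = Some x by apply: tv => //; [rewrite p2 // v1|lia].
  have et2 : eval eps w M2 (tmp d.+1) = Some y by apply: tv => //; lia.
  exists (k1 + (k2 + (cost (EpsGe (tmp d) (tmp d.+1)) + 20))), (upd M2 (ad 30 d) (y%:R <= x%:R * eps)%R); split.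
  + apply: ExecSeq e1 _; apply: ExecSeq e2 _; apply: exec_set_tmp => //; first by lia.
    change (obind (fun a => obind (fun b => fit w (b%:R <= a%:R * eps)%R) (eval eps w M2 (tmp d.+1))) (eval eps w M2 (tmp d)) = Some ((y%:R <= x%:R * eps)%R : nat)).
    by rewrite et1 et2 /= fitX //; case: (_ <= _)%R.
  + have := bound_seq t1k t2k (ltnSn _).
    have -> : cost (EpsGe (tmp d) (tmp d.+1)) = 41 by [].
    rewrite [tsz (TEps _ _)]/=; lia.
  + exact: represents_tmp.
  + by rewrite upd_ad //= eqxx.
  + by move=> d' hd'; rewrite upd_ad //= (ltn_eqF hd') p2 ?p1 //; lia.
- case/andP: (wf) => hr wf1.
  have hT := ev_le bu he (wf : wft (size env) (TSum r t)).
  have hTS : ev eps I u env (TSum r t) <= X.+2 ^ S by apply: valS hT; rewrite /=; lia.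
  have fle i : i < erange I r -> ev eps I u (rcons env i) t <= X.+2 ^ S.
    move=> hi; apply: (valS (k := tsz t)); first by lia.
    by apply: ev_le => //; [exact: env_rcons hi|rewrite size_rcons].
  pose F i := \sum_(j < i) ev eps I u (rcons env j) t.
  have F0 : F 0 = 0 by rewrite /F big_ord0.
  have Fr i : i < erange I r -> F i.+1 = addn (F i) (ev eps I u (rcons env i) t) by rewrite /F big_ord_recr.
  have Fle i : i <= erange I r -> F i <= X.+2 ^ S.
    move=> hi; apply: leq_trans hTS; rewrite /F /= -!(big_mkord xpredT (fun j => ev eps I u (rcons env j) t)).
    by rewrite (big_cat_nat (leq0n i) hi) leq_addr.
  have [k [M' [h1 h2 h3 h4 h5]]] := @exec_fold (size env) d r (cterm (size env).+1 d.+1 t)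
    (Bin Add (tmp d) (tmp d.+1)) addn (fun i => ev eps I u (rcons env i) t)
    F env u M (tsz t) erefl 
    ltac:(lia) ltac:(lia) hr hM F0
    Fr
    Fle fle
    ltac:(move=> M1 x y iM1 h1 h2 h3 h4 h5;
      change (obind (fun a => obind (fun b => fit w (a + b)) (eval eps w M1 (tmp d.+1))) (eval eps w M1 (tmp d)) = Some (x + y));
      rewrite (tv d x) // ?(tv d.+1 y) //= ?fitE //; lia) isT
    ltac:(move=> i M1 hi hM1; rewrite -(size_rcons env i);
      have [||||k [M2 [e2 k2 r2 v2 p2]]] := IH (rcons env i) d.+1 M1 _ _ _ _ hM1; [exact: env_rcons hi|by rewrite size_rcons|lia|rewrite size_rcons; lia|];
      by exists k, M2; split=> // d' hd'; apply: p2; lia).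
  by exists k, M'; split.
- case/andP: (wf) => hr wf1.
  have hT := ev_le bu he (wf : wft (size env) (TMax r t)).
  have hTS : ev eps I u env (TMax r t) <= X.+2 ^ S by apply: valS hT; rewrite /=; lia.
  have fle i : i < erange I r -> ev eps I u (rcons env i) t <= X.+2 ^ S.
    move=> hi; apply: (valS (k := tsz t)); first by lia.
    by apply: ev_le => //; [exact: env_rcons hi|rewrite size_rcons].
  pose F i := \max_(j < i) ev eps I u (rcons env j) t.
  have F0 : F 0 = 0 by rewrite /F big_ord0.
  have Fr i : i < erange I r -> F i.+1 = maxn (F i) (ev eps I u (rcons env i) t) by rewrite /F big_ord_recr.
  have Fle i : i <= erange I r -> F i <= X.+2 ^ S.
    move=> hi; apply/bigmax_leqP => j _; apply: fle; apply: leq_trans hi; exact: ltn_ord.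
  have [k [M' [h1 h2 h3 h4 h5]]] := @exec_fold (size env) d r (cterm (size env).+1 d.+1 t)
    (Bin Add (tmp d) (Bin Sub (tmp d.+1) (tmp d))) maxn (fun i => ev eps I u (rcons env i) t)
    F env u M (tsz t) erefl 
    ltac:(lia) ltac:(lia) hr hM F0
    Fr
    Fle fle
    ltac:(move=> M1 x y iM1 h1 h2 h3 h4 h5;
      change (obind (fun a => obind (fun b => fit w (a + b)) (obind (fun a => obind (fun b => fit w (a - b)) (eval eps w M1 (tmp d))) (eval eps w M1 (tmp d.+1)))) (eval eps w M1 (tmp d)) = Some (maxn x y));
      rewrite (tv d x) // ?(tv d.+1 y) //= ?(fitE (x := y - x)) /= ?maxnE ?fitE -?maxnE //; lia) isT
    ltac:(move=> i M1 hi hM1; rewrite -(size_rcons env i);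
      have [||||k [M2 [e2 k2 r2 v2 p2]]] := IH (rcons env i) d.+1 M1 _ _ _ _ hM1; [exact: env_rcons hi|by rewrite size_rcons|lia|rewrite size_rcons; lia|];
      by exists k, M2; split=> // d' hd'; apply: p2; lia).
  by exists k, M'; split.
Qed.

Lemma represents_setc u env M a i x : a < 30 -> represents u env M ->
  represents (setc u a i x) env (upd M (ad a i) x).
Proof.
move=> ha [h1 h2 h3]; split; first exact: input_ok_upd.
- move=> b j hb; rewrite upd_ad ?h2 /setc //; try lia.
  by case: eqP => [->|]; case: eqP => //= ->.
- move=> l hl; rewrite upd_ad ?h3 //; last by lia.
  by rewrite (gtn_eqF (_ : a < 31)) //; lia.
Qed.

(** All loops run over ranges, so the time bound depends on the syntax only and [wp] has to speak
    about values, never about time. *)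
Lemma cstmt_correct s u env M (Q : state -> Prop) :
  (forall a i, u a i <= X) -> (forall l, nth 0 env l <= X) ->
  wfs (size env) s -> ssz s < S -> size env + ssz s <= S -> represents u env M ->
  wp eps I X s env u Q ->
  exists k M' u', [/\ exec eps w (cstmt (size env) s) M k M', k <= Z ^ (16 * ssz s),
    represents u' env M', forall a i, u' a i <= X & Q u'].
Proof.
have z0 : Z ^ (16 * 0) <= Z ^ (16 * 0) by [].
elim: s u env M Q => [|a t1 t2|s1 IH1 s2 IH2|t s1 IH1 s2 IH2|r s IH] u env M Q bu he wf hd hl hM /=; rewrite /= in wf hd hl.
- move=> hQ; exists 1, M, u; split=> //; first exact: ExecSkip.
  by have := Zexp_gt0 (16 * 1).
- case/and3P: wf => ha wf1 wf2 [b1 b2 hQ].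
  have [||k1 [M1 [e1 t1k r1 v1 p1]]] := cterm_correct (d := 0) bu he wf1 _ _ hM; [lia|lia|].
  have [||k2 [M2 [e2 t2k r2 v2 p2]]] := cterm_correct (d := 1) bu he wf2 _ _ r1; [lia|lia|].
  have iM2 : input_ok M2 by case: r2.
  set x := ev eps I u env t1 in v1 b1 hQ; set y := ev eps I u env t2 in v2 b2 hQ.
  have hx : x <= X.+2 ^ S by apply: XS; lia.
  have hy : y <= X.+2 ^ S by apply: XS; lia.
  have S0' : 0 <= X.+2 ^ S by [].
  have et1 : eval eps w M2 (tmp 0) = Some x.
    by rewrite -v1 -(p2 0) //; apply: eval_reg => //; rewrite p2 // v1.
  have et2 : eval eps w M2 (tmp 1) = Some y by rewrite -v2; apply: eval_reg; rewrite ?v2 //; apply: leS; lia.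
  exists (k1 + (k2 + (cost (addr a (tmp 0)) + cost (tmp 1)).+1)), (upd M2 (ad a x) y), (setc u a x y).
  split=> //.
  + apply: ExecSeq e1 _; apply: ExecSeq e2 _; apply: ExecStore => //.
    by apply: eval_addr => //; lia.
  + have -> : (cost (addr a (tmp 0)) + cost (tmp 1)).+1 = 59 by [].
    by have := bound_seq t1k t2k (_ : tsz t1 + tsz t2 < (a + tsz t1 + tsz t2).+1); move=> /(_ ltac:(lia)); lia.
  + exact: represents_setc.
  + by move=> b j; rewrite /setc; case: eqP => // _; case: eqP.
- case/andP: wf => wf1 wf2 h.
  have [||k1 [M1 [u1 [e1 t1k r1 b1 q1]]]] := IH1 u env M _ bu he wf1 _ _ hM h; [lia|lia|].
  have [||k2 [M2 [u2 [e2 t2k r2 b2 q2]]]] := IH2 u1 env M1 _ b1 he wf2 _ _ r1 (q1 b1); [lia|lia|].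
  exists (k1 + k2), M2, u2; split=> //; first exact: ExecSeq e2.
  by have := bound_seq t1k t2k (ltnSn _); lia.
- case/and3P: wf => wf0 wf1 wf2 [h1 h2].
  have [||k0 [M0 [e0 t0k r0 v0 p0]]] := cterm_correct (d := 0) bu he wf0 _ _ hM; [lia|lia|].
  have iM0 : input_ok M0 by case: r0.
  have hx : ev eps I u env t <= X.+2 ^ S by apply: valS (ev_le bu he wf0); lia.
  have et : eval eps w M0 (tmp 0) = Some (ev eps I u env t).
    by rewrite -v0; apply: eval_reg => //; rewrite v0.
  have cost0 : cost (tmp 0) = 20 by [].
  have [z|nz] := eqVneq (ev eps I u env t) 0.
    have [||k2 [M2 [u2 [e2 t2k r2 b2 q2]]]] := IH2 u env M0 _ bu he wf2 _ _ r0 (h2 z); [lia|lia|].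
    exists (k0 + (cost (tmp 0) + k2).+1), M2, u2; split=> //.
      by apply: ExecSeq e0 _; apply: ExecIfFalse e2; rewrite et z.
    have := bound_seq t0k t2k (_ : _ < (tsz t + ssz s1 + ssz s2).+1); move=> /(_ ltac:(lia)); lia.
  have [||k2 [M2 [u2 [e2 t2k r2 b2 q2]]]] := IH1 u env M0 _ bu he wf1 _ _ r0 (h1 nz); [lia|lia|].
  exists (k0 + (cost (tmp 0) + k2).+1), M2, u2; split=> //.
    by apply: ExecSeq e0 _; apply: ExecIfTrue et nz e2.
  have := bound_seq t0k t2k (_ : _ < (tsz t + ssz s1 + ssz s2).+1); move=> /(_ ltac:(lia)); lia.
- case/andP: wf => hr wf1 [Inv [i0 iS iQ]].
  have iM : input_ok M by case: hM.
  have [k [M' [ex hk _ [u' [r' b' q']]]]] : exists k M', [/\ exec eps w (loop (size env) r (cstmt (size env).+1 s)) M k M',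
      k <= (erange I r).+1 * (Z ^ (16 * ssz s) + 200), input_ok M' &
      exists u', [/\ represents u' (rcons env (erange I r)) M', forall a i, u' a i <= X & Inv (erange I r) u']].
    apply: (@exec_loop (size env) r _ (fun i M' => exists u', [/\ represents u' (rcons env i) M', forall a i, u' a i <= X & Inv i u'])) => //.
    + by apply: leS; lia.
    + move=> i M1 hi iM1 vi [u1 [r1 b1 I1]].
      have he' := env_rcons he hr hi.
      have sz := size_rcons env i.
      have [|||k [M2 [u2 [e2 t2k r2 b2 q2]]]] := IH u1 (rcons env i) M1 _ b1 he' _ _ _ r1 (iS i u1 hi b1 I1); rewrite ?sz //; [lia|lia|].
      exists k, M2; split=> //; first by rewrite -sz.
      * by case: r2.
      * exact: represents_var_last r2.
      * exists u2; split=> //; apply: represents_var; exact: represents_rcons r2.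
    + by exists u; split=> //; apply: represents_var.
  exists k, M', u'; split=> //.
  + have hb := bound_loop r (leqnn (Z ^ (16 * ssz s))); apply: leq_trans hb.
    apply: leq_trans hk _; apply: leq_trans (leq_addr _ _); rewrite leq_mul2l; apply/orP; right; lia.
  + exact: represents_rcons r'.
  + exact: iQ.
Qed.

Definition while_cell g s := While (cell g (Cst 0)) (cstmt 0 s).

(** The number of rounds of the two outer searches is not polynomial in [Z]. It comes from an
    invariant indexed by the round, which must force [i < T] as long as the guard is on. *)
Lemma exec_while g s (Inv : nat -> state -> Prop) T u M :
  g < 30 -> wfs 0 s -> ssz s < S ->
  (forall i u, (forall a j, u a j <= X) -> Inv i u -> u g 0 != 0 ->
     i < T /\ wp eps I X s [::] u (Inv i.+1)) ->
  (forall a i, u a i <= X) -> represents u [::] M -> Inv 0 u ->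
  exists k M' u', [/\ exec eps w (while_cell g s) M k M', k <= T.+1 * (Z ^ (16 * ssz s) + 30),
    represents u' [::] M', forall a i, u' a i <= X & u' g 0 = 0 /\ exists i, Inv i u'].
Proof.
move=> hg wf hs step bu hM h0.
have he l : nth 0 [::] l <= X by rewrite nth_nil.
have ec u1 M1 : (forall a i, u1 a i <= X) -> represents u1 [::] M1 -> eval eps w M1 (cell g (Cst 0)) = Some (u1 g 0).
  move=> b1 [h1 h2 _]; rewrite -(h2 g 0) //; apply: eval_reg => //; first by lia.
  by rewrite h2 //; apply: XS; [lia|apply: leq_trans (b1 _ _) _; lia].
suff main j : forall i u M, i + j = T -> (forall a i, u a i <= X) -> represents u [::] M -> Inv i u ->
  exists k M' u', [/\ exec eps w (while_cell g s) M k M', k <= j.+1 * (Z ^ (16 * ssz s) + 30),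
    represents u' [::] M', forall a i, u' a i <= X & u' g 0 = 0 /\ exists i, Inv i u'].
  exact: (main T 0 u M (add0n _) bu hM h0).
have cc : cost (cell g (Cst 0)) = 20 by [].
elim: j => [|j IH] i u1 M1 ij b1 r1 I1.
  have [z|nz] := eqVneq (u1 g 0) 0; last by have [] := step i u1 b1 I1 nz; lia.
  exists (cost (cell g (Cst 0))).+1, M1, u1; split=> //.
  - by apply: ExecWhileFalse; rewrite (ec u1) // z.
  - lia.
  - by split=> //; exists i.
have [z|nz] := eqVneq (u1 g 0) 0.
  exists (cost (cell g (Cst 0))).+1, M1, u1; split=> //.
  - by apply: ExecWhileFalse; rewrite (ec u1) // z.
  - lia.
  - by split=> //; exists i.
have [iT w1] := step i u1 b1 I1 nz.
have [k2 [M2 [u2 [e2 t2 r2 b2 q2]]]] := cstmt_correct b1 he wf hs (ltnW hs : size [::] + ssz s <= S) r1 w1.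
have [|k3 [M3 [u3 [e3 t3 r3 b3 q3]]]] := IH i.+1 u2 M2 _ b2 r2 q2; first by lia.
exists (cost (cell g (Cst 0)) + k2 + k3).+1, M3, u3; split=> //.
  by apply: ExecWhileTrue nz e2 e3; apply: ec.
lia.
Qed.

(* Copies array [a] to the words from 1 on. Words 0 and 1, from which addresses
   are computed, are overwritten last. *)
Definition emit a :=
  Seq (set_var 0 (Bin Sub (Bin Mul (Deref (Cst 1)) (Deref (Cst 0))) (Cst 1)))
  (Seq (While (var 0) (Seq (Store (Bin Add (Cst 1) (var 0)) (cell a (var 0)))
                           (set_var 0 (Bin Sub (var 0) (Cst 1)))))
  (Seq (Store (Cst 1) (cell a (Cst 0))) (Store (Cst 0) (Cst 1)))).

Lemma exec_emit a u M : a < 30 -> agents I * items I <= X -> represents u [::] M ->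
  (forall a i, u a i <= X) ->
  exists k M', [/\ exec eps w (emit a) M k M', k <= (agents I * items I).+1 * 300, M' 0 = 1
    & forall c, c < agents I * items I -> M' (1 + c) = u a c].
Proof.
move=> ha nmX [iM hu _] bu; set L := agents I * items I in nmX *.
have LX : L.-1 <= X by lia.
have S1 : 0 < S by lia.
have small x : x <= X -> x <= X.+2 ^ S by move=> h; apply: XS => //; lia.
pose Inv c M' := [/\ dims_ok M', forall i, M' (ad a i) = u a i, M' (ad 31 0) = c
  & forall j, c < j -> j < L -> M' (1 + j) = u a j].
have var0 M' c : c <= X -> Inv c M' -> eval eps w M' (var 0) = Some c.
  by move=> cX [d _ hc _]; rewrite -hc; apply: eval_reg; rewrite ?hc //; apply: small.
have cellc M' c e : c <= X -> Inv c M' -> eval eps w M' e = Some c -> eval eps w M' (cell a e) = Some (u a c).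
  move=> cX [d hu' _ _] he; rewrite -(hu' c); apply: eval_cell => //; first by lia.
    exact: small.
  by rewrite hu'; apply: small.
have d0 := input_dims iM.
have e0 : eval eps w M (Bin Sub (Bin Mul (Deref (Cst 1)) (Deref (Cst 0))) (Cst 1)) = Some L.-1.
  have [h0 h1] := d0; have nX : agents I <= X by have := Z_le_X; rewrite /Z; lia.
  have mX : items I <= X by have := Z_le_X; rewrite /Z; lia.
  rewrite /= (fitX (x := 1)) //= h1 (fitX (x := agents I)) /=; last by lia.
  rewrite (fitX (x := 0)) //= h0 (fitX (x := items I)) /=; last by lia.
  rewrite -/L (fitX (x := L)) /=; last by lia.
  by rewrite subn1 fitX //; lia.
have x0 := exec_set d0 (isT : 31 < 32) (leq0n _) e0.
have I0 : Inv L.-1 (upd M (ad 31 0) L.-1).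
  split.
  - by case: d0 => h0 h1; split; rewrite /upd /ad ltn_eqF // /base.
  - by move=> i; rewrite upd_ad //; [rewrite (ltn_eqF (_ : a < 31)) ?hu //; lia|lia].
  - by rewrite upd_ad // !eqxx.
  - by move=> j; lia.
have main c : forall M', c <= L.-1 -> Inv c M' -> exists k M2, [/\ exec eps w 
    (While (var 0) (Seq (Store (Bin Add (Cst 1) (var 0)) (cell a (var 0)))
                           (set_var 0 (Bin Sub (var 0) (Cst 1))))) M' k M2,
    k <= c.+1 * 150 & Inv 0 M2].
  have cv : cost (var 0) = 20 by [].
  have cs : cost (Bin Add (Cst 1) (var 0)) + cost (cell a (var 0)) = 61 by [].
  elim: c => [|c IH] M' cL I1.
    exists (cost (var 0)).+1, M'; split=> //; first by apply: ExecWhileFalse; apply: var0 I1.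
  have cX : c.+1 <= X by lia.
  have v1 := var0 _ _ cX I1.
  have t1 : eval eps w M' (Bin Add (Cst 1) (var 0)) = Some (1 + c.+1).
    change (obind (fun a => obind (fun b => fit w (a + b)) (eval eps w M' (var 0))) (fit w 1) = Some (1 + c.+1)).
    by rewrite v1 (fitX (x := 1)) //= fitX //; lia.
  have st := ExecStore t1 (cellc _ _ _ cX I1 v1).
  set M1 := upd M' (1 + c.+1) (u a c.+1) in st.
  (* The output area ends below [base I], so copying never destroys a cell that is still to be
     copied. *)
  have lb : 1 + c.+1 < base I by rewrite /base -/L; lia.
  have I1' : Inv c.+1 M1.
    case: I1 => d h1 h2 h3; split.
    - by case: d => g0 g1; split; rewrite /M1 /upd.
    - by move=> i; rewrite /M1 /upd gtn_eqF ?h1 // /ad; lia.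
    - by rewrite /M1 /upd gtn_eqF ?h2 // /ad; lia.
    - by move=> j cj jL; rewrite /M1 /upd gtn_eqF ?h3 //; lia.
  have v1' := var0 _ _ cX I1'.
  have t2 : eval eps w M1 (Bin Sub (var 0) (Cst 1)) = Some c.
    change (obind (fun a => obind (fun b => fit w (a - b)) (fit w 1)) (eval eps w M1 (var 0)) = Some c).
    by rewrite v1' (fitX (x := 1)) //= subn1 fitX //=; lia.
  have st2 := exec_set (let: And4 d _ _ _ := I1' in d) (isT : 31 < 32) (leq0n _) t2.
  have I2 : Inv c (upd M1 (ad 31 0) c).
    case: I1' => d h1 h2 h3; split.
    - by case: d => g0 g1; split; rewrite /upd /ad ltn_eqF // /base.
    - by move=> i; rewrite upd_ad //; [rewrite (ltn_eqF (_ : a < 31)) ?h1 //; lia|lia].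
    - by rewrite upd_ad // !eqxx.
    - move=> j cj jL; have jb : 1 + j < base I by rewrite /base -/L; lia.
      rewrite {1}/upd ltn_eqF; last by rewrite /ad; lia.
      have [->|ne] := eqVneq j c.+1; first by rewrite /M1 /upd eqxx.
      by apply: h3 => //; lia.
  have [k [M2 [e2 hk h2]]] := IH _ (ltnW cL) I2.
  exists (cost (var 0) + ((cost (Bin Add (Cst 1) (var 0)) + cost (cell a (var 0))).+1 + (cost (Bin Sub (var 0) (Cst 1)) + 20)) + k).+1, M2.
  split=> //.
  - by apply: ExecWhileTrue v1 _ _ e2 => //; apply: ExecSeq st st2.
  - rewrite cs cv; have -> : cost (Bin Sub (var 0) (Cst 1)) = 22 by []. 
    lia.
have [k [M2 [e2 hk I2]]] := main _ _ (leqnn _) I0.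
have t1 : eval eps w M2 (Cst 1) = Some 1 by rewrite /= fitX.
have c0 := cellc _ _ _ (leq0n X) I2 (fitX (leq0n _) : eval eps w M2 (Cst 0) = Some 0).
have s1 := ExecStore t1 c0; set M3 := upd M2 1 (u a 0) in s1.
have s2 := ExecStore (fitX (leq0n _) : eval eps w M3 (Cst 0) = Some 0) (fitX (isT : 1 <= X.+2) : eval eps w M3 (Cst 1) = Some 1).
exists (cost (Bin Sub (Bin Mul (Deref (Cst 1)) (Deref (Cst 0))) (Cst 1)) + 20 + (k + ((cost (Cst 1) + cost (cell a (Cst 0))).+1 + (cost (Cst 0) + cost (Cst 1)).+1))), (upd M3 0 1).
split=> //.
- apply: ExecSeq x0 _; apply: ExecSeq e2 _; exact: ExecSeq s1 s2.
- have -> : cost (Bin Sub (Bin Mul (Deref (Cst 1)) (Deref (Cst 0))) (Cst 1)) = 7 by [].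
  have -> : (cost (Cst 1) + cost (cell a (Cst 0))).+1 = 22 by [].
  have -> : (cost (Cst 0) + cost (Cst 1)).+1 = 3 by [].
  lia.
- move=> c cL; rewrite /upd gtn_eqF ?add1n //= /M3 /upd.
  by case: c cL => [|c] cL //=; case: I2 => _ _ _ h; rewrite -add1n h.
Qed.

End Compilation.

(** * Hashing and mixed radix digits *)

Lemma sum_mul a b (f : nat -> nat) :
  \sum_(z < a * b) f z = \sum_(i < a) \sum_(j < b) f (i * b + j).
Proof.
rewrite -!(big_mkord xpredT f); elim: a => [|a IH]; first by rewrite mul0n big_ord0 big_nil.
rewrite big_ord_recr /= -IH mulSnr (big_cat_nat (leq0n _) (leq_addr _ _)) /=; congr (_ + _).
by rewrite -{1}[a * b]add0n big_addn addKn big_mkord; apply: eq_bigr => i _; rewrite addnC.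
Qed.

(** Replace each [a] by the [d] numbers [a d + j] with [j < d]: if [a d + c] falls into the window,
    all of them fall into the window widened by [d]. Together they run once through [[0, N d)],
    where every residue occurs exactly [d] times. *)
Lemma count_window N d w c : 0 < N -> 0 < d ->
  \sum_(a < N) ((a * d + c) %% N < w) <= w + d.
Proof.
move=> N0 d0; rewrite -(leq_pmul2r d0).
apply: (@leq_trans (\sum_(z < N * d) ((z + c) %% N < w + d))).
  rewrite (sum_mul _ _ (fun z => (z + c) %% N < w + d : nat)) big_distrl /=; apply: leq_sum => a _.
  case: ltnP => // h; rewrite mul1n -{1}[d]card_ord -sum1_card; apply: leq_sum => j _.
  rewrite addnAC -modnDml (leq_ltn_trans (leq_mod _ _)) //.
  by rewrite -addnS leq_add ?ltn_ord // ltnW.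
rewrite [N * d]mulnC (sum_mul _ _ (fun z => (z + c) %% N < w + d : nat)).
have -> : (w + d) * d = \sum_(q < d) (w + d) by rewrite sum_nat_const card_ord mulnC.
apply: leq_sum => q _.
pose h (r : 'I_N) := Ordinal (ltn_pmod (r + c) N0).
have h_inj : injective h.
  move=> r r' /(congr1 val) /= /eqP; rewrite eqn_modDr !modn_small // => /eqP.
  exact: val_inj.
rewrite (eq_bigr (fun r => h r < w + d : nat)); last first.
  by move=> r _ /=; rewrite -addnA modnMDl.
rewrite -(reindex_inj (P := xpredT) (F := fun r : 'I_N => (r < w + d : nat)) h_inj) /=.
rewrite -(big_mkord xpredT (fun r => (r < w + d : nat))).
have [h1|/ltnW h1] := leqP (w + d) N.
  rewrite (big_cat_nat (leq0n _) h1) /= -[leqRHS]addn0 leq_add //.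
    rewrite -{3}[w + d]subn0 -[leqRHS]muln1 -sum_nat_const_nat; apply: leq_sum => i _; exact: leq_b1.
  by rewrite big_nat big1 // => i /andP[]; rewrite leqNgt => /negbTE ->.
apply: leq_trans h1; rewrite -{2}[N]subn0 -[leqRHS]muln1 -sum_nat_const_nat.
by apply: leq_sum => i _; exact: leq_b1.
Qed.

Lemma same_block q a b : 0 < q -> a %/ q = b %/ q -> a < b + q.
Proof.
move=> q0 e; have := ltn_pmod a q0; have := divn_eq a q; have := divn_eq b q; rewrite e.
by move: (b %/ q * q) (a %% q) (b %% q) => *; lia.
Qed.

Definition ncolors p := 4 * (p * p) + 1.
Definition hash_range p m := ncolors p * m.+1.
Definition color p m a v := ((a * v) %% hash_range p m) %/ m.+1.

Lemma hash_range_gt0 p m : 0 < hash_range p m.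
Proof. by rewrite muln_gt0 /ncolors addn1. Qed.

Lemma color_lt p m a v : color p m a v < ncolors p.
Proof. by rewrite /color ltn_divLR // ltn_pmod // hash_range_gt0. Qed.

(** Let [e = a d mod N]. Blocks of equal color have length [m + 1], so a collision puts [e] within
    [m + 1] of 0 modulo [N], on one side or the other: two windows of length [m + 1], each hit at
    most [m + 1 + d <= 2 (m + 1)] times. *)
Lemma collisions p m y d : 0 < d -> d <= m ->
  \sum_(a < hash_range p m) (color p m a (y + d) == color p m a y) <= 4 * m.+1.
Proof.
move=> d0 dm; have N0 := hash_range_gt0 p m; set N := hash_range p m in N0 *.
apply: (@leq_trans (\sum_(a < N) (((a * d + 0) %% N < m.+1) + ((a * d + m.+1) %% N < m.+1)))); last first.
  rewrite big_split /=; apply: leq_trans (leq_add (count_window _ _ N0 d0) (count_window _ _ N0 d0)) _; lia.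
apply: leq_sum => a _; case: eqP => //=; rewrite /color -/N mulnDr addn0 => /eqP.
rewrite -(modnDm (a * y)) -(modnDml (a * d)); set r := (a * y) %% N; set e := (a * d) %% N => h.
have rN : r < N by rewrite ltn_pmod.
have eN : e < N by rewrite ltn_pmod.
have mN : m.+1 <= N by rewrite /N /hash_range leq_pmull // /ncolors addn1.
have q0 : 0 < m.+1 by [].
clearbody r e N; clear N0 d0 dm a.
have [lt|ge] := ltnP (r + e) N.
  rewrite (modn_small lt) in h; have := same_block q0 (eqP h).
  by rewrite ltn_add2l => ->.
have e1 : (r + e) %% N = r + e - N by rewrite -{1}(subnK ge) modnDr modn_small //; lia.
have e2 : e + m.+1 >= N -> (e + m.+1) %% N = e + m.+1 - N.
  by move=> h2; rewrite -{1}(subnK h2) modnDr modn_small //; lia.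
rewrite e1 in h; have h1 := same_block q0 (esym (eqP h)).
have Ne : N <= e + m.+1 by clear e1 e2 h; lia.
by rewrite e2 // (_ : e + m.+1 - N < m.+1) ?addn1 //; clear e1 e2 h; lia.
Qed.

Lemma hash_injective p m (x : nat -> nat) : (forall t, t < p -> x t < m) ->
  (forall t t', t < p -> t' < p -> x t = x t' -> t = t') ->
  exists2 a, a < hash_range p m &
    forall t t', t < p -> t' < p -> color p m a (x t) = color p m a (x t') -> t = t'.
Proof.
move=> xm xi; set N := hash_range p m.
pose bad a (t t' : nat) := (t != t') && (color p m a (x t) == color p m a (x t')).
have : \sum_(a < N) \sum_(t < p) \sum_(t' < p) bad a t t' < N.
  rewrite exchange_big /=; apply: (@leq_ltn_trans (\sum_(t < p) \sum_(t' < p) 4 * m.+1)); last first.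
    by rewrite !sum_nat_const !card_ord /N /hash_range /ncolors; lia.
  apply: leq_sum => t _; rewrite exchange_big /=; apply: leq_sum => t' _.
  have [/xi|] := eqVneq (x t) (x t').
    move=> /(_ (ltn_ord t) (ltn_ord t')) -> //.
    by rewrite big1 // => a _; rewrite /bad eqxx.
  wlog : t t' / x t > x t'.
    move=> W ne; have [lt|gt|eq] := ltngtP (x t) (x t'); last by rewrite eq eqxx in ne.
      2: exact: W.
    rewrite (eq_bigr (fun a : 'I_N => (bad a t' t : nat))); first by apply: W; rewrite // eq_sym.
    by move=> a _; rewrite /bad eq_sym [X in _ && X]eq_sym.
  move=> lt _; have := @collisions p m (x t') (x t - x t'); rewrite subnKC ?(ltnW lt) // => h.
  apply: leq_trans (h _ _); first by apply: leq_sum => a _; rewrite /bad; case: (t != t').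
    by rewrite subn_gt0.
  by have := xm t (ltn_ord t); lia.
move=> lt.
have [/existsP[a /eqP a0]|/existsPn no] := boolP [exists a : 'I_N, \sum_(t < p) \sum_(t' < p) bad a t t' == 0].
  exists a => // t t' ht ht' e; apply/eqP; apply: contraTT isT => ne.
  move/eqP: a0; rewrite sum_nat_eq0 => /forallP /(_ (Ordinal ht)) /=.
  by rewrite sum_nat_eq0 => /forallP /(_ (Ordinal ht')) /=; rewrite /bad ne e eqxx.
have : N <= \sum_(a < N) \sum_(t < p) \sum_(t' < p) bad a t t'.
  rewrite -{1}[N]card_ord -sum1_card; apply: leq_sum => a _; rewrite lt0n; exact: no.
lia.
Qed.

Lemma digits_exist (r d : nat -> nat) len : (forall i, i < len -> d i < r i) ->
  exists2 x, x < \prod_(i < len) r i &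
    forall i, i < len -> (x %/ \prod_(j < i) r j) %% r i = d i.
Proof.
elim: len => [|len IH] h; first by exists 0; rewrite // big_ord0.
have [x hx dx] := IH (fun i hi => h i (leqW hi)).
exists (x + d len * \prod_(j < len) r j) => [|i].
  rewrite big_ord_recr /=; have := h len (ltnSn _).
  move: (\prod_(j < len) r j) hx => P hx hd; apply: (@leq_trans (P + d len * P)); first by rewrite ltn_add2r.
  by rewrite -mulSn mulnC leq_mul2l hd orbT.
rewrite ltnS leq_eqVlt => /orP[/eqP->|hi].
  rewrite divnDMl ?divn_small // ?modn_small ?h //; exact: leq_ltn_trans hx.
have ri : 0 < r i by apply: leq_ltn_trans (h i (leqW hi)).
have Pi : 0 < \prod_(j < i) r j.
  by apply: prodn_cond_gt0 => j _; apply: leq_ltn_trans (h j _); have := ltn_ord j; lia.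
have -> : \prod_(j < len) r j = (\prod_(i.+1 <= j < len) r j * r i) * \prod_(j < i) r j.
  by rewrite -!(big_mkord xpredT r) (big_cat_nat (leq0n i) (ltnW hi)) /= (big_ltn hi) mulnC [r i * _]mulnC.
by rewrite addnC mulnA divnMDl // mulnA modnMDl dx.
Qed.

(** * Allocations as forests of slots *)

Section Placement.
Variable I : instance.
Let m := items I.
Let n := agents I.
Let p : nat := budget I.

Definition adj_addr v v' := 3 + (v * items I + v').
Definition val_addr i v := 3 + (items I * items I + (i * items I + v)).
(** Graph and valuations as functions on numbers, taken from the input words: they match what the
    program reads without casts to ordinals. *)
Definition nadj v v' := input_memory I (adj_addr v v').
Definition nval i v := input_memory I (val_addr i v).

Lemma nth_allpairs_ord (T : Type) (x0 : T) a b (f : 'I_a -> 'I_b -> T) (i : 'I_a) (j : 'I_b) :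
  nth x0 [seq f x y | x <- enum 'I_a, y <- enum 'I_b] (i * b + j) = f i j.
Proof.
suff h (s : seq 'I_a) k (x : 'I_a) : nth x s k = x -> k < size s ->
    nth x0 [seq f x y | x <- s, y <- enum 'I_b] (k * b + j) = f x j.
  by rewrite (h _ _ i) ?size_enum_ord ?nth_ord_enum.
elim: s k => [|y s IH] [|k] //= ex hk; rewrite nth_cat size_map size_enum_ord.
  by rewrite mul0n add0n ltn_ord ex (nth_map j) ?size_enum_ord // nth_ord_enum.
by rewrite mulSn -addnA ltnNge leq_addr /= addKn IH.
Qed.

Lemma nadjE (v v' : 'I_m) : nadj v v' = adj v v'.
Proof.
rewrite /nadj /input_memory /input_words /adj_addr /= nth_cat size_allpairs !size_enum_ord -/m.
have h : v * m + v' < m * m by have := ltn_ord v; have := ltn_ord v'; nia.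
by rewrite h (nth_allpairs_ord 0 (fun x y => adj x y : nat)).
Qed.

Lemma nvalE (i : 'I_n) (v : 'I_m) : nval i v = valuation i v.
Proof.
rewrite /nval /input_memory /input_words /val_addr /= nth_cat size_allpairs !size_enum_ord -/m.
rewrite ifF; last by apply/negbTE; rewrite -leqNgt leq_addr.
by rewrite add0n addKn (nth_allpairs_ord 0 (fun x y => valuation x y)).
Qed.

Lemma nadjC v v' : v < m -> v' < m -> nadj v v' = nadj v' v.
Proof.
by move=> hv hv'; have := nadjE (Ordinal hv) (Ordinal hv'); have := nadjE (Ordinal hv') (Ordinal hv); rewrite /= adj_sym => -> ->.
Qed.

(* Slot [t < p] holds item [itm t] of the bundle of agent [ag t]; [par] makes
   the slots of each bundle a tree whose root is the fixed point of [par]. *)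
Record placement (itm ag par : nat -> nat) : Prop := Placement {
  pl_itm : forall t, t < p -> itm t < m;
  pl_inj : forall t t', t < p -> t' < p -> itm t = itm t' -> t = t';
  pl_ag : forall t, t < p -> ag t < n;
  pl_par : forall t, t < p -> par t <= t;
  pl_edge : forall t, t < p -> par t != t ->
    nadj (itm t) (itm (par t)) != 0 /\ ag (par t) = ag t;
  pl_root : forall t t', t < p -> par t = t -> t' < t -> ag t' <> ag t
}.

Definition bundle_value (itm ag : nat -> nat) i j :=
  \sum_(t < p | ag t == j) nval i (itm t).

Section Sound.
Variables (itm ag par : nat -> nat).
Hypothesis pl : placement itm ag par.

Let it (t : 'I_p) : 'I_m := Ordinal (pl_itm pl (ltn_ord t)).

Definition place_alloc : allocation I :=
  [ffun i : 'I_n => [set it t | t : 'I_p & ag t == i]].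

Lemma it_inj : injective it.
Proof. by move=> t t' /(congr1 val) /= /(pl_inj pl (ltn_ord t) (ltn_ord t')) /val_inj. Qed.

Lemma mem_place_alloc (i : 'I_n) v : v \in place_alloc i = has (fun t => (itm t == v) && (ag t == i)) (iota 0 p).
Proof.
rewrite ffunE; apply/imsetP/hasP => [[t]|[t]].
  by rewrite inE => h ->; exists (nat_of_ord t); rewrite ?mem_iota //= eqxx.
rewrite mem_iota add0n => /andP[_ tp] /andP[/eqP e h]; exists (Ordinal tp); first by rewrite inE.
by apply: val_inj.
Qed.

(** Of two distinct slots of one bundle the later is no root, as a root comes first in its bundle.
    Replacing it by its parent lowers the sum of the two slot numbers, on which the induction
    runs. *)
Lemma place_connected (i : 'I_n) : connected_bundle (place_alloc i).
Proof.
have mem (t : 'I_p) : ag t = i -> it t \in place_alloc i.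
  by move=> h; rewrite ffunE; apply/imsetP; exists t; rewrite // inE h.
have sym : connect_sym (induced (place_alloc i)).
  by apply: sym_connect_sym => x y; rewrite /induced /= adj_sym andbCA.
suff main k (t t' : 'I_p) : t + t' <= k -> ag t = i -> ag t' = i ->
    connect (induced (place_alloc i)) (it t) (it t').
  move=> x y; rewrite {1 2}ffunE => /imsetP[t + ->] /imsetP[t' + ->]; rewrite !inE => /eqP h /eqP h'.
  exact: (main (t + t')).
elim: k t t' => [|k IH] t t' hk h h'.
  suff -> : t = t' by exact: connect0.
  by apply: val_inj => /=; lia.
wlog lt : t t' hk h h' / t' < t.
  move=> W; have [lt|lt|/val_inj->] := ltngtP t t'; last exact: connect0.
    by rewrite sym; apply: W => //; rewrite addnC.
  exact: W.
have [r|nr] := eqVneq (par t) t.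
  by case: (pl_root pl (ltn_ord t) r lt); rewrite h h'.
have [ad ag'] := pl_edge pl (ltn_ord t) nr.
have hp := pl_par pl (ltn_ord t).
have lp : par t < p by apply: leq_ltn_trans hp (ltn_ord t).
pose u := Ordinal lp.
have hu : ag u = i by rewrite /= ag' h.
apply: (connect_trans (y := it u)).
  apply: connect1; rewrite /induced /= !mem //= .
  by move: ad; rewrite (nadjE (it t) (it u)) eqb0 negbK.
have lt' : par t < t by rewrite ltn_neqAle nr hp.
by apply: IH => //=; lia.
Qed.

Lemma place_utility (i j : 'I_n) : utility i (place_alloc j) = bundle_value itm ag i j.
Proof.
rewrite /utility ffunE big_imset /=; last by move=> t t' _ _; apply: it_inj.
rewrite /bundle_value; apply: eq_big => [t|t _]; first by rewrite inE.
by rewrite -nvalE.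
Qed.

Lemma place_valid : valid place_alloc.
Proof.
split; last exact: place_connected.
- move=> i j ij; rewrite !ffunE -setI_eq0; apply/eqP/setP => v; rewrite !inE.
  apply/negP => /andP[/imsetP[t ht ->] /imsetP[t' ht' /it_inj e]]; subst t'.
  move: ht ht'; rewrite !inE => /eqP h1 /eqP h2; case/eqP: ij; apply: val_inj.
  by rewrite /= -h1 h2.
- transitivity (\sum_(i < n) \sum_(t < p) (ag t == i)).
    apply: eq_bigr => i _; rewrite ffunE card_imset; last exact: it_inj.
    by rewrite -sum1_card big_mkcond; apply: eq_bigr => t _; rewrite inE; case: (ag t == i).
  rewrite exchange_big /=; transitivity (\sum_(t < p) 1); last by rewrite sum1_card card_ord.
  apply: eq_bigr => t _.
  by rewrite (bigD1 (Ordinal (pl_ag pl (ltn_ord t)))) //= eqxx big1 // => i /negbTE; rewrite -val_eqE /= eq_sym => ->.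
Qed.

End Sound.

Lemma crossing_edge (T : finType) (e : rel T) (A : pred T) x y :
  connect e x y -> A x -> ~~ A y -> exists a b, [/\ e a b, A a & ~~ A b].
Proof.
case/connectP => s; elim: s x => [|z s IH] x /=; first by move=> _ -> ->.
case/andP => exz hs hy Ax Ay; have [Az|nAz] := boolP (A z); first exact: IH Az Ay.
by exists x, z.
Qed.

(** The allocated items are listed so that each one either opens its bundle or has an earlier
    neighbour in the same bundle; positions become slots and any such neighbour becomes the
    parent. *)
Lemma placement_exists (Pi : allocation I) : valid Pi -> envy_free Pi ->
  exists itm ag par, placement itm ag par /\
    forall i j, i < n -> j < n -> bundle_value itm ag i j <= bundle_value itm ag i i.
Proof.
move=> [disj total conn] ef.
pose owner (v : 'I_m) : nat := if [pick i | v \in Pi i] is Some i then i : nat else 0.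
have ownerP (i : 'I_n) v : v \in Pi i -> owner v = i.
  rewrite /owner => vi; case: pickP => [j vj|/(_ i)]; last by rewrite vi.
  have [->//|/disj] := eqVneq j i.
  by rewrite -setI_eq0 => /eqP /setP /(_ v); rewrite !inE vi vj.
pose good (s : seq 'I_m) := [/\ uniq s, forall v, v \in s -> exists i, v \in Pi i
  & forall t x0, t < size s ->
     (exists2 t', t' < t & owner (nth x0 s t') = owner (nth x0 s t) /\ adj (nth x0 s t) (nth x0 s t')) \/
     (forall t', t' < t -> owner (nth x0 s t') <> owner (nth x0 s t))].
have cardD : #|\bigcup_i Pi i| = p.
  rewrite -sum1_card partition_disjoint_bigcup // /p -total.
  by apply: eq_bigr => i _; rewrite sum1_card.
have [s [us sP st] sz] : exists2 s, good s & size s = p.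
  suff main q : q <= p -> exists2 s, good s & size s = q by exact: main.
  elim: q => [|q IH] qp; first by exists [::].
  have [s [us sP st] sz] := IH (ltnW qp).
  have ext v i : v \in Pi i -> v \notin s -> ((exists2 y, y \in s & y \in Pi i /\ adj v y) \/ (forall y, y \in s -> y \notin Pi i)) ->
    exists2 s, good s & size s = q.+1.
    move=> vi vs h; exists (rcons s v); last by rewrite size_rcons sz.
    split; first by rewrite rcons_uniq vs.
      by move=> x; rewrite mem_rcons inE => /orP[/eqP->|/sP//]; exists i.
    move=> t x0; rewrite size_rcons ltnS leq_eqVlt => /orP[/eqP->|lt].
      have last : nth x0 (rcons s v) (size s) = v by rewrite nth_rcons ltnn eqxx.
      rewrite last; case: h => [[y ys [yi vy]]|h]; [left|right].
        exists (index y s); first by rewrite index_mem.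
        by rewrite nth_rcons index_mem ys nth_index // (ownerP i) // (ownerP i).
      move=> t' lt'; rewrite nth_rcons lt' (ownerP i v vi).
      have ys := mem_nth x0 lt'; have [j yj] := sP _ ys; rewrite (ownerP j) // => /val_inj e.
      by move: (h _ ys); rewrite -e yj.
    have nthE t' : t' <= t -> nth x0 (rcons s v) t' = nth x0 s t'.
      by move=> h'; rewrite nth_rcons (leq_ltn_trans h' lt).
    rewrite (nthE t) //; case: (st t x0 lt) => [[t' lt' h']|h']; [left|right].
      by exists t' => //; rewrite nthE // ltnW.
    by move=> t' lt'; rewrite (nthE t' (ltnW lt')); apply: h'.
  have [v vD vs] : exists2 v, v \in \bigcup_i Pi i & v \notin s.
    apply/exists_inP; apply: contraLR qp => /exists_inPn h; rewrite -leqNgt -sz -cardD -(card_uniqP us).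
    by apply/subset_leq_card/subsetP => x /h; rewrite negbK.
  have /bigcupP[i _ vi] := vD.
  (* An item of an untouched bundle opens a tree. Otherwise a path inside the bundle from a listed
     item [y] to [v] has an edge that leaves the list, and the outer end of this edge is appended
     instead of [v]. *)
  have [/hasP[y ys yi]|/hasPn no] := boolP (has [pred y | y \in Pi i] s); last first.
    by apply: (ext v i) => //; right.
  have [a [b [/and3P[ai bi ab] /= as_ bs]]] := crossing_edge (A := mem s) (conn i y v yi vi) ys vs.
  by apply: (ext b i) => //; left; exists a => //; split; rewrite // adj_sym.
have memD v : (v \in \bigcup_i Pi i) = (v \in s).
  suff -> : \bigcup_i Pi i = [set v in s] by rewrite inE.
  apply/esym/eqP; rewrite eqEcard cardD cardsE (card_uniqP us) sz leqnn andbT.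
  by apply/subsetP => x; rewrite inE => /sP [i xi]; apply/bigcupP; exists i.
(* [nth] needs a default item, which [p > 0] provides. *)
have [p0|p0] := posnP p.
  exists id, id, id; split.
    by split; rewrite -/p p0.
  by move=> i j _ _; rewrite /bundle_value -/p p0 !big_ord0.
have x0 : 'I_m by case: (s) sz => [/= e|//]; rewrite -e in p0.
pose it t := nth x0 s t.
have sizeE t : t < p -> t < size s by rewrite sz.
pose par t := if [pick t' : 'I_p | [&& t' < t, owner (it t') == owner (it t) & adj (it t) (it t')]]
  is Some t' then t' : nat else t.
have own_lt v : v \in s -> exists2 i : 'I_n, v \in Pi i & owner v = i.
  by move=> /sP[i vi]; exists i; rewrite // (ownerP i).
have valueE (i j : 'I_n) : bundle_value it (owner \o it) i j = utility i (Pi j).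
  rewrite /bundle_value (eq_bigr (fun t : 'I_p => valuation i (it t))); last by move=> t _; rewrite nvalE.
  rewrite -(big_mkord (fun t => owner (it t) == j) (fun t => valuation i (it t))) -/p -sz.
  rewrite -(big_nth x0 (fun v => owner v == j) (fun v => valuation i v)) big_mkcond big_uniq //= -big_mkcondr.
  apply: eq_bigl => v; apply/andP/idP => [[vs /eqP oj]|vj].
    by have [k vk ok] := own_lt v vs; rewrite (_ : j = k) //; apply: val_inj; exact: etrans (esym oj) ok.
  by rewrite -memD (ownerP j) // eqxx; split=> //; apply/bigcupP; exists j.
exists (fun t => it t : nat), (owner \o it), par; split.
  split.
  - by move=> t _; apply: ltn_ord.
  - move=> t t' /sizeE ht /sizeE ht' /val_inj /eqP; rewrite nth_uniq // => /eqP //.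
  - by move=> t /sizeE ht /=; have [i _ ->] := own_lt _ (mem_nth x0 ht).
  - by move=> t _; rewrite /par; case: pickP => // t' /andP[/ltnW].
  - move=> t ht; rewrite /par; case: pickP => [t' /and3P[_ /eqP h1 h2] _|_]; last by rewrite eqxx.
    by rewrite nadjE h2.
  - move=> t t' ht + lt; rewrite /par; case: pickP => [u /andP[h _] e|no _].
      by rewrite e ltnn in h.
    case: (st t x0 (sizeE t ht)) => [[u lu [h1 h2]]|h]; last exact: h.
    have up : u < p by apply: ltn_trans lu ht.
    by have := no (Ordinal up); rewrite /= lu /it h1 h2 eqxx.
move=> i j hi hj; have := valueE (Ordinal hi) (Ordinal hj); have := valueE (Ordinal hi) (Ordinal hi).
rewrite /= /bundle_value => -> ->; exact: ef.
Qed.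

End Placement.

(** * The program *)

Definition tc k := TRange (RC k).
Definition tm := TRange RM.
Definition tn := TRange RN.
Definition tp := TRange RP.
Definition tadd := TBin Add.
Definition tsub := TBin Sub.
Definition tmul := TBin Mul.
Definition tdiv := TBin Div.
Definition tle := TBin Leq.
Definition tlt a b := tle (tadd a (tc 1)) b.
Definition teq a b := tmul (tle a b) (tle b a).
Definition tnot t := tle t (tc 0).
Definition tbool t := tle (tc 1) t.
Definition tif c a b := tadd (tmul (tbool c) a) (tmul (tnot c) b).
Definition tmod a b := tsub a (tmul (tdiv a b) b).
Definition tex r t := TSum r (tbool t).
Definition tall r t := tnot (tex r (tnot t)).

(** Scalars sit at index 0 of their array. [aX] is the current code out of [aQ], [aGo] the guard of
    either outer loop, [aHash] the multiplier of the coloring, [aRest] the part of the code still to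
    be decoded; [aAlive] tells whether an item can stand at a slot with the whole subtree below it
    filled, and [aSol] holds the item chosen for a slot. *)
Definition aK := 0.
Definition aQ := 1.
Definition aX := 2.
Definition aGo := 3.
Definition aFound := 4.
Definition aHash := 5.
Definition aRest := 6.
Definition aRep := 7.
Definition aDig := 8.
Definition aAg := 9.
Definition aTau := 10.
Definition aAlive := 11.
Definition aSol := 12.
Definition aOut := 13.

Definition reg a := TCell a (tc 0).
Definition tcolors := tadd (tmul (tc 4) (tmul tp tp)) (tc 1).
Definition tblock := tadd tm (tc 1).
Definition thash := tmul tcolors tblock.
Definition tcolor v := tdiv (tmod (tmul (reg aHash) v) thash) tblock.
Definition tval i v := TInput (tadd (tc 3) (tadd (tmul tm tm) (tadd (tmul i tm) v))).
Definition tadj v v' := TInput (tadd (tc 3) (tadd (tmul v tm) v')).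
Definition tdig t q := TCell aDig (tadd (tmul t (tadd tn (tc 2))) q).
(* The digits of slot [t]: its color, its parent and, for the representative
   [b] of each type, twice the level of its value plus the bit telling whether
   [b] owns it. *)
Definition tcol t := tdig t (tc 0).
Definition tpar t := tdig t (tc 1).
Definition tlevel t b := tdiv (tdig t (tadd (tc 2) b)) (tc 2).
Definition towner t b := tmod (tdig t (tadd (tc 2) b)) (tc 2).
Definition trep i := TCell aRep i.
(** An agent that represents no type gets radix 1, so its digit is 0 and costs nothing: the number
    of codes depends on [|A|] where the number of digits depends on [n]. The factor [K + 1] is for
    the levels [0, ..., K] and the factor 2 for the ownership bit. *)
Definition tradix i :=
  let q := tmod i (tadd tn (tc 2)) in
  tif (teq q (tc 0)) tcolors (tif (teq q (tc 1)) tp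
    (tif (teq (trep (tsub q (tc 2))) (tsub q (tc 2)))
         (tmul (tc 2) (tadd (reg aK) (tc 1))) (tc 1))).
Definition talive t v := TCell aAlive (tadd (tmul t tm) v).

(** A type is represented by its largest member. *)
Definition find_reps :=
  SFor RN (SStore aRep (TVar 0) (TMax RN
    (tmul (TVar 1) (tall RM (teq (tval (TVar 0) (TVar 2)) (tval (TVar 1) (TVar 2))))))).

(** The margin at which rounding costs no more than the factor [1 + eps]. If [K <= p], truncated
    subtraction gives 0 and the test fails unless [p = 0]. *)
Definition tprecise := TEps (tsub (reg aK) tp) (tmul (tc 2) tp).
Definition init := SSeq find_reps (SStore aGo (tc 0) (tnot tprecise)).
Definition raiseK :=
  SSeq (SStore aK (tc 0) (tadd (reg aK) (tc 1))) (SStore aGo (tc 0) (tnot tprecise)).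

Definition rdigits := RMul RP (RAdd RN (RC 2)).
Definition count_codes :=
  SSeq (SStore aQ (tc 0) thash)
  (SSeq (SFor rdigits (SStore aQ (tc 0) (tmul (reg aQ) (tradix (TVar 0)))))
        (SStore aGo (tc 0) (tc 1))).

Definition decode :=
  SSeq (SStore aHash (tc 0) (tmod (reg aX) thash))
  (SSeq (SStore aRest (tc 0) (tdiv (reg aX) thash))
   (SFor rdigits (SSeq (SStore aDig (TVar 0) (tmod (reg aRest) (tradix (TVar 0))))
                       (SStore aRest (tc 0) (tdiv (reg aRest) (tradix (TVar 0))))))).

(* Cells of [aAg] hold agents shifted by one; 0 means that none is left. *)
Definition assign :=
  SFor RP (SIf (teq (tpar (TVar 0)) (TVar 0))
    (SStore aAg (TVar 0) (TMax RN (tmul (tadd (TVar 1) (tc 1))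
       (tmul (towner (TVar 0) (trep (TVar 1)))
             (tnot (tex RP (tmul (tlt (TVar 2) (TVar 0))
                        (teq (TCell aAg (TVar 2)) (tadd (TVar 1) (tc 1))))))))))
    (SStore aAg (TVar 0) (TCell aAg (tpar (TVar 0))))).

Definition start_tau := SFor RN (SStore aTau (TVar 0) (TMax RM (tval (TVar 0) (TVar 1)))).

(* [l] is the first free loop variable.
   Upper bounds are imposed for every type, a lower bound only for the type that
   owns slot [t]: the thresholds that admit a choice of items are then closed
   under pointwise maximum. *)
Definition tfits l t v :=
  tmul (teq (tcolor v) (tcol t))
  (tmul (tall RN (let b := TVar l in tif (teq (trep b) b)
    (tmul (tle (tmul (reg aK) (tval b v)) (tmul (tlevel t b) (TCell aTau b)))
          (tle (tmul (towner t b) (tmul (tlevel t b) (TCell aTau b)))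
               (tadd (tmul (reg aK) (tval b v)) (TCell aTau b)))) (tc 1)))
  (tall RP (let t' := TVar l in
     tif (tmul (tlt t t') (teq (tpar t') t))
         (tex RM (tmul (tadj v (TVar l.+1)) (talive t' (TVar l.+1)))) (tc 1)))).

(** Runs from the last cell to the first: children have larger slot numbers than their parent, so
    they are settled when the parent consults them. *)
Definition mark_alive l :=
  SFor (RMul RP RM) (let i := tsub (tsub (tmul tp tm) (tc 1)) (TVar l) in
    SStore aAlive i (tbool (tfits l.+1 (tdiv i tm) (tmod i tm)))).

(** Looking at the roots is enough, since a live item at a root already stands for a filling of the
    whole tree. *)
Definition tbad l b :=
  tex RP (let t := TVar l in tmul (teq (tpar t) t)
    (tmul (towner t b) (tall RM (tnot (talive t (TVar l.+1)))))).

Definition lower_tau :=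
  SFor RN (SIf (tbad 2 (TVar 1))
    (SStore aTau (TVar 1) (TMax RM (tmul (tval (TVar 1) (TVar 2))
       (tlt (tval (TVar 1) (TVar 2)) (TCell aTau (TVar 1)))))) SSkip).

Definition rounds :=
  SSeq start_tau (SSeq (mark_alive 0)
    (SFor (RAdd (RMul RN RM) (RC 1))
      (SIf (tex RN (tbad 2 (TVar 1))) (SSeq lower_tau (mark_alive 1)) SSkip))).

(** Parents come first, so the item of the parent is at hand when a child is treated. The maximum is
    just a way to choose. *)
Definition select :=
  SFor RP (SStore aSol (TVar 0) (TMax RM (let t := TVar 0 in let v := TVar 1 in
    tmul v (tbool (tmul (talive t v) (tadd (teq (tpar t) t)
       (tadj v (TCell aSol (tpar t))))))))).

Definition tbundle l i j :=
  TSum RP (tmul (teq (TCell aAg (TVar l)) (tadd j (tc 1))) (tval i (TCell aSol (TVar l)))).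

(** With truncated subtraction, [(1 + eps) own >= other] becomes the single cut query
    [other - own <= own * eps]. *)
Definition tverify :=
  let t := TVar 0 in let t' := TVar 1 in
  let sol t := TCell aSol t in let ag t := TCell aAg t in
  tmul (tall RP (tmul (tlt (sol t) tm) (tmul (tle (tc 1) (ag t)) (tle (ag t) tn))))
  (tmul (tall RP (tall RP (tadd (teq t t') (tnot (teq (sol t) (sol t'))))))
  (tmul (tall RP (tadd (teq (tpar t) t)
     (tmul (tlt (tpar t) t) (tmul (teq (ag (tpar t)) (ag t)) (tadj (sol t) (sol (tpar t)))))))
  (tmul (tall RP (tall RP (tif (tmul (teq (tpar t) t) (tlt t' t)) (tnot (teq (ag t') (ag t))) (tc 1))))
        (tall RN (tall RN (TEps (tbundle 2 (TVar 0) (TVar 0))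
           (tsub (tbundle 2 (TVar 0) (TVar 1)) (tbundle 2 (TVar 0) (TVar 0))))))))).

Definition step :=
  SSeq decode (SSeq assign (SSeq rounds (SSeq select
    (SSeq (SStore aFound (tc 0) (tbool tverify))
    (SSeq (SStore aX (tc 0) (tadd (reg aX) (tc 1)))
          (SStore aGo (tc 0) (tmul (tnot (reg aFound)) (tlt (reg aX) (reg aQ))))))))).

Definition fill_out :=
  SFor (RMul RN RM) (SStore aOut (TVar 0) (tbool (tex RP
    (tmul (teq (TCell aAg (TVar 1)) (tadd (tdiv (TVar 0) tm) (tc 1)))
          (teq (TCell aSol (TVar 1)) (tmod (TVar 0) tm)))))).

Lemma wf_prog : [&& wfs 0 init, wfs 0 raiseK, wfs 0 count_codes, wfs 0 step & wfs 0 fill_out].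
Proof. by vm_compute. Qed.

(** * Values of the terms of the program *)

Section Eval.
Variables (R : realType) (eps : R) (I : instance).
Local Notation ev := (ev eps I).
Implicit Types (u : state) (env : seq nat).

(** Every nonzero value counts as true, so that [tmul] is conjunction and [tadd] is disjunction. *)
Definition holds u env t := 0 < ev u env t.

Lemma ev_bin o a b u env : ev u env (TBin o a b) = binop_eval o (ev u env a) (ev u env b). Proof. by []. Qed.
Lemma ev_tmul a b u env : ev u env (tmul a b) = ev u env a * ev u env b. Proof. by []. Qed.
Lemma ev_tadd a b u env : ev u env (tadd a b) = ev u env a + ev u env b. Proof. by []. Qed.
Lemma ev_tsub a b u env : ev u env (tsub a b) = ev u env a - ev u env b. Proof. by []. Qed.
Lemma ev_tdiv a b u env : ev u env (tdiv a b) = ev u env a %/ ev u env b. Proof. by []. Qed.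
Lemma ev_tcell a t u env : ev u env (TCell a t) = u a (ev u env t). Proof. by []. Qed.
Lemma ev_tmax r t u env : ev u env (TMax r t) = \max_(i < erange I r) ev u (rcons env i) t. Proof. by []. Qed.
Lemma ev_tsum r t u env : ev u env (TSum r t) = \sum_(i < erange I r) ev u (rcons env i) t. Proof. by []. Qed.
Lemma ev_tall r t u env : ev u env (tall r t) = holds u env (tall r t).
Proof. by rewrite /holds lt0b. Qed.
Lemma ev_tlt a b u env : ev u env (tlt a b) = (ev u env a < ev u env b). Proof. by rewrite /tlt /= addn1. Qed.
Lemma ev_teq a b u env : ev u env (teq a b) = (ev u env a == ev u env b).
Proof. by rewrite /teq /= mulnb eqn_leq. Qed.
Lemma ev_tnot t u env : ev u env (tnot t) = ~~ holds u env t. Proof. by rewrite /holds -leqNgt. Qed.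
Lemma ev_tbool t u env : ev u env (tbool t) = holds u env t. Proof. by []. Qed.
Lemma ev_tif c a b u env : ev u env (tif c a b) = if holds u env c then ev u env a else ev u env b.
Proof.
have -> : ev u env (tif c a b) = ev u env (tbool c) * ev u env a + ev u env (tnot c) * ev u env b by [].
rewrite ev_tbool ev_tnot.
by case: holds; rewrite ?mul1n ?mul0n ?addn0.
Qed.
Lemma ev_tmod a b u env : ev u env (tmod a b) = ev u env a %% ev u env b.
Proof. by rewrite /tmod /= {1}(divn_eq (ev u env a) (ev u env b)) addKn. Qed.

Lemma holds_tand a b u env : holds u env (tmul a b) = holds u env a && holds u env b.
Proof. exact: muln_gt0. Qed.
Lemma holds_tor a b u env : holds u env (tadd a b) = holds u env a || holds u env b.
Proof. exact: addn_gt0. Qed.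
Lemma holds_teq a b u env : holds u env (teq a b) = (ev u env a == ev u env b).
Proof. by rewrite /holds ev_teq lt0b. Qed.
Lemma holds_tle a b u env : holds u env (tle a b) = (ev u env a <= ev u env b).
Proof. by rewrite /holds lt0b. Qed.
Lemma holds_tlt a b u env : holds u env (tlt a b) = (ev u env a < ev u env b).
Proof. by rewrite /holds ev_tlt lt0b. Qed.
Lemma holds_tnot t u env : holds u env (tnot t) = ~~ holds u env t.
Proof. by rewrite /holds ev_tnot lt0b. Qed.
Lemma holds_tif c a b u env : holds u env (tif c a b) = if holds u env c then holds u env a else holds u env b.
Proof. by rewrite /holds ev_tif /holds; case: (0 < ev u env c). Qed.
Lemma holds_teps a b u env : holds u env (TEps a b) = ((ev u env b)%:R <= (ev u env a)%:R * eps)%R.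
Proof. by rewrite /holds lt0b. Qed.

Lemma holds_texP r t u env :
  reflect (exists2 i, i < erange I r & holds u (rcons env i) t) (holds u env (tex r t)).
Proof.
rewrite /holds /tex /= lt0n sum_nat_eq0 negb_forall.
apply: (iffP existsP) => [[i]|[i hi h]].
  by rewrite /= eqb0 negbK => h; exists i; first exact: ltn_ord.
by exists (Ordinal hi); rewrite /= eqb0 negbK.
Qed.

Lemma holds_tallP r t u env :
  reflect (forall i, i < erange I r -> holds u (rcons env i) t) (holds u env (tall r t)).
Proof.
rewrite holds_tnot; apply: (iffP idP) => [/holds_texP h i hi|h].
  by apply: contraT => nh; case: h; exists i; rewrite ?holds_tnot.
by apply/holds_texP => -[i hi]; rewrite holds_tnot h.
Qed.

Definition fdig u t q := u aDig (t * (agents I + 2) + q).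
Definition fcol u t := fdig u t 0.
Definition fpar u t := fdig u t 1.
Definition flevel u t b := fdig u t (2 + b) %/ 2.
Definition fowner u t b := fdig u t (2 + b) %% 2.
Definition fradix u i :=
  let q := i %% (agents I + 2) in
  if q == 0 then ncolors (budget I) else if q == 1 then budget I : nat else
  if u aRep (q - 2) == q - 2 then 2 * (u aK 0 + 1) else 1.

Lemma ev_tradix u env i : ev u env (tradix i) = fradix u (ev u env i).
Proof.
rewrite /tradix /fradix; set q := tmod _ _.
have <- : ev u env q = ev u env i %% (agents I + 2) by rewrite ev_tmod.
by rewrite !ev_tif !holds_teq.
Qed.
Lemma ev_thash u env : ev u env thash = hash_range (budget I) (items I).
Proof. by congr (_ * _); apply: addn1. Qed.
Lemma ev_tcolor u env v : ev u env (tcolor v) = color (budget I) (items I) (u aHash 0) (ev u env v).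
Proof. by rewrite /tcolor /tdiv ev_bin ev_tmod ev_thash; congr (_ %/ _); apply: addn1. Qed.
Lemma ev_tlevel u env t b : ev u env (tlevel t b) = flevel u (ev u env t) (ev u env b).
Proof. by []. Qed.
Lemma ev_towner u env t b : ev u env (towner t b) = fowner u (ev u env t) (ev u env b).
Proof. by rewrite /towner ev_tmod. Qed.
Lemma ev_tpar u env t : ev u env (tpar t) = fpar u (ev u env t).
Proof. by []. Qed.
Lemma ev_tcol u env t : ev u env (tcol t) = fcol u (ev u env t).
Proof. by []. Qed.
Lemma ev_tval u env i v : ev u env i < agents I -> ev u env v < items I ->
  ev u env (tval i v) = nval I (ev u env i) (ev u env v).
Proof.
move=> hi hv; rewrite /tval /nval /= /base.
set a := 3 + _; rewrite (_ : a < _ = true) ?muln1 //; apply/idP; rewrite /a.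
by move: (ev u env i) (ev u env v) hi hv => *; nia.
Qed.
Lemma ev_tadj u env v v' : ev u env v < items I -> ev u env v' < items I ->
  ev u env (tadj v v') = nadj I (ev u env v) (ev u env v').
Proof.
move=> hi hv; rewrite /tadj /nadj /= /base.
set a := 3 + _; rewrite (_ : a < _ = true) ?muln1 //; apply/idP; rewrite /a.
by move: (ev u env v) (ev u env v') hi hv => *; nia.
Qed.
End Eval.

(** * Correctness of the search *)

(** The maximum of [f * P] is the choice operator of the program. The value 0 is not ambiguous: if 0
    is the maximum and [P] is inhabited, then [f] vanishes on [P], and 0 is still the value of [f]
    at a point of [P]. *)
Lemma max_pick n (f : nat -> nat) (P : nat -> bool) : (exists2 a, a < n & P a) ->
  exists2 a, a < n /\ P a & \max_(i < n) (f i * P i) = f a.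
Proof.
case=> a an Pa.
have n0 : 0 < #|'I_n| by rewrite card_ord; apply: leq_ltn_trans an.
have [i0 e] := @bigop.eq_bigmax 'I_n (fun i => f i * P i) n0.
have [Pi|nPi] := boolP (P i0).
  by exists i0; rewrite // e Pi muln1.
exists a => //; rewrite e (negbTE nPi) muln0.
have := @bigop.leq_bigmax 'I_n (fun i => f i * P i) (Ordinal an).
by rewrite e (negbTE nPi) muln0 /= Pa muln1 leqn0 => /eqP.
Qed.

(** * Type representatives and decoding *)

Definition large_bound (I : instance) X := (items I + agents I + 2) ^ 8 <= X.

Section Stages.
Variables (R : realType) (eps : R) (I : instance) (X : nat).
Local Notation m := (items I).
Local Notation n := (agents I).
Local Notation p := (nat_of_ord (budget I)).
Local Notation ev := (ev eps I).
Local Notation wp := (wp eps I X).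
Local Notation bnd u := (forall a i, u a i <= X).
Local Notation N := (hash_range p m).
Implicit Types (u : state) (env : seq nat) (Q : state -> Prop).

Hypothesis ZX : large_bound I X.
Hypothesis inputX : forall b, input_memory I b <= X.

Lemma quadX : (m + n + 2) * (m + n + 2) <= X.
Proof.
move: ZX; rewrite /large_bound; have : 0 < m + n + 2 by rewrite addn2.
move: (m + n + 2) => z z0; apply: leq_trans.
by rewrite mulnn leq_pexp2l.
Qed.

Lemma pm : p <= m. Proof. exact: budget_le. Qed.

Lemma nX : n < X. Proof. have := quadX; nia. Qed.
Lemma mX : m < X. Proof. have := quadX; nia. Qed.
Lemma digX : p * (n + 2) <= X. Proof. have := quadX; have := pm; nia. Qed.
Lemma pmX : p * m <= X. Proof. have := quadX; have := pm; nia. Qed.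
Lemma X1 : 1 < X. Proof. have := quadX; nia. Qed.
Lemma nmX : n * m <= X. Proof. have := quadX; nia. Qed.

Lemma wp_seq s1 s2 env u (P Q : state -> Prop) :
  wp s1 env u P -> (forall u1, bnd u1 -> P u1 -> same_but (mods s1) u u1 -> wp s2 env u1 Q) ->
  wp (SSeq s1 s2) env u Q.
Proof.
move=> h1 h2 /=; apply: wp_mono (wp_frame h1) => u1 [hP hf] b1; exact: h2.
Qed.

Lemma wp_fill r a t env u f Q : bnd u -> erange I r <= X ->
  (forall u' i, i < erange I r -> same_but [:: a] u u' -> ev u' (rcons env i) t = f i) ->
  (forall i, i < erange I r -> f i <= X) ->
  (forall u', same_but [:: a] u u' -> (forall i, i < erange I r -> u' a i = f i) -> Q u') ->
  wp (SFor r (SStore a (TVar (size env)) t)) env u Q.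
Proof.
move=> bu rX ht fX hQ /=.
exists (fun i u' => same_but [:: a] u u' /\ forall j, j < i -> u' a j = f j); split.
- by split.
- move=> i u' hi bu' [sb h]; rewrite nth_rcons ltnn eqxx ht //; split.
  + exact: leq_trans (ltnW hi) rX.
  + exact: fX.
  + split=> [b|j].
      by rewrite inE /setc => /negbTE nb; rewrite nb sb // inE nb.
    by rewrite ltnS /setc eqxx leq_eqVlt; case: eqP => [->|_] //= /h.
- by move=> u' bu' [sb h]; apply: hQ.
Qed.

Definition rep_of i := \max_(j < n) (j * [forall v : 'I_m, nval I i v == nval I j v]).

Lemma rep_ofP i : i < n ->
  rep_of i < n /\ forall v, v < m -> nval I i v = nval I (rep_of i) v.
Proof.
move=> hi; rewrite /rep_of.
have [|a [an /forallP Pa] ->] := @max_pick n id (fun j => [forall v : 'I_m, nval I i v == nval I j v]).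
  by exists i => //; apply/forallP.
by split=> // v hv; apply/eqP/(Pa (Ordinal hv)).
Qed.

Lemma rep_of_eq i j : (forall v, v < m -> nval I i v = nval I j v) -> rep_of i = rep_of j.
Proof.
move=> h; apply: eq_bigr => k _; congr (_ * nat_of_bool _); apply: eq_forallb => v.
by rewrite h.
Qed.

Lemma rep_of_idem i : i < n -> rep_of (rep_of i) = rep_of i.
Proof. by move=> /rep_ofP[_ h]; apply: rep_of_eq => v hv; rewrite h. Qed.

Lemma wp_find_reps u Q : bnd u ->
  (forall u', same_but [:: aRep] u u' -> (forall i, i < n -> u' aRep i = rep_of i) -> Q u') ->
  wp find_reps [::] u Q.
Proof.
move=> bu hQ; apply: (@wp_fill RN aRep _ [::] u rep_of) => //.
- exact: ltnW nX.
- move=> u' i hi _; rewrite ev_tmax; apply: eq_bigr => j _; rewrite ev_tmul ev_tall.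
  congr (_ * nat_of_bool _); apply/holds_tallP/forallP => h v.
    by have := h v (ltn_ord v); rewrite holds_teq !ev_tval //=.
  by move=> hv; rewrite holds_teq !ev_tval //=; apply: (h (Ordinal hv)).
- by move=> i hi; have [h _] := rep_ofP hi; apply: leq_trans (ltnW h) (ltnW nX).
Qed.

Section Codes.
Variable K : nat.

Definition radix i :=
  let q := i %% (n + 2) in
  if q == 0 then ncolors p else if q == 1 then p else
  if rep_of (q - 2) == q - 2 then 2 * (K + 1) else 1.

Definition ncodes := N * \prod_(i < p * (n + 2)) radix i.

Definition ready u := u aK 0 = K /\ forall i, i < n -> u aRep i = rep_of i.

Lemma fradixE u i : ready u -> fradix I u i = radix i.
Proof.
case=> hK hr; rewrite /fradix /radix hK.
have : i %% (n + 2) < n + 2 by rewrite ltn_pmod // addn2.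
case: (i %% (n + 2)) => [|[|q]] //; rewrite subn2 /= => hq; rewrite hr //; lia.
Qed.

Lemma radix_gt0 i : i < p * (n + 2) -> 0 < radix i.
Proof.
move=> hi; rewrite /radix; case: ifP => // _; first by rewrite /ncolors addn1.
case: ifP => [_|_]; last by case: ifP; rewrite // addn1.
by case: (posnP p) hi => // ->; rewrite mul0n.
Qed.

Lemma prod_radix_gt0 i : i <= p * (n + 2) -> 0 < \prod_(j < i) radix j.
Proof. by move=> hi; apply: prodn_cond_gt0 => j _; apply: radix_gt0; apply: leq_trans hi. Qed.

Hypothesis codesX : ncodes <= X.

(** All radices are positive, so the partial products held in [aQ] do not exceed the last one. *)
Lemma prod_radix_le i : i <= p * (n + 2) -> N * \prod_(j < i) radix j <= X.
Proof.
move=> hi; apply: leq_trans codesX; rewrite /ncodes leq_mul2l; apply/orP; right.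
rewrite -!(big_mkord xpredT radix) (big_cat_nat (leq0n _) hi) /= leq_pmulr //.
rewrite big_nat; apply: prodn_cond_gt0 => j /andP[_ hj]; exact: radix_gt0.
Qed.

Lemma hashX : N <= X.
Proof. by have := prod_radix_le (leq0n _); rewrite big_ord0 muln1. Qed.



Lemma wp_count_codes u Q : bnd u -> ready u ->
  (forall u', same_but [:: aQ; aGo] u u' -> u' aQ 0 = ncodes -> u' aGo 0 = 1 -> Q u') ->
  wp count_codes [::] u Q.
Proof.
move=> bu hr hQ.
apply: (@wp_seq _ _ _ _ (fun u' => u' aQ 0 = N)).
  by split; rewrite ?ev_thash // ?hashX /setc.
move=> u1 b1 e1 f1; have r1 : ready u1.
  by case: hr => h1 h2; split; [rewrite f1|move=> i hi; rewrite f1 ?h2].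
apply: (@wp_seq _ _ _ _ (fun u' => u' aQ 0 = ncodes)).
  exists (fun i u' => u' aQ 0 = N * \prod_(j < i) radix j /\ same_but [:: aQ] u1 u'); split.
  - by rewrite big_ord0 muln1.
  - move=> i u2 hi b2 [e2 f2].
    have r2 : ready u2.
      by case: r1 => h1 h2; split; [rewrite f2|move=> k hk; rewrite f2 ?h2].
    have E : ev u2 [:: i] (tmul (reg aQ) (tradix (TVar 0))) = N * \prod_(j < i.+1) radix j.
      by rewrite /tmul ev_bin ev_tradix fradixE // big_ord_recr mulnA -e2.
    change (wp (SStore aQ (tc 0) (tmul (reg aQ) (tradix (TVar 0)))) [:: i] u2
      (fun u' => u' aQ 0 = N * \prod_(j < i.+1) radix j /\ same_but [:: aQ] u1 u')).
    split; rewrite ?E ?prod_radix_le //.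
    by split=> // a; rewrite inE /setc => /negbTE na; rewrite na f2 // inE na.
  - by move=> u2 _ [].
move=> u2 b2 e2 f2; split=> //=; first exact: ltnW X1.
apply: hQ => // a; rewrite !inE /setc => /norP[/negbTE na /negbTE ng]; rewrite ng f2 ?f1 //=.
all: by rewrite inE na.
Qed.

Definition digit x i := (x %/ N %/ \prod_(j < i) radix j) %% radix i.

Lemma wp_decode u Q x : bnd u -> ready u -> u aX 0 = x ->
  (forall u', same_but [:: aHash; aRest; aDig] u u' -> u' aHash 0 = x %% N ->
     (forall i, i < p * (n + 2) -> u' aDig i = digit x i) -> Q u') ->
  wp decode [::] u Q.
Proof.
move=> bu hr hx hQ; have xX : x <= X by rewrite -hx.
have E0 : ev u [::] (tmod (reg aX) thash) = x %% N by rewrite ev_tmod ev_thash -hx.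
apply: (@wp_seq _ _ _ _ (fun u' => u' aHash 0 = x %% N)).
  by split; rewrite ?E0 //; apply: leq_trans (leq_mod _ _) xX.
move=> u1 b1 e1 f1.
have E1 : ev u1 [::] (tdiv (reg aX) thash) = x %/ N.
  by rewrite /tdiv ev_bin ev_thash /= f1 // hx.
apply: (@wp_seq _ _ _ _ (fun u' => u' aRest 0 = x %/ N)).
  by split; rewrite ?E1 //; apply: leq_trans (leq_div _ _) xX.
move=> u2 b2 e2 f2.
exists (fun i u' => [/\ u' aRest 0 = x %/ N %/ \prod_(j < i) radix j,
   same_but [:: aRest; aDig] u2 u' & forall j, j < i -> u' aDig j = digit x j]); split.
- by rewrite big_ord0 divn1.
- move=> i u' hi b' [er sb ed].
  have r' : ready u'.
    by case: hr => h1 h2; split; [rewrite sb // f2 // f1|move=> k hk; rewrite sb // f2 // f1 // h2].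
  have E2 w' : ready w' -> w' aRest 0 = u' aRest 0 ->
      ev w' [:: i] (tmod (reg aRest) (tradix (TVar 0))) = digit x i.
    by move=> rw ew; rewrite ev_tmod ev_tradix fradixE // /= ew er.
  have E3 w' : ready w' -> w' aRest 0 = u' aRest 0 ->
      ev w' [:: i] (tdiv (reg aRest) (tradix (TVar 0))) = x %/ N %/ \prod_(j < i.+1) radix j.
    by move=> rw ew; rewrite /tdiv ev_bin ev_tradix fradixE // /= ew er big_ord_recr /= -divnMA.
  apply: (@wp_seq (SStore aDig (TVar 0) (tmod (reg aRest) (tradix (TVar 0)))) _ _ _
     (fun u' => u' aDig i = digit x i /\ forall j, j < i -> u' aDig j = digit x j)).
    split; rewrite ?E2 //=.
    + apply: leq_trans digX; exact: ltnW.
    + apply: leq_trans (leq_mod _ _) _; apply: leq_trans (leq_div _ _) _.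
      exact: leq_trans (leq_div _ _) xX.
    + by rewrite /setc !eqxx; split=> // j hj; rewrite (ltn_eqF hj) ed.
  move=> u3 b3 [d3 d3'] f3; have r3 : ready u3.
    by case: r' => h1 h2; split; [rewrite f3|move=> k hk; rewrite f3 // h2].
  split; rewrite ?E3 ?f3 //.
  + apply: leq_trans (leq_div _ _) _; exact: leq_trans (leq_div _ _) xX.
  + split=> //.
    * move=> a; rewrite !inE /setc => /norP[/negbTE na /negbTE ng]; rewrite na f3 ?sb //.
        by rewrite !inE na ng.
      by rewrite inE ng.
    * move=> j; rewrite ltnS leq_eqVlt /setc /= => /orP[/eqP->|/d3'] //.
- move=> u' b' [_ sb ed]; apply: hQ => //.
  + move=> a; rewrite !inE => /norP[ha /norP[hb hc]].
    by rewrite sb ?f2 ?f1 // !inE ?negb_or ?hb ?ha.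
  + by rewrite sb // f2 //.
Qed.

End Codes.
End Stages.

(** * Filling the trees under given thresholds *)

Section Search.
Variables (R : realType) (eps : R) (I : instance) (X K : nat).
Local Notation m := (items I).
Local Notation n := (agents I).
Local Notation p := (nat_of_ord (budget I)).
Local Notation ev := (ev eps I).
Local Notation wp := (wp eps I X).
Local Notation bnd u := (forall a i, u a i <= X).
Local Notation N := (hash_range p m).
Local Notation rep_of := (rep_of I).
Implicit Types (u : state) (env : seq nat) (Q : state -> Prop).

Hypothesis ZX : large_bound I X.
Hypothesis inputX : forall b, input_memory I b <= X.

Lemma ev_talive u env t v : ev u env (talive t v) = u aAlive (ev u env t * m + ev u env v).
Proof. by []. Qed.

(** Variables are numbered from the outermost binder, so a term keeps its value when it is moved
    under further binders; this expresses that for arguments such as the slot and the item of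
    [tfits]. *)
Definition stable u env t x := forall e, ev u (env ++ e) t = x.

Definition ffits u t v :=
  [&& color p m (u aHash 0) v == fcol I u t,
      [forall b : 'I_n, (u aRep b == b) ==>
        ((u aK 0 * nval I b v <= flevel I u t b * u aTau b) &&
         (fowner I u t b * (flevel I u t b * u aTau b) <= u aK 0 * nval I b v + u aTau b))]
    & [forall t' : 'I_p, (t < t') && (fpar I u t' == t) ==>
        [exists v' : 'I_m, (0 < nadj I v v') && (0 < u aAlive (t' * m + v'))]]].

Lemma holds_tfits u env t v x y : stable u env t x -> stable u env v y -> y < m ->
  holds eps I u env (tfits (size env) t v) = ffits u x y.
Proof.
move=> ht hv ym; rewrite /tfits (holds_tand _ _ (teq _ _)) (holds_tand _ _ (tall _ _)).
have h1 b : ev u (rcons env b) t = x by rewrite -cats1 ht.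
have h2 b : ev u (rcons env b) v = y by rewrite -cats1 hv.
have h3 b b' : ev u (rcons (rcons env b) b') v = y by rewrite -!cats1 -catA hv.
have h4 b : ev u (rcons env b) (TVar (size env)) = b by rewrite /= nth_rcons ltnn eqxx.
have h5 b b' : ev u (rcons (rcons env b) b') (TVar (size env)) = b.
  by rewrite /= !nth_rcons size_rcons ltnS leqnn ltnn eqxx.
have h6 b b' : ev u (rcons (rcons env b) b') (TVar (size env).+1) = b'.
  by rewrite /= nth_rcons size_rcons ltnn eqxx.
have ht0 : ev u env t = x by rewrite -(ht [::]) cats0.
have hv0 : ev u env v = y by rewrite -(hv [::]) cats0.
congr [&& _, _ & _].
- by rewrite holds_teq ev_tcolor ev_tcol ht0 hv0.
- apply/holds_tallP/forallP => h b.
    have := h b (ltn_ord b); rewrite holds_tif holds_teq ev_tcell h4; case: eqP => //= _.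
    rewrite (holds_tand _ _ (tle _ _)) !holds_tle !ev_tadd !ev_tmul !ev_tlevel ev_towner !ev_tcell ev_tval ?h4 ?h1 ?h2 //=.
  move=> hb; have := h (Ordinal hb); rewrite holds_tif holds_teq ev_tcell h4 /=; case: eqP => //= _.
  by rewrite (holds_tand _ _ (tle _ _)) !holds_tle !ev_tadd !ev_tmul !ev_tlevel ev_towner !ev_tcell ev_tval ?h4 ?h1 ?h2.
- apply/holds_tallP/forallP => h t'.
    have := h t' (ltn_ord t'); rewrite holds_tif (holds_tand _ _ (tlt _ _)) holds_tlt holds_teq ev_tpar h4 h1.
    case: andP => //= _ /holds_texP[v' hv']; rewrite (holds_tand _ _ (tadj _ _)) => /andP[a1 a2].
    apply/existsP; exists (Ordinal hv').
    by move: a1 a2; rewrite /holds ev_tadj ?h3 ?h6 // ev_talive h5 h6 => -> ->.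
  move=> hb; have := h (Ordinal hb); rewrite holds_tif (holds_tand _ _ (tlt _ _)) holds_tlt holds_teq ev_tpar h4 h1 /=.
  case: andP => //= _ /existsP[v' /andP[a1 a2]]; apply/holds_texP; exists v' => //.
  by rewrite (holds_tand _ _ (tadj _ _)) /holds ev_tadj ?h3 ?h6 // ev_talive h5 h6 a1.
Qed.

Definition alive_ok u :=
  forall t v, t < p -> v < m -> u aAlive (t * m + v) = ffits u t v.

(* [ffits] reads only the cells that come after [t * m + v]. *)
Lemma ffits_ext u u' t v : same_but [:: aAlive] u u' -> t < p -> v < m ->
  (forall j, t * m + v < j < p * m -> u' aAlive j = u aAlive j) ->
  ffits u' t v = ffits u t v.
Proof.
clear ZX inputX.
move=> sb ht hv hj; rewrite /ffits /fcol /flevel /fowner /fpar /fdig.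
rewrite (sb aHash) // (sb aRep) // (sb aK) // (sb aTau) // (sb aDig) //; congr [&& _, _ & _].
apply: eq_forallb => t'; case: (ltnP t t') => //= lt; congr (_ ==> _).
apply: eq_existsb => v'; rewrite hj //; apply/andP; split.
  by have := ltn_ord v'; nia.
by have := ltn_ord v'; have := ltn_ord t'; nia.
Qed.

Lemma wp_mark_alive env u Q : bnd u ->
  (forall u', same_but [:: aAlive] u u' -> alive_ok u' -> Q u') ->
  wp (mark_alive (size env)) env u Q.
Proof.
move=> bu hQ.
have hpm := pmX ZX.
exists (fun i u' => same_but [:: aAlive] u u' /\
  forall t v, t < p -> v < m -> p * m - i <= t * m + v -> u' aAlive (t * m + v) = ffits u' t v); split.
- split=> // t v ht hv; rewrite subn0 => h; exfalso; nia.
- move=> i u' hi b' [sb al]; rewrite /= in hi.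
  set idx := p * m - 1 - i.
  have m0 : 0 < m by have : 0 < p * m by [apply: leq_ltn_trans hi]; rewrite muln_gt0 => /andP[].
  have hst : stable u' (rcons env i) (tdiv (tsub (tsub (tmul tp tm) (tc 1)) (TVar (size env))) tm) (idx %/ m).
    by move=> e; rewrite ev_tdiv !ev_tsub /= nth_cat size_rcons leqnn nth_rcons ltnn eqxx.
  have hsv : stable u' (rcons env i) (tmod (tsub (tsub (tmul tp tm) (tc 1)) (TVar (size env))) tm) (idx %% m).
    by move=> e; rewrite ev_tmod !ev_tsub /= nth_cat size_rcons leqnn nth_rcons ltnn eqxx.
  have vm : idx %% m < m by rewrite ltn_mod.
  have idxE := divn_eq idx m.
  have idxlt : idx < p * m by rewrite /idx; lia.
  have tp' : idx %/ m < p by rewrite ltn_divLR.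
  have hf := holds_tfits hst hsv vm; rewrite size_rcons in hf.
  have ei : ev u' (rcons env i) (tsub (tsub (tmul tp tm) (tc 1)) (TVar (size env))) = idx.
    by rewrite !ev_tsub /= nth_rcons ltnn eqxx.
  set w := setc u' aAlive idx (ffits u' (idx %/ m) (idx %% m)).
  have sw : same_but [:: aAlive] u' w by move=> a; rewrite inE /w /setc => /negbTE ->.
  have ww j : idx < j -> w aAlive j = u' aAlive j.
    by move=> h; rewrite /w /setc eqxx gtn_eqF.
  suff post : same_but [:: aAlive] u w /\ (forall t v, t < p -> v < m -> p * m - i.+1 <= t * m + v ->
      w aAlive (t * m + v) = ffits w t v).
    split.
    + by rewrite ei; apply: leq_trans hpm; apply: ltnW.
    + by rewrite ev_tbool; apply: leq_trans (leq_b1 _) _; exact: ltnW (X1 ZX).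
    + by rewrite ev_tbool ei hf.
  split=> [a ha|t v ht hv hle]; first by rewrite sw // sb.
  have : idx <= t * m + v by rewrite /idx; lia.
  rewrite leq_eqVlt => /orP[/eqP e|lt].
    have et : t = idx %/ m by rewrite e divnMDl // divn_small // addn0.
    have ev' : v = idx %% m by rewrite e modnMDl modn_small.
    rewrite (ffits_ext sw ht hv); last by move=> j /andP[h _]; apply: ww; rewrite e.
    by rewrite -e et ev' /w /setc !eqxx.
  rewrite ww // al //; last by rewrite /idx in lt; lia.
  by rewrite (ffits_ext sw ht hv) // => j /andP[h _]; apply: ww; apply: ltn_trans lt h.
- by move=> u' b' [sb al]; apply: hQ => // t v ht hv; apply: al; rewrite //= subnn.
Qed.

Definition fbad u b :=
  [exists t : 'I_p, [&& fpar I u t == t, 0 < fowner I u t b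
    & [forall v : 'I_m, u aAlive (t * m + v) == 0]]].

Lemma holds_tbad u env b x : stable u env b x ->
  holds eps I u env (tbad (size env) b) = fbad u x.
Proof.
move=> hb.
have h1 b' : ev u (rcons env b') b = x by rewrite -cats1 hb.
have h4 b' : ev u (rcons env b') (TVar (size env)) = b' by rewrite /= nth_rcons ltnn eqxx.
have h5 b' b2 : ev u (rcons (rcons env b') b2) (TVar (size env)) = b'.
  by rewrite /= !nth_rcons size_rcons ltnS leqnn ltnn eqxx.
have h6 b' b2 : ev u (rcons (rcons env b') b2) (TVar (size env).+1) = b2.
  by rewrite /= nth_rcons size_rcons ltnn eqxx.
have E t : holds eps I u (rcons env t) (tmul (teq (tpar (TVar (size env))) (TVar (size env)))
    (tmul (towner (TVar (size env)) b) (tall RM (tnot (talive (TVar (size env)) (TVar (size env).+1))))))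
  = [&& fpar I u t == t, 0 < fowner I u t x & [forall v : 'I_m, u aAlive (t * m + v) == 0]].
  rewrite (holds_tand _ _ (teq _ _)) (holds_tand _ _ (towner _ _)) holds_teq ev_tpar h4.
  congr [&& _, _ & _]; first by rewrite /holds ev_towner h4 h1.
  apply/holds_tallP/forallP => h v.
    by have := h v (ltn_ord v); rewrite holds_tnot /holds ev_talive h5 h6 -eqn0Ngt.
  by move=> hv; have := h (Ordinal hv); rewrite holds_tnot /holds ev_talive h5 h6 -eqn0Ngt.
apply/holds_texP/existsP => [[t ht]|[t]].
  by rewrite E => h; exists (Ordinal ht).
by rewrite -E => h; exists t.
Qed.

Lemma fbad_ext u u' b : (forall a, a != aTau -> u' a = u a) -> fbad u' b = fbad u b.
Proof. by move=> h; rewrite /fbad /fpar /fowner /fdig !h. Qed.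

Definition next_tau u b := \max_(v < m) (nval I b v * (nval I b v < u aTau b)).

Lemma wp_lower_tau r u Q : bnd u ->
  (forall u', same_but [:: aTau] u u' ->
     (forall b, b < n -> u' aTau b = if fbad u b then next_tau u b else u aTau b) -> Q u') ->
  wp lower_tau [:: r] u Q.
Proof.
move=> bu hQ.
exists (fun i u' => same_but [:: aTau] u u' /\ forall b, b < n -> u' aTau b =
  if (b < i) && fbad u b then next_tau u b else u aTau b); split=> //.
move=> i u' hi b' [sb ht].
have hst : stable u' [:: r; i] (TVar 1) i by [].
have hbad : holds eps I u' [:: r; i] (tbad 2 (TVar 1)) = fbad u i.
  rewrite (holds_tbad hst); apply: fbad_ext => a ha; apply: sb; by rewrite inE.
have tau : u' aTau i = u aTau i by rewrite ht // ltnn.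
split.
- rewrite -lt0n -/(holds eps I u' [:: r; i] _) hbad => hb.
  have E : ev u' [:: r; i] (TMax RM (tmul (tval (TVar 1) (TVar 2)) (tlt (tval (TVar 1) (TVar 2)) (TCell aTau (TVar 1)))))
      = next_tau u i.
    rewrite ev_tmax; apply: eq_bigr => v _; rewrite ev_tmul ev_tlt ev_tval //= tau //.
  split; rewrite ?E.
  + by apply: leq_trans (ltnW hi) (ltnW (nX ZX)).
  + apply/bigmax_leqP => v _; apply: leq_trans (inputX (val_addr I i v)).
    by rewrite -/(nval I i v); case: (_ < _); rewrite ?muln1 ?muln0.
  + split=> [a ha|b hb']; first by rewrite /setc; move: ha; rewrite inE => /negbTE na; rewrite na sb // inE na.
    rewrite /setc eqxx /= ltnS leq_eqVlt; case: eqP => [->|_] /=; first by rewrite hb.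
    exact: ht.
- move=> /eqP; rewrite -[_ == 0]negbK -lt0n -/(holds eps I u' [:: r; i] _) hbad => hb.
  split=> // b hb'; rewrite ht // [b < i.+1]ltnS [b <= i]leq_eqVlt; case: eqP => [->|_] //=.
  by rewrite (negbTE hb) andbF.
by move=> u' b' [sb ht]; apply: hQ => // b hb; rewrite ht //= hb.
Qed.

Lemma wp_start_tau u Q : bnd u ->
  (forall u', same_but [:: aTau] u u' ->
    (forall b, b < n -> u' aTau b = \max_(v < m) nval I b v) -> Q u') ->
  wp start_tau [::] u Q.
Proof.
move=> bu hQ; apply: (@wp_fill R eps I X RN aTau _ [::] u (fun b => \max_(v < m) nval I b v)) => //.
- exact: ltnW (nX ZX).
- by move=> u' b hb _; rewrite ev_tmax; apply: eq_bigr => v _; rewrite ev_tval //=.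
- by move=> b hb; apply/bigmax_leqP => v _; apply: inputX.
Qed.

Section Coded.
Variables (itm ag par : nat -> nat).

(* The scale of type [b] in the intended allocation. *)
Definition scale b := \max_(t < p) nval I b (itm t).
(** Rounded up, so that in [tfits] the upper bound holds for the intended item and the lower one
    holds up to a single threshold. If the scale is 0, division by zero makes the level 0. *)
Definition level t b := (K * nval I b (itm t) + (scale b).-1) %/ scale b.

(** Only [aK], [aRep], [aHash] and [aDig] are constrained, and no stage after decoding writes them:
    the property survives to the end of a round. *)
Record coded u : Prop := Coded {
  cd_place : placement I itm ag par;
  cd_ef : forall i j, i < n -> j < n -> bundle_value I itm ag i j <= bundle_value I itm ag i i;
  cd_ready : ready I K u;
  cd_hash : forall t t', t < p -> t' < p ->
    color p m (u aHash 0) (itm t) = color p m (u aHash 0) (itm t') -> t = t';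
  cd_col : forall t, t < p -> fcol I u t = color p m (u aHash 0) (itm t);
  cd_par : forall t, t < p -> fpar I u t = par t;
  cd_level : forall t b, t < p -> b < n -> rep_of b = b -> flevel I u t b = level t b;
  cd_owner : forall t b, t < p -> b < n -> fowner I u t b = (b == rep_of (ag t))
}.

Lemma coded_ext u u' : coded u -> (forall a, a \in [:: aK; aRep; aHash; aDig] -> u' a = u a) -> coded u'.
Proof.
case=> h1 h2 [h3 h3'] h4 h5 h6 h7 h8 e.
have e1 := e aK isT; have e2 := e aRep isT; have e3 := e aHash isT; have e4 := e aDig isT.
split=> //; rewrite /fcol /fpar /flevel /fowner /fdig ?e1 ?e2 ?e3 ?e4 //.
by split; rewrite ?e1 ?e2.
Qed.

Lemma scale_le t b : t < p -> nval I b (itm t) <= scale b.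
Proof. by move=> ht; apply: (@bigop.leq_bigmax 'I_p (fun t => nval I b (itm t)) (Ordinal ht)). Qed.

Lemma level_ge t b : t < p -> K * nval I b (itm t) <= level t b * scale b.
Proof.
clear ZX inputX.
move=> ht; have [z|pos] := posnP (scale b).
  by have := scale_le b ht; rewrite z leqn0 => /eqP ->; rewrite muln0.
rewrite /level; have := divn_eq (K * nval I b (itm t) + (scale b).-1) (scale b).
by have := ltn_pmod (K * nval I b (itm t) + (scale b).-1) pos; move: (_ %/ _ * _) (_ %% _) => *; lia.
Qed.

Lemma level_le t b : level t b * scale b <= K * nval I b (itm t) + scale b.
Proof.
clear ZX inputX. apply: leq_trans (leq_trunc_div _ _) _; lia. Qed.

Lemma level_leK t b : t < p -> level t b <= K.
Proof.
clear ZX inputX.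
move=> ht; have [z|pos] := posnP (scale b); first by rewrite /level z divn0.
rewrite -ltnS ltn_divLR // mulSn; have : K * nval I b (itm t) <= K * scale b.
  by rewrite leq_mul2l scale_le ?orbT.
move: (K * _) (K * _) => *; lia.
Qed.

Lemma max_is_attained (f : nat -> nat) k : 0 < k -> exists2 t, t < k & \max_(t < k) f t = f t.
Proof.
move=> k0; have [|a [ak _] h] := @max_pick k f xpredT; first by exists 0.
by exists a => //; rewrite -h; apply: eq_bigr => i _; rewrite muln1.
Qed.

(** Induction from the leaves. The lower bound is tested for the owning type alone, and a child has
    the same owner as its parent; so the threshold must equal the scale for that one type only,
    while those of the other types may still be too large. *)
Lemma alive_intended u t : coded u -> alive_ok u ->
  (forall b, b < n -> rep_of b = b -> scale b <= u aTau b) ->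
  u aTau (rep_of (ag t)) = scale (rep_of (ag t)) ->
  t < p -> u aAlive (t * m + itm t) = 1.
Proof.
clear ZX inputX.
move=> cd ok tau.
suff main s : forall t, p - t <= s -> u aTau (rep_of (ag t)) = scale (rep_of (ag t)) -> t < p ->
    u aAlive (t * m + itm t) = 1 by exact: (main (p - t) t (leqnn _)).
have pl := cd_place cd; have [hK hR] := cd_ready cd.
elim: s => [|s IH] {}t hs own ht; first by lia.
rewrite ok ?(pl_itm pl) //; apply/eqP; rewrite eqb1; apply/and3P; split.
- by rewrite (cd_col cd).
- apply/forallP => b; apply/implyP; rewrite hR // => /eqP rb.
  rewrite (cd_level cd) // (cd_owner cd) // hK; apply/andP; split.
    by apply: leq_trans (level_ge _ ht) _; rewrite leq_mul2l tau ?orbT.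
  have [e|] := eqVneq; last by rewrite mul0n.
  by rewrite mul1n e own; apply: level_le.
- apply/forallP => t'; apply/implyP => /andP[lt]; rewrite (cd_par cd) // => /eqP e.
  have t'p := ltn_ord t'.
  have ne : par t' != t' by rewrite e neq_ltn lt.
  have [ad ga] := pl_edge pl t'p ne; rewrite e in ad ga.
  apply/existsP; exists (Ordinal (pl_itm pl t'p)); rewrite /= IH //; last first.
  + by rewrite -ga.
  + by lia.
  + by rewrite andbT lt0n nadjC ?(pl_itm pl).
Qed.

(** By [alive_intended], once the threshold of a type has come down to its scale, the intended items
    keep its trees alive. So a type found bad can be lowered further without danger. *)
Lemma bad_scale u b : coded u -> alive_ok u ->
  (forall b, b < n -> rep_of b = b -> scale b <= u aTau b) ->
  b < n -> fbad u b -> rep_of b = b /\ scale b < u aTau b.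
Proof.
move=> cd ok tau hb /existsP[t /and3P[hp ho /forallP hv]].
have ht := ltn_ord t; move: ho; rewrite (cd_owner cd) // lt0b => /eqP e.
have an := pl_ag (cd_place cd) ht.
have rb : rep_of b = b by rewrite e rep_of_idem.
split=> //; rewrite ltn_neqAle tau // andbT; apply/eqP => e2.
have := alive_intended cd ok tau (_ : u aTau (rep_of (ag t)) = _) ht.
rewrite -e -e2 => /(_ erefl); have := hv (Ordinal (pl_itm (cd_place cd) ht)) => /= /eqP -> //.
Qed.

End Coded.
End Search.

(** * Choosing agents, thresholds and items *)

Section Search.
Variables (R : realType) (eps : R) (I : instance) (X K : nat).
Local Notation m := (items I).
Local Notation n := (agents I).
Local Notation p := (nat_of_ord (budget I)).
Local Notation ev := (ev eps I).
Local Notation wp := (wp eps I X).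
Local Notation bnd u := (forall a i, u a i <= X).
Local Notation N := (hash_range p m).
Local Notation rep_of := (rep_of I).
Local Notation coded := (coded I K).
Implicit Types (u : state) (env : seq nat) (Q : state -> Prop).

Hypothesis ZX : large_bound I X.
Hypothesis inputX : forall b, input_memory I b <= X.

(** Agreement with the intended agents up to a permutation inside each type: same representatives
    and the same pattern of equalities. *)
Definition assigned k (ag : nat -> nat) u := forall t, t < k ->
  [/\ 0 < u aAg t <= n, rep_of (u aAg t).-1 = rep_of (ag t)
    & forall t', t' < k -> (u aAg t == u aAg t') = (ag t == ag t')].

(** If every agent of the type were in use, send each to the intended agent of a slot where it is
    used. This injects the type into itself without [ag t], which the earlier slots do not involve
    because [t] is a root. *)
Lemma free_agent itm ag par u u' t : coded itm ag par u -> t < p -> par t = t ->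
  assigned t ag u' -> exists2 a, a < n &
   (rep_of a == rep_of (ag t)) && ~~ [exists t' : 'I_p, (t' < t) && (u' aAg t' == a.+1)].
Proof.
move=> cd ht root asg; have pl := cd_place cd.
pose C := [set a : 'I_n | rep_of a == rep_of (ag t)].
pose free (a : 'I_n) := (rep_of a == rep_of (ag t)) && ~~ [exists t' : 'I_p, (t' < t) && (u' aAg t' == a.+1)].
have [/existsP[a fa]|/existsPn nofree] := boolP [exists a, free a]; first by exists a.
have used (a : 'I_n) : exists h : 'I_n, a \in C -> exists2 t', t' < t & u' aAg t' = a.+1 /\ ag t' = h.
  have [aC|] := boolP (a \in C); last by exists a.
  have := nofree a; rewrite inE in aC; rewrite /free aC /= negbK => /existsP[t' /andP[lt /eqP e]].
  by exists (Ordinal (pl_ag pl (ltn_ord t'))) => _; exists t'.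
have [h hP] := fin_all_exists used.
have hC : [set h a | a in C] \subset C :\ Ordinal (pl_ag pl ht).
  apply/subsetP => x /imsetP[a aC ->]; have [t' lt [e1 e2]] := hP a aC.
  rewrite !inE -val_eqE /= -e2; apply/andP; split.
    by apply/eqP; apply: (pl_root pl ht root lt).
  by have [_ <- _] := asg t' lt; rewrite e1 /=; move: aC; rewrite inE.
have h_inj : {in C &, injective h}.
  move=> a b aC bC hab; have [t1 lt1 [e1 g1]] := hP a aC; have [t2 lt2 [e2 g2]] := hP b bC.
  have [_ _ /(_ t2 lt2)] := asg t1 lt1; rewrite g1 g2 hab eqxx e1 e2 eqSS => /eqP.
  exact: val_inj.
have := subset_leq_card hC; rewrite card_in_imset //.
have := cardsD1 (Ordinal (pl_ag pl ht)) C; rewrite inE eqxx => ->.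
by rewrite add1n ltnn.
Qed.

(** Most codes describe nothing. The claim is therefore conditional on [coded], while the bounds on
    the stored values hold for every code. *)
Lemma wp_assign u Q : bnd u ->
  (forall u', same_but [:: aAg] u u' ->
     (forall itm ag par, coded itm ag par u -> assigned p ag u') -> Q u') ->
  wp assign [::] u Q.
Proof.
move=> bu hQ.
exists (fun i u' => same_but [:: aAg] u u' /\ forall itm ag par, coded itm ag par u -> assigned i ag u'); split.
- by split=> // itm ag par _ t; rewrite ltn0.
- move=> i u' hi b' [sb as_]; rewrite /= in hi.
  have iX : i <= X by have := pm I; have := mX ZX; move: hi; clear; lia.
  have fp : ev u' [:: i] (tpar (TVar 0)) = fpar I u i by rewrite ev_tpar /fpar /fdig sb.
  have hst : holds eps I u' [:: i] (teq (tpar (TVar 0)) (TVar 0)) = (fpar I u i == i).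
    by rewrite holds_teq fp.
  have sw x : same_but [:: aAg] u (setc u' aAg i x).
    by move=> a ha; rewrite /setc; move: (ha); rewrite inE => /negbTE ->; rewrite sb.
  have ext itm ag par x : coded itm ag par u -> 
      0 < x <= n -> rep_of x.-1 = rep_of (ag i) -> (forall t, t < i -> (u' aAg t == x) = (ag t == ag i)) ->
      assigned i.+1 ag (setc u' aAg i x).
    move=> cd h1 h2 h3 t; have asg := as_ _ _ _ cd.
    have old t' : t' < i -> setc u' aAg i x aAg t' = u' aAg t' by move=> h; rewrite /setc /= ltn_eqF.
    have new : setc u' aAg i x aAg i = x by rewrite /setc !eqxx.
    rewrite ltnS leq_eqVlt => /orP[/eqP->|lt].
      rewrite new; split=> // t'; rewrite ltnS leq_eqVlt => /orP[/eqP->|lt']; first by rewrite new !eqxx.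
      by rewrite old // eq_sym h3 // eq_sym.
    have [a1 a2 a3] := asg t lt; rewrite old //; split=> // t'.
    rewrite ltnS leq_eqVlt => /orP[/eqP->|lt']; first by rewrite new h3.
    by rewrite old // a3.
  split.
  + rewrite -lt0n -/(holds eps I u' [:: i] _) hst => /eqP root.
    set body := TMax _ _.
    have E : ev u' [:: i] body = \max_(a < n) (a.+1 *
        (fowner I u i (u aRep a) * ~~ [exists t' : 'I_p, (t' < i) && (u' aAg t' == a.+1)])).
      rewrite /body ev_tmax; apply: eq_bigr => a _; rewrite (ev_tmul _ _ (tadd _ _)) (ev_tmul _ _ (towner _ _)).
      rewrite ev_tadd ev_towner ev_tnot /fowner /fdig ev_tcell (sb aRep) // (sb aDig) //.
      rewrite [ev _ _ (tc 1)]/= addn1; congr (_ * (_ * nat_of_bool (~~ _))).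
      apply/holds_texP/existsP => [[t' ht']|[t']].
        rewrite (holds_tand _ _ (tlt _ _)) holds_tlt holds_teq ev_tcell ev_tadd /= addn1 => h.
        by exists (Ordinal ht').
      move=> h; exists t'; first exact: ltn_ord.
      by rewrite (holds_tand _ _ (tlt _ _)) holds_tlt holds_teq ev_tcell ev_tadd /= addn1.
    have bodyn : ev u' [:: i] body <= n.
      rewrite E; apply/bigmax_leqP => a _; rewrite /fowner.
      have : fdig I u i (2 + u aRep a) %% 2 < 2 by rewrite ltn_mod.
      case: (_ %% 2) => [|[|//]] _; case: (~~ _); rewrite ?muln0 ?mul0n ?muln0 //= !muln1; exact: ltn_ord.
    split; [exact: iX|exact: leq_trans bodyn (ltnW (nX ZX))|split; first exact: sw].
    move=> itm ag par cd; have asg := as_ _ _ _ cd.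
    have rt : par i = i by rewrite -(cd_par cd).
    have [|a [an /andP[ra fr]] Ea] := @max_pick n succn (fun a => (rep_of a == rep_of (ag i)) &&
        ~~ [exists t' : 'I_p, (t' < i) && (u' aAg t' == a.+1)]).
      exact: (free_agent cd hi rt asg).
    have {}E : ev u' [:: i] body = a.+1.
      rewrite E -Ea; apply: eq_bigr => c _; congr (_ * _); rewrite (cd_ready cd).2 // (cd_owner cd) //.
        by rewrite -mulnb.
      by have [] := rep_ofP (ltn_ord c).
    rewrite E; apply: (ext itm ag par) => //=; first exact: (eqP ra).
    move=> t lt; have tp : t < p by apply: ltn_trans lt hi.
    have -> : (ag t == ag i) = false by apply/eqP; apply: (pl_root (cd_place cd) hi rt lt).
    by apply: contraNF fr => h; apply/existsP; exists (Ordinal tp); rewrite /= lt.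
  + move=> /eqP; rewrite -[_ == 0]negbK -lt0n -/(holds eps I u' [:: i] _) hst => nroot.
    split; [exact: iX|exact: b'|split; first exact: sw].
    move=> itm ag par cd; have pl := cd_place cd.
    have e : fpar I u i = par i by rewrite (cd_par cd).
    rewrite e in nroot; have [_ ga] := pl_edge pl hi nroot.
    have lt : par i < i by rewrite ltn_neqAle nroot (pl_par pl).
    have [h1 h2 h3] := as_ _ _ _ cd (par i) lt.
    rewrite ev_tcell fp e; apply: (ext itm ag par) => //.
      by rewrite h2 ga.
    by move=> t lt'; rewrite eq_sym h3 // ga eq_sym.
- by move=> u' b' [sb h]; apply: hQ.
Qed.

(** The termination measure of the rounds. It starts at most at [n * m] and drops whenever a bad
    type is lowered, which is why [n * m + 1] rounds suffice. *)
Definition slack u := \sum_(b < n) \sum_(v < m) (nval I b v < u aTau b).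

Lemma slack_le u : slack u <= n * m.
Proof.
apply: (@leq_trans (\sum_(b < n) m)); last by rewrite sum_nat_const card_ord.
apply: leq_sum => b _; apply: (@leq_trans (\sum_(v < m) 1)); last by rewrite sum1_card card_ord.
by apply: leq_sum => v _; apply: leq_b1.
Qed.

Lemma next_tau_lt u b : (exists2 v, v < m & nval I b v < u aTau b) -> next_tau I u b < u aTau b.
Proof. by move=> /(max_pick (nval I b)) [a [am h]]; rewrite /next_tau => ->. Qed.

(** The item value that becomes the new threshold is no longer strictly below it, so at least one
    pair stops counting and none is added. *)
Lemma slack_lower u u' : (forall b, b < n -> u' aTau b = if fbad I u b then next_tau I u b else u aTau b) ->
  (forall b, b < n -> fbad I u b -> exists2 v, v < m & nval I b v < u aTau b) ->
  (exists b : 'I_n, fbad I u b) -> slack u' < slack u.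
Proof.
move=> htau hex [b0 bad0].
have le (b : 'I_n) : \sum_(v < m) (nval I b v < u' aTau b) <= \sum_(v < m) (nval I b v < u aTau b).
  apply: leq_sum => v _; rewrite htau //; case: ifP => // bb.
  have lt := next_tau_lt (hex b (ltn_ord b) bb).
  by case h: (nval I b v < next_tau I u b) => //; rewrite (ltn_trans h lt).
rewrite /slack (bigD1 b0) //= [X in _ < X](bigD1 b0) //= -addSn; apply: leq_add; last by apply: leq_sum.
have [v [vm lt] Emax] := max_pick (nval I b0) (hex b0 (ltn_ord b0) bad0).
rewrite (bigD1 (Ordinal vm)) //= [X in _ < X](bigD1 (Ordinal vm)) //= lt htau // bad0 {1}/next_tau Emax ltnn.
rewrite add0n add1n ltnS; apply: leq_sum => v' _.
by case h: (nval I b0 v' < next_tau I u b0) => //; rewrite (ltn_trans h (next_tau_lt (hex b0 (ltn_ord b0) bad0))).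
Qed.

Lemma wp_rounds u Q : bnd u ->
  (forall u', same_but [:: aTau; aAlive] u u' -> alive_ok I u' ->
     (forall itm ag par, coded itm ag par u -> forall b, b < n -> ~~ fbad I u' b) -> Q u') ->
  wp rounds [::] u Q.
Proof.
move=> bu hQ.
pose tau_ok u' := forall itm ag par, coded itm ag par u -> forall b, b < n -> rep_of b = b -> scale I itm b <= u' aTau b.
apply: (@wp_seq _ _ _ _ _ _ _ _ tau_ok).
  apply: wp_start_tau => // u' sb ht itm ag par cd b hb _; rewrite ht //.
  apply/bigmax_leqP => t _.
  exact: (@bigop.leq_bigmax 'I_m (fun v => nval I b v) (Ordinal (pl_itm (cd_place cd) (ltn_ord t)))).
move=> u1 b1 t1 f1.
apply: (@wp_seq _ _ _ _ _ _ _ _ (alive_ok I)).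
  by apply: (wp_mark_alive eps ZX [::]).
move=> u2 b2 ok2 f2.
exists (fun r u' => [/\ same_but [:: aTau; aAlive] u2 u', alive_ok I u', tau_ok u' &
  forall itm ag par, coded itm ag par u -> (forall b, b < n -> ~~ fbad I u' b) \/ r + slack u' <= n * m]); split.
- split=> //.
  + by move=> itm ag par cd b hb rb; rewrite f2 //; apply: t1 cd b hb rb.
  + by move=> itm ag par cd; right; rewrite add0n slack_le.
- move=> r u' hr b' [sb ok tk prog].
  have cdu itm ag par : coded itm ag par u -> coded itm ag par u'.
    move=> cd; apply: coded_ext cd _ => a; rewrite !inE => ha.
    by rewrite sb ?f2 ?f1 //; case/or4P: ha => /eqP ->.
  have hex : holds eps I u' [:: r] (tex RN (tbad 2 (TVar 1))) = [exists b : 'I_n, fbad I u' b].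
    have hb b : holds eps I u' [:: r; b] (tbad 2 (TVar 1)) = fbad I u' b by apply: (@holds_tbad R eps I u' [:: r; b]).
    apply/holds_texP/existsP => [[b hb']|[b]]; first by rewrite hb => h; exists (Ordinal hb').
    by rewrite -hb => h; exists b; first exact: ltn_ord.
  split.
  + rewrite -lt0n -/(holds eps I u' [:: r] _) hex => /existsP[b0 bad0].
    apply: (@wp_seq _ _ _ _ _ _ _ _ (fun w => forall b, b < n -> w aTau b = if fbad I u' b then next_tau I u' b else u' aTau b)).
      by apply: wp_lower_tau.
    move=> u3 b3 ht3 f3; apply: (wp_mark_alive eps ZX [:: r]) => // u4 f4 ok4.
    have tau4 b : b < n -> u4 aTau b = if fbad I u' b then next_tau I u' b else u' aTau b.
      by move=> hb; rewrite f4 // ht3.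
    (* The scale of a bad type is itself an item value below the threshold. So the next smaller
       value exists and is at least the scale. *)
    have witness itm ag par b : coded itm ag par u -> b < n -> fbad I u' b ->
        exists2 v, v < m & nval I b v < u' aTau b /\ scale I itm b = nval I b v.
      move=> cd hb bb; have [rb lt] := bad_scale (cdu _ _ _ cd) ok (tk _ _ _ cd) hb bb.
      have p0 : 0 < p by case/existsP: bb => t _; apply: leq_ltn_trans (ltn_ord t).
      have [t tp e] := max_is_attained (fun t => nval I b (itm t)) p0.
      by exists (itm t); [exact: (pl_itm (cd_place cd) tp)|rewrite -e].
    split=> //.
    * move=> a ha; rewrite f4 ?f3 ?sb //; move: ha; rewrite !inE => /norP[h1 h2] //.
    * move=> itm ag par cd b hb rb; rewrite tau4 //; case: ifP => bb; last exact: tk cd b hb rb.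
      have [v vm [lt ->]] := witness _ _ _ _ cd hb bb.
      have := @bigop.leq_bigmax 'I_m (fun v => nval I b v * (nval I b v < u' aTau b)) (Ordinal vm).
      by rewrite /= lt muln1.
    * move=> itm ag par cd; right; case: (prog _ _ _ cd) => [/(_ b0 (ltn_ord b0))|h]; first by rewrite bad0.
      have : slack u4 < slack u'.
        apply: slack_lower tau4 _ _; last by exists b0.
        by move=> b hb bb; have [v vm [lt _]] := witness _ _ _ _ cd hb bb; exists v.
      by clear -h; lia.
  + move=> /eqP; rewrite -[_ == 0]negbK -lt0n -/(holds eps I u' [:: r] _) hex => /existsPn nob.
    split=> // itm ag par cd; left => b hb; exact: (nob (Ordinal hb)).
- move=> u3 b3 [sb ok tk prog]; apply: hQ => //.
  + by move=> a ha; rewrite sb // f2 ?f1 //; move: ha; rewrite !inE => /norP[].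
  + move=> itm ag par cd; case: (prog _ _ _ cd) => // /=; rewrite addn1; clear; lia.
Qed.

Lemma wp_select u Q : bnd u ->
  (forall u', same_but [:: aSol] u u' ->
     (forall itm ag par, coded itm ag par u -> alive_ok I u -> (forall b, b < n -> ~~ fbad I u b) ->
        forall t, t < p -> [/\ u' aSol t < m, 0 < u aAlive (t * m + u' aSol t)
          & par t != t -> 0 < nadj I (u' aSol t) (u' aSol (par t))]) -> Q u') ->
  wp select [::] u Q.
Proof.
move=> bu hQ.
exists (fun i u' => same_but [:: aSol] u u' /\ 
    forall itm ag par, coded itm ag par u -> alive_ok I u -> (forall b, b < n -> ~~ fbad I u b) ->
        forall t, t < i -> [/\ u' aSol t < m, 0 < u aAlive (t * m + u' aSol t)
          & par t != t -> 0 < nadj I (u' aSol t) (u' aSol (par t))]); split=> //.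
- move=> i u' hi b' [sb inv]; rewrite /= in hi.
  have iX : i <= X by have := pm I; have := mX ZX; move: hi; clear; lia.
  set body := TMax _ _.
  have bodym : ev u' [:: i] body <= X.
    rewrite /body ev_tmax; apply/bigmax_leqP => v _; rewrite ev_tmul ev_tbool.
    apply: (@leq_trans m); last exact: ltnW (mX ZX).
    by case: holds; rewrite ?muln1 ?muln0 //= ltnW.
  split=> //; split.
    by move=> a ha; rewrite /setc; move: (ha); rewrite inE => /negbTE ->; rewrite sb.
  move=> itm ag par cd ok nob.
  have {inv} inv := inv _ _ _ cd ok nob; have pl := cd_place cd.
  pose P v := (0 < u aAlive (i * m + v)) && ((par i == i) || (0 < nadj I v (u' aSol (par i)))).
  have fp : fpar I u' i = par i by rewrite -(cd_par cd) // /fpar /fdig sb.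
  have E : ev u' [:: i] body = \max_(v < m) (v * P v).
    rewrite /body ev_tmax; apply: eq_bigr => v _; rewrite ev_tmul ev_tbool; congr (_ * nat_of_bool _).
    rewrite (holds_tand _ _ (talive _ _)) (holds_tor _ _ (teq _ _)) holds_teq ev_tpar.
    rewrite /P [ev u' [:: i; v : nat] (TVar 0)]/= fp; congr (_ && _).
      by rewrite /holds ev_talive /= sb.
    case: eqP => //= /eqP ne.
    have lt : par i < i by rewrite ltn_neqAle ne (pl_par pl).
    have [h1 _ _] := inv _ lt.
    have es v' : ev u' [:: i; v'] (TCell aSol (tpar (TVar 0))) = u' aSol (par i).
      by rewrite ev_tcell ev_tpar [ev _ _ (TVar 0)]/= fp.
    by rewrite /holds ev_tadj ?es //=.
  (* A root has a live item because no type is bad. Elsewhere the item of the parent is live, and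
     for that it needed a live neighbour at this slot. *)
  have [|v [vm Pv] Ev] := @max_pick m id P.
    have [r|ne] := eqVneq (par i) i.
      have rb := cd_owner cd hi.
      have [rn _] := rep_ofP (pl_ag pl hi).
      have := nob _ rn; rewrite /fbad negb_exists => /forallP /(_ (Ordinal hi)) /=.
      rewrite (cd_par cd) // r eqxx rb // eqxx /= negb_forall => /existsP[v hv].
      by exists v => //; rewrite /P r eqxx lt0n hv.
    have lt : par i < i by rewrite ltn_neqAle ne (pl_par pl).
    have lp : par i < p by apply: ltn_trans lt hi.
    have [h1 h2 _] := inv _ lt.
    move: h2; rewrite ok // lt0b => /and3P[_ _ /forallP /(_ (Ordinal hi)) /=].
    rewrite lt (cd_par cd) // eqxx /= => /existsP[v /andP[a1 a2]].
    by exists v => //; rewrite /P a2 nadjC // a1 orbT.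
  have {}E : ev u' [:: i] body = v by rewrite E Ev.
  have old t : t < i -> setc u' aSol i (ev u' [:: i] body) aSol t = u' aSol t by move=> h; rewrite /setc /= ltn_eqF.
  have new : setc u' aSol i (ev u' [:: i] body) aSol i = v by rewrite /setc !eqxx E.
  move=> t; rewrite ltnS leq_eqVlt => /orP[/eqP->|lt].
    case/andP: Pv => P1 P2; rewrite [X in setc u' aSol X]/= in old new; rewrite new; split=> // ne.
    by rewrite old; [rewrite (negbTE ne) in P2|rewrite ltn_neqAle ne (pl_par pl)].
  have [h1 h2 h3] := inv t lt; rewrite old //; split=> // ne; rewrite old; first exact: h3.
  by apply: (leq_ltn_trans _ lt); apply: (pl_par pl); exact: ltn_trans lt hi.
- by move=> u' b' [sb h]; apply: hQ.
Qed.

End Search.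

(** * The rounding error *)

(** The chain is [k (x - y) <= 2 q T <= (k - q) e T <= (h - q) e T <= k y e]. Here [y] and [x] are
    the values of the own and the other bundle, [h] is the level sum of the own one, [T] the
    threshold, [k = K] and [q = p]. *)
Lemma envy_margin (F : realFieldType) (x y T h k q e : F) :
  (0 < e -> 0 <= T -> 0 <= q -> q < k -> 2 * q <= (k - q) * e ->
   h * T <= k * y + q * T -> k * x <= (h + q) * T -> k <= h -> x - y <= y * e)%R.
Proof.
move=> e0 T0 q0 qk pr lo hi kh; have k0 : (0 < k)%R by apply: le_lt_trans qk.
rewrite -(ler_pM2l k0).
have a1 : (0 <= ((k - q) * e - 2 * q) * T)%R by rewrite mulr_ge0 // subr_ge0.
have a2 : (0 <= (h - k) * (T * e))%R by rewrite !mulr_ge0 ?subr_ge0 // ltW.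
have a3 : (0 <= (k * y + q * T - h * T) * e)%R by rewrite mulr_ge0 ?subr_ge0 // ltW.
nra.
Qed.

Section Verify.
Variables (R : realType) (eps : R) (I : instance) (K : nat).
Local Notation m := (items I).
Local Notation n := (agents I).
Local Notation p := (nat_of_ord (budget I)).
Local Notation ev := (ev eps I).
Local Notation rep_of := (rep_of I).
Local Notation coded := (coded I K).
Implicit Types (u : state).

Hypothesis eps_gt0 : (0 < eps)%R.
Hypothesis precise : ((2 * p)%:R <= (K - p)%:R * eps)%R.

Definition bundle u i j := \sum_(t < p) (u aAg t == j.+1) * nval I i (u aSol t).

Lemma bundleE u i j : bundle u i j = \sum_(t < p | u aAg t == j.+1) nval I i (u aSol t).
Proof. by rewrite [RHS]big_mkcond; apply: eq_bigr => t _; case: eqP; rewrite ?mul1n. Qed.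

Lemma precise_gt : 0 < p -> p < K.
Proof.
move=> p0; rewrite ltnNge; apply/negP => h; move: precise; rewrite (eqP (h : K - p == 0)) mul0r.
by rewrite lern0 muln_eq0 /= => /eqP h0; rewrite h0 in p0.
Qed.

(** Sending an intended agent to the one that the program uses in its place is an injective map of a
    type into itself, hence onto. *)
Lemma assigned_onto itm ag par u r : placement I itm ag par -> assigned I p ag u ->
  (forall a, a < n -> rep_of a = r -> exists2 t, t < p & ag t = a) ->
  forall a, a < n -> rep_of a = r -> exists2 t, t < p & u aAg t = a.+1.
Proof.
move=> pl asg onto a an ra.
pose C := [set a : 'I_n | rep_of a == r].
have ex (c : 'I_n) : exists h : 'I_n, c \in C -> exists2 t, t < p & ag t = c /\ u aAg t = h.+1.
  have [cC|] := boolP (c \in C); last by exists c.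
  move: cC; rewrite inE => /eqP /(onto c (ltn_ord c)) [t tp e].
  have [/andP[h1 h2] _ _] := asg t tp.
  have lt : (u aAg t).-1 < n by rewrite prednK.
  by exists (Ordinal lt) => _; exists t; rewrite //= prednK.
have [h hP] := fin_all_exists ex.
have hC : [set h c | c in C] = C.
  apply/eqP; rewrite eqEcard; apply/andP; split.
    apply/subsetP => x /imsetP[c cC ->]; have [t tp [e1 e2]] := hP c cC.
    have [_ e3 _] := asg t tp; rewrite inE; rewrite e2 e1 /= in e3.
    by rewrite e3; move: cC; rewrite inE.
  rewrite card_in_imset // => c d cC dC hcd.
  have [t tp [e1 e2]] := hP c cC; have [t' tp' [e1' e2']] := hP d dC.
  have [_ _ /(_ t' tp')] := asg t tp; rewrite e2 e2' hcd eqxx e1 e1' => /esym /eqP.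
  exact: val_inj.
have : Ordinal an \in [set h c | c in C] by rewrite hC inE /= ra.
case/imsetP => c cC e; have [t tp [_ e2]] := hP c cC.
by exists t; rewrite // e2 -e.
Qed.

Lemma sum_le_count (P : pred nat) (f g : nat -> nat) c x y :
  (forall t, t < p -> P t -> f t * x <= c * g t + y) ->
  (\sum_(t < p | P t) f t) * x <= c * (\sum_(t < p | P t) g t) + p * y.
Proof.
move=> h; rewrite big_distrl big_distrr /=.
apply: (@leq_trans (\sum_(t < p | P t) (c * g t + y))).
  by apply: leq_sum => t Pt; apply: h.
rewrite big_split leq_add2l sum_nat_const leq_mul2r; apply/orP; right.
by apply: leq_trans (max_card _) _; rewrite card_ord.
Qed.

(** The found and the intended item of a slot may differ in value but share the level, counted in
    units of [tau / K] for the former and [scale / K] for the latter. Sums of levels thus carry the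
    intended envy-freeness over, even if [tau] exceeds the scale. *)
Lemma envy_bound itm ag par u i j : coded itm ag par u -> assigned I p ag u -> alive_ok I u ->
  (forall t, t < p -> u aSol t < m /\ 0 < u aAlive (t * m + u aSol t)) ->
  i < n -> j < n ->
  ((bundle u i j - bundle u i i)%:R <= (bundle u i i)%:R * eps)%R.
Proof.
move=> cd asg ok sol hi hj; have pl := cd_place cd; have [hK hR] := cd_ready cd.
have [bn bv] := rep_ofP hi; set b := rep_of i in bn bv *.
have rb : rep_of b = b by apply: rep_of_idem.
have sum0 : (forall t, t < p -> nval I b (u aSol t) = 0) -> bundle u i j = 0.
  move=> h; rewrite /bundle big1 // => t _; have [h1 _] := sol t (ltn_ord t).
  by rewrite bv // h // muln0.
have zero : bundle u i j = 0 -> ((bundle u i j - bundle u i i)%:R <= (bundle u i i)%:R * eps)%R.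
  by move=> ->; rewrite sub0n mulr_ge0 // ltW.
have [p0|p0] := posnP p; first by apply/zero/sum0 => t; rewrite p0.
have pK := precise_gt p0.
have fits t : t < p -> K * nval I b (u aSol t) <= level I K itm t b * u aTau b /\
    (b = rep_of (ag t) -> level I K itm t b * u aTau b <= K * nval I b (u aSol t) + u aTau b).
  move=> ht; have [h1 h2] := sol t ht; move: h2; rewrite ok // lt0b => /and3P[_ /forallP /(_ (Ordinal bn)) /= + _].
  rewrite hR // rb eqxx /= hK (cd_level cd) // (cd_owner cd) // => /andP[f1 f2]; split=> // e.
  by move: f2; rewrite -e eqxx mul1n.
(* Scale 0 makes all levels 0, and as [K > 0] the upper bound then forces the chosen items to be
   worth nothing to this type. *)
have [s0|spos] := posnP (scale I itm b).
  apply/zero/sum0 => t ht; have [f1 _] := fits t ht.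
  move: f1; rewrite /level s0 divn0 mul0n leqn0 muln_eq0 => /orP[/eqP k0|/eqP //].
  by rewrite k0 in pK.
have same c x : c < n -> rep_of c = b -> bundle_value I itm ag c x = bundle_value I itm ag b x.
  move=> cn rc; apply: eq_bigr => t _; have [_ h] := rep_ofP cn.
  by rewrite h ?rc // (pl_itm pl).
have rich c : c < n -> rep_of c = b -> scale I itm b <= bundle_value I itm ag c c.
  move=> cn rc; have [t0 t0p e0] := max_is_attained (fun t => nval I b (itm t)) p0.
  apply: leq_trans (cd_ef cd cn (pl_ag pl t0p)); rewrite same // /scale e0 /bundle_value.
  by rewrite (bigD1 (Ordinal t0p)) //= leq_addr.
(* Every agent of the type thus holds something in the intended allocation, hence also in the found
   one. Otherwise [i] might be left with nothing and its envy would have no bound. *)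
have [r rp er] : exists2 r, r < p & u aAg r = i.+1.
  apply: (assigned_onto (r := b) pl asg) => // c cn rc.
  have := leq_trans spos (rich c cn rc); rewrite lt0n /bundle_value sum_nat_eq0 negb_forall => /existsP[t].
  by rewrite negb_imply => /andP[/eqP e _]; exists t.
have [_ ra rE] := asg r rp; rewrite er /= -/b in ra.
set a := ag r in ra rE; have an : a < n := pl_ag pl rp.
have setE t : t < p -> (u aAg t == i.+1) = (ag t == a) by move=> ht; rewrite -er eq_sym rE // eq_sym.
pose H k := \sum_(t < p | u aAg t == k.+1) level I K itm t b.
pose tau := u aTau b; pose s := scale I itm b.
have bunb k : bundle u i k = \sum_(t < p | u aAg t == k.+1) nval I b (u aSol t).
  by rewrite bundleE; apply: eq_bigr => t _; have [h1 _] := sol t (ltn_ord t); rewrite bv.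
have low : H i * tau <= K * bundle u i i + p * tau.
  rewrite bunb; apply: (@sum_le_count (fun t => u aAg t == i.+1) (fun t => level I K itm t b) (fun t => nval I b (u aSol t))).
  move=> t tp /eqP e; have [_ f2] := fits t tp; apply: f2.
  by have [_ + _] := asg t tp; rewrite e.
have high : K * bundle u i j <= H j * tau.
  rewrite bunb big_distrr big_distrl /=; apply: leq_sum => t _; by have [] := fits t (ltn_ord t).
have HiE : H i = \sum_(t < p | ag t == a) level I K itm t b.
  by apply: eq_bigl => t; rewrite setE.
have Hi1 : K * bundle_value I itm ag b a <= H i * s.
  rewrite HiE /bundle_value big_distrr big_distrl /=; apply: leq_sum => t _; by apply: level_ge; apply: ltn_ord.
have KHi : K <= H i.
  rewrite -(leq_pmul2r spos); apply: leq_trans Hi1; rewrite leq_mul2l; apply/orP; right.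
  by rewrite -(same a) //; apply: rich.
(* Intended envy-freeness in terms of levels: rounding up adds at most 1 for each of at most [p]
   slots. *)
have HjHi : H j <= H i + p.
  have [/existsP[t /eqP e]|/existsPn no] := boolP [exists t : 'I_p, u aAg t == j.+1]; last first.
    by rewrite /H big_pred0 // => t; apply/negbTE.
  have [_ _ tE] := asg t (ltn_ord t).
  have HjE : H j = \sum_(t' < p | ag t' == ag t) level I K itm t' b.
    by apply: eq_bigl => t'; rewrite -e eq_sym tE // eq_sym.
  have h1 : H j * s <= K * bundle_value I itm ag b (ag t) + p * s.
    rewrite HjE; apply: (@sum_le_count (fun t' => ag t' == ag t) (fun t => level I K itm t b) (fun t => nval I b (itm t))).
    by move=> t' tp' _; apply: level_le.
  rewrite -(leq_pmul2r spos) mulnDl; apply: leq_trans h1 _; rewrite leq_add2r.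
  apply: leq_trans Hi1; rewrite leq_mul2l; apply/orP; right.
  by rewrite -!(same a) //; apply: (cd_ef cd) => //; apply: (pl_ag pl).
have {}high : K * bundle u i j <= (H i + p) * tau by apply: leq_trans high _; rewrite leq_mul2r HjHi orbT.
have [le|/ltnW le] := leqP (bundle u i j) (bundle u i i).
  by rewrite (eqP (le : _ - _ == 0)) mulr_ge0 // ltW.
rewrite natrB //; apply: (@envy_margin _ _ _ tau%:R (H i)%:R K%:R p%:R).
- exact: eps_gt0.
- exact: ler0n.
- exact: ler0n.
- by rewrite ltr_nat.
- by move: precise; rewrite natrM natrB // ltnW.
- by move: low; rewrite -(ler_nat R) natrD !natrM.
- by move: high; rewrite -(ler_nat R) !natrM natrD.
- by rewrite ler_nat.
Qed.

End Verify.

(** * Trying one code *)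

Section Step.
Variables (R : realType) (eps : R) (I : instance) (X K : nat).
Local Notation m := (items I).
Local Notation n := (agents I).
Local Notation p := (nat_of_ord (budget I)).
Local Notation ev := (ev eps I).
Local Notation wp := (wp eps I X).
Local Notation bnd u := (forall a i, u a i <= X).
Local Notation N := (hash_range p m).
Local Notation rep_of := (rep_of I).
Local Notation coded := (coded I K).
Implicit Types (u : state) (Q : state -> Prop).

Record verified u : Prop := Verified {
  vf_range : forall t, t < p -> u aSol t < m /\ 0 < u aAg t <= n;
  vf_inj : forall t t', t < p -> t' < p -> u aSol t = u aSol t' -> t = t';
  vf_edge : forall t, t < p -> fpar I u t != t ->
    [/\ fpar I u t < t, u aAg (fpar I u t) = u aAg t & 0 < nadj I (u aSol t) (u aSol (fpar I u t))];
  vf_root : forall t t', t < p -> fpar I u t = t -> t' < t -> u aAg t' <> u aAg t;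
  vf_envy : forall i j, i < n -> j < n ->
    ((bundle I u i j - bundle I u i i)%:R <= (bundle I u i i)%:R * eps)%R
}.

Lemma ev_tbundle l u env i j x y : size env = l -> stable eps I u env i x -> stable eps I u env j y ->
  (forall t, t < p -> u aSol t < m) -> x < n ->
  ev u env (tbundle l i j) = bundle I u x y.
Proof.
move=> <- hi hj sol xn; rewrite /tbundle ev_tsum; apply: eq_bigr => t _.
have tE : ev u (rcons env t) (TVar (size env)) = t by rewrite /= nth_rcons ltnn eqxx.
have iE : ev u (rcons env t) i = x by rewrite -cats1 hi.
have jE : ev u (rcons env t) j = y by rewrite -cats1 hj.
rewrite ev_tmul ev_teq ev_tadd jE [ev _ _ (tc 1)]/= addn1 ev_tcell tE.
by rewrite ev_tval ?ev_tcell ?tE ?iE //; apply: sol; apply: ltn_ord.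
Qed.

Lemma holds_tverify u : reflect (verified u) (holds eps I u [::] tverify).
Proof.
have cellE env a l : ev u env (TCell a (TVar l)) = u a (nth 0 env l) by [].
apply: (iffP idP); rewrite /tverify !(holds_tand _ _ (tall _ _)).
  case/and5P => /holds_tallP h1 /holds_tallP h2 /holds_tallP h3 /holds_tallP h4 /holds_tallP h5.
  have sol t : t < p -> u aSol t < m.
    by move=> tp; have := h1 t tp; rewrite (holds_tand _ _ (tlt _ _)) holds_tlt => /andP[].
  split.
  - move=> t tp; have := h1 t tp.
    rewrite (holds_tand _ _ (tlt _ _)) (holds_tand _ _ (tle _ _)) holds_tlt !holds_tle.
    by case/and3P => a1 a2 a3; split=> //; apply/andP.
  - move=> t t' tp tp' e; have /holds_tallP /(_ t' tp') := h2 t tp.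
    by rewrite (holds_tor _ _ (teq _ _)) holds_tnot !holds_teq /= e eqxx orbF => /eqP.
  - move=> t tp ne; have := h3 t tp.
    rewrite (holds_tor _ _ (teq _ _)) (holds_tand _ _ (tlt _ _)) (holds_tand _ _ (teq _ _)) !holds_teq holds_tlt.
    rewrite !ev_tpar [ev _ _ (TVar 0)]/= (negbTE ne) /= => /and3P[a1 /eqP a2 a3].
    have pp : fpar I u t < p by apply: ltn_trans tp.
    split=> //; move: a3; rewrite /holds ev_tadj //=; [exact: sol|exact: sol].
  - move=> t t' tp e lt; have /holds_tallP /(_ t' (ltn_trans lt tp)) := h4 t tp.
    rewrite holds_tif (holds_tand _ _ (teq _ _)) holds_teq holds_tlt holds_tnot holds_teq.
    by rewrite ev_tpar /= e eqxx lt /= => /eqP.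
  - move=> i j hi hj; have /holds_tallP /(_ j hj) := h5 i hi.
    rewrite holds_teps ev_tsub !(@ev_tbundle 2 u [:: i; j] (TVar 0) (TVar 0) i i) //.
    by rewrite (@ev_tbundle 2 u [:: i; j] (TVar 0) (TVar 1) i j).
case=> h1 h2 h3 h4 h5; have sol t : t < p -> u aSol t < m by move=> /h1[].
apply/and5P; split; apply/holds_tallP => t tp.
- have [a1 /andP[a2 a3]] := h1 t tp.
  rewrite (holds_tand _ _ (tlt _ _)) (holds_tand _ _ (tle _ _)) holds_tlt !holds_tle.
  by apply/and3P.
- apply/holds_tallP => t' tp'; rewrite (holds_tor _ _ (teq _ _)) holds_tnot !holds_teq /=.
  by case: eqP => //= ne; apply/eqP => e; apply/ne/h2.
- rewrite (holds_tor _ _ (teq _ _)) (holds_tand _ _ (tlt _ _)) (holds_tand _ _ (teq _ _)) !holds_teq holds_tlt.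
  rewrite !ev_tpar [ev _ _ (TVar 0)]/=; case: eqP => //= /eqP ne.
  have [a1 a2 a3] := h3 t tp ne; have pp : fpar I u t < p by apply: ltn_trans tp.
  apply/and3P; split=> //; first by apply/eqP.
  by rewrite /holds ev_tadj //=; [exact: sol|exact: sol].
- apply/holds_tallP => t' tp'.
  rewrite holds_tif (holds_tand _ _ (teq _ _)) holds_teq holds_tlt holds_tnot holds_teq.
  rewrite ev_tpar /=; case: andP => // -[/eqP e lt]; apply/eqP; exact: h4.
- apply/holds_tallP => j hj.
  rewrite holds_teps ev_tsub !(@ev_tbundle 2 u [:: t; j] (TVar 0) (TVar 0) t t) //.
  by rewrite (@ev_tbundle 2 u [:: t; j] (TVar 0) (TVar 1) t j) //; apply: h5.
Qed.

Hypothesis eps_gt0 : (0 < eps)%R.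
Hypothesis precise : ((2 * p)%:R <= (K - p)%:R * eps)%R.

Lemma verified_intended itm ag par u : coded itm ag par u -> assigned I p ag u -> alive_ok I u ->
  (forall t, t < p -> [/\ u aSol t < m, 0 < u aAlive (t * m + u aSol t)
     & par t != t -> 0 < nadj I (u aSol t) (u aSol (par t))]) -> verified u.
Proof.
move=> cd asg ok sol; have pl := cd_place cd.
split.
- by move=> t tp; have [h _ _] := sol t tp; have [h' _ _] := asg t tp.
- move=> t t' tp tp' e; apply: (cd_hash cd) => //.
  (* Trees are filled independently of each other; what keeps their items apart is that each chosen
     item has the guessed color of its slot. *)
  have col s : s < p -> color p m (u aHash 0) (u aSol s) = color p m (u aHash 0) (itm s).
    move=> sp; have [h1 h2 _] := sol s sp; move: h2; rewrite ok // lt0b => /and3P[/eqP -> _ _].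
    by rewrite (cd_col cd).
  by rewrite -!col // e.
- move=> t tp; rewrite (cd_par cd) // => ne; have [_ _ h] := sol t tp.
  have lt : par t < t by rewrite ltn_neqAle ne (pl_par pl).
  have [_ e] := pl_edge pl tp ne; split=> //; last exact: h.
  by have [_ _ /(_ _ (ltn_trans lt tp))] := asg t tp; rewrite e eqxx => /eqP.
- move=> t t' tp; rewrite (cd_par cd) // => e lt e'.
  have [_ _ /(_ _ (ltn_trans lt tp))] := asg t tp; rewrite e' eqxx => /esym /eqP e2.
  by apply: (pl_root pl tp e lt).
- move=> i j hi hj; apply: (envy_bound eps_gt0 precise cd asg ok) => // t tp.
  by have [h1 h2 _] := sol t tp.
Qed.

Hypothesis ZX : large_bound I X.
Hypothesis inputX : forall b, input_memory I b <= X.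
Hypothesis codesX : ncodes I K <= X.
Local Notation digit := (digit I K).

(* What the code [x] must spell out for the search to follow the allocation. *)
Definition code_of x := exists itm ag par, [/\ placement I itm ag par,
  forall i j, i < n -> j < n -> bundle_value I itm ag i j <= bundle_value I itm ag i i,
  forall t t', t < p -> t' < p -> color p m (x %% N) (itm t) = color p m (x %% N) (itm t') -> t = t' &
  forall t, t < p -> [/\ digit x (t * (n + 2)) = color p m (x %% N) (itm t),
    digit x (t * (n + 2) + 1) = par t &
    forall b, b < n -> digit x (t * (n + 2) + (2 + b)) =
      if rep_of b == b then 2 * level I K itm t b + (b == rep_of (ag t)) else 0]].

Lemma coded_of u x : ready I K u -> u aHash 0 = x %% N ->
  (forall i, i < p * (n + 2) -> u aDig i = digit x i) -> code_of x ->
  exists itm ag par, coded itm ag par u.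
Proof.
move=> rd hh hd [itm [ag [par [pl ef hash dg]]]]; exists itm, ag, par.
have dE t q : t < p -> q < n + 2 -> fdig I u t q = digit x (t * (n + 2) + q).
  by move=> tp qn; rewrite /fdig hd //; clear ZX codesX precise; nia.
split=> //.
- by rewrite hh.
- move=> t tp; have [h _ _] := dg t tp; rewrite /fcol dE //; [by rewrite addn0 h hh|by rewrite addn2].
- move=> t tp; have [_ h _] := dg t tp; rewrite /fpar dE //; last by rewrite addn2.
- move=> t b tp bn rb; have [_ _ h] := dg t tp.
  rewrite /flevel dE ?h //; last by rewrite addnC ltn_add2r.
  by rewrite rb eqxx mulnC divnMDl // divn_small ?addn0 //; case: (_ == _).
- move=> t b tp bn; have [_ _ h] := dg t tp.
  rewrite /fowner dE ?h //; last by rewrite addnC ltn_add2r.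
  have an := pl_ag pl tp.
  case: eqP => [_|nr]; first by rewrite mulnC modnMDl modn_small //; case: (_ == _).
  rewrite mod0n; case: eqP => // e; case: nr.
  by rewrite e rep_of_idem.
Qed.

Lemma wp_step u Q x : bnd u -> ready I K u -> u aX 0 = x -> x < u aQ 0 ->
  (forall u', ready I K u' -> u' aQ 0 = u aQ 0 -> u' aX 0 = x.+1 ->
     u' aGo 0 = (u' aFound 0 == 0) && (x.+1 < u aQ 0) ->
     (0 < u' aFound 0 -> verified u') -> (code_of x -> 0 < u' aFound 0) -> Q u') ->
  wp step [::] u Q.
Proof.
move=> bu rd hx xQ hQ.
apply: (@wp_seq _ _ _ _ _ _ _ _ (fun u1 => u1 aHash 0 = x %% N /\
   forall i, i < p * (n + 2) -> u1 aDig i = digit x i)).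
  by apply: (wp_decode eps ZX bu rd hx) => u' _ h1 h2.
move=> u1 b1 [hh hd] f1.
have r1 : ready I K u1.
  by case: rd => h1 h2; split; [rewrite f1|move=> i hi; rewrite f1 // h2].
apply: (@wp_seq _ _ _ _ _ _ _ _ (fun u2 => forall itm ag par, coded itm ag par u1 -> assigned I p ag u2)).
  by apply: (wp_assign eps (K := K) ZX b1) => u' _.
move=> u2 b2 h2 f2.
have cd2 itm ag par : coded itm ag par u1 -> coded itm ag par u2.
  move=> cd; apply: coded_ext cd _ => a; rewrite !inE => ha.
  by rewrite f2 //; case/or4P: ha => /eqP ->.
apply: (@wp_seq _ _ _ _ _ _ _ _ (fun u3 => alive_ok I u3 /\ forall itm ag par, coded itm ag par u2 ->
   forall b, b < n -> ~~ fbad I u3 b)).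
  by apply: (wp_rounds eps (K := K) ZX inputX b2) => u' _ h1 h3.
move=> u3 b3 [ok3 nob3] f3.
have cd3 itm ag par : coded itm ag par u2 -> coded itm ag par u3.
  move=> cd; apply: coded_ext cd _ => a; rewrite !inE => ha.
  by rewrite f3 //; case/or4P: ha => /eqP ->.
apply: (@wp_seq _ _ _ _ _ _ _ _ (fun u4 => forall itm ag par, coded itm ag par u3 -> alive_ok I u3 ->
   (forall b, b < n -> ~~ fbad I u3 b) ->
        forall t, t < p -> [/\ u4 aSol t < m, 0 < u3 aAlive (t * m + u4 aSol t)
          & par t != t -> 0 < nadj I (u4 aSol t) (u4 aSol (par t))])).
  by apply: (wp_select eps (K := K) ZX b3) => u' _ h.
move=> u4 b4 h4 f4.
have cd4 itm ag par : coded itm ag par u3 -> coded itm ag par u4.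
  move=> cd; apply: coded_ext cd _ => a; rewrite !inE => ha.
  by rewrite f4 //; case/or4P: ha => /eqP ->.
have x1X : 1 <= X by apply: ltnW; apply: X1 ZX.
apply: (@wp_seq _ _ _ _ _ _ _ _ (fun u5 => u5 aFound 0 = holds eps I u4 [::] tverify)).
  split=> //; rewrite ev_tbool; apply: leq_trans x1X; exact: leq_b1.
move=> u5 b5 h5 f5.
have eX : u5 aX 0 = x by rewrite f5 // f4 // f3 // f2 // f1.
have eQ : u5 aQ 0 = u aQ 0 by rewrite f5 // f4 // f3 // f2 // f1.
apply: (@wp_seq _ _ _ _ _ _ _ _ (fun u6 => u6 aX 0 = x.+1)).
  split=> //; rewrite ev_tadd /= eX addn1 //.
  by apply: leq_trans xQ _; apply: bu.
move=> u6 b6 h6 f6.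
have eG : ev u6 [::] (tmul (tnot (reg aFound)) (tlt (reg aX) (reg aQ))) = (u5 aFound 0 == 0) && (x.+1 < u aQ 0).
  rewrite ev_tmul ev_tnot ev_tlt mulnb /holds /= h6 -leqNgt leqn0.
  by rewrite !f6 // eQ.
split=> //; first by rewrite eG; apply: leq_trans x1X; apply: leq_b1.
rewrite eG; set w := setc _ _ _ _.
have w6 a : a != aGo -> w a = u6 a by rewrite /w /setc => /negbTE ->.
have wF : w aFound 0 = holds eps I u4 [::] tverify by rewrite w6 // f6 // h5.
have vw : verified u4 -> verified w.
  have e1 : w aSol = u4 aSol by rewrite w6 // f6 // f5.
  have e2 : w aAg = u4 aAg by rewrite w6 // f6 // f5.
  have e3 : w aDig = u4 aDig by rewrite w6 // f6 // f5.
  by case; split; rewrite /bundle /fpar /fdig ?e1 ?e2 ?e3.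
apply: hQ.
- case: r1 => g1 g2; split; first by rewrite w6 // f6 // f5 // f4 // f3 // f2.
  by move=> i hi; rewrite w6 // f6 // f5 // f4 // f3 // f2 // g2.
- by rewrite w6 // f6.
- by rewrite w6.
- by rewrite wF /w /setc /= h5.
- by rewrite wF lt0b => /holds_tverify.
- move=> /(coded_of r1 hh hd) [itm [ag [par cd]]]; rewrite wF lt0b; apply/holds_tverify.
  have c2 := cd2 _ _ _ cd; have c3 := cd3 _ _ _ c2; have c4 := cd4 _ _ _ c3.
  apply: (verified_intended c4).
  + by have := h2 _ _ _ cd; rewrite /assigned f4 // f3.
  + move=> t v tp vm; rewrite f4 // ok3 //; rewrite /ffits /fcol /flevel /fowner /fpar /fdig !f4 //.
  + by move=> t tp; have := h4 _ _ _ c3 ok3 (nob3 _ _ _ c2) t tp; rewrite (f4 aAlive).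
Qed.

End Step.

(** * Some code describes a given solution *)

Section Existence.
Variables (I : instance) (K : nat).
Local Notation m := (items I).
Local Notation n := (agents I).
Local Notation p := (nat_of_ord (budget I)).
Local Notation N := (hash_range p m).
Local Notation rep_of := (rep_of I).

Lemma code_exists (Pi : allocation I) : valid Pi -> envy_free Pi ->
  exists2 x, x < ncodes I K & code_of I K x.
Proof.
move=> va ef; have [itm [ag [par [pl efp]]]] := placement_exists va ef.
have [a aN hash] := hash_injective (pl_itm pl) (pl_inj pl).
pose d i := let t := i %/ (n + 2) in let q := i %% (n + 2) in
  if q == 0 then color p m a (itm t) else if q == 1 then par t else
  if rep_of (q - 2) == q - 2 then 2 * level I K itm t (q - 2) + (q - 2 == rep_of (ag t)) else 0.
have n2 : 0 < n + 2 by rewrite addn2.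
have [i|y hy dy] := @digits_exist (radix I K) d (p * (n + 2)).
  move=> hi; have tp : i %/ (n + 2) < p by rewrite ltn_divLR.
  rewrite /d /radix; case: ifP => _; first exact: color_lt.
  case: ifP => _; first exact: leq_ltn_trans (pl_par pl tp) tp.
  case: ifP => _ //; have := level_leK K itm (i %% (n + 2) - 2) tp.
  by case: (_ == rep_of _); move: (level _ _ _ _ _); clear; lia.
have N0 : 0 < N := hash_range_gt0 p m.
have xN : (y * N + a) %% N = a by rewrite modnMDl modn_small.
have dE i : i < p * (n + 2) -> digit I K (y * N + a) i = d i.
  by move=> hi; rewrite /digit divnMDl // (divn_small aN) addn0 dy.
(* The multiplier is the lowest digit of a code. *)
exists (y * N + a).
  rewrite /ncodes; apply: (@leq_trans (y.+1 * N)); first by rewrite mulSn addnC ltn_add2r.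
  by rewrite mulnC leq_mul2l hy orbT.
exists itm, ag, par; split=> //; first by rewrite xN.
move=> t tp.
have lt q : q < n + 2 -> t * (n + 2) + q < p * (n + 2) by clear -tp; nia.
have dq q : q < n + 2 -> digit I K (y * N + a) (t * (n + 2) + q) =
    if q == 0 then color p m a (itm t) else if q == 1 then par t else
    if rep_of (q - 2) == q - 2 then 2 * level I K itm t (q - 2) + (q - 2 == rep_of (ag t)) else 0.
  move=> hq; rewrite dE ?lt // /d divnMDl // (divn_small hq) addn0 modnMDl modn_small //.
rewrite xN; split.
- by rewrite -[t * (n + 2)]addn0 dq.
- by rewrite dq ?addn2.
- move=> b bn; rewrite dq; last by rewrite addnC ltn_add2r.
  by rewrite add2n subn2.
Qed.

Lemma ncodes_gt0 : 0 < ncodes I K.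
Proof. by rewrite muln_gt0 hash_range_gt0 prod_radix_gt0. Qed.

Lemma ncodes_mono K' : K <= K' -> ncodes I K <= ncodes I K'.
Proof.
move=> h; rewrite /ncodes leq_mul2l; apply/orP; right; apply: leq_prod => i _.
rewrite /radix; case: ifP => // _; case: ifP => // _; case: ifP => // _.
by rewrite leq_mul2l leq_add2r h orbT.
Qed.

End Existence.

(** * Soundness of the output *)

Section Sound.
Variables (R : realType) (eps : R) (I : instance).
Local Notation m := (items I).
Local Notation n := (agents I).
Local Notation p := (nat_of_ord (budget I)).

Lemma verified_placement u : verified eps I u ->
  placement I (u aSol) (fun t => (u aAg t).-1) (fpar I u).
Proof.
case=> h1 h2 h3 h4 _; split=> //.
- by move=> t /h1[].
- by move=> t /h1[_ /andP[a1 a2]]; rewrite prednK.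
- by move=> t tp; case: (eqVneq (fpar I u t) t) => [->//|/(h3 t tp)[/ltnW]].
- by move=> t tp ne; have [_ -> h] := h3 t tp ne; rewrite -lt0n.
- move=> t t' tp e lt /(congr1 S); have [_ /andP[a1 _]] := h1 t tp.
  have [_ /andP[a2 _]] := h1 t' (ltn_trans lt tp).
  by rewrite !prednK //; apply: h4.
Qed.

Lemma verified_output u (M : memory) : verified eps I u ->
  (forall c, c < n * m -> M (1 + c) =
     has (fun t => (u aAg t == (c %/ m).+1) && (u aSol t == c %% m)) (iota 0 p)) ->
  valid (output_allocation I M) /\ eps_envy_free eps (output_allocation I M).
Proof.
move=> vf hM; have pl := verified_placement vf.
have -> : output_allocation I M = place_alloc pl.
  apply/ffunP => i; apply/setP => v; rewrite mem_place_alloc ffunE inE.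
  have lt : i * m + v < n * m by have := ltn_ord i; have := ltn_ord v; clear; nia.
  have m0 : 0 < m by apply: leq_ltn_trans (ltn_ord v).
  rewrite -addnA hM // eqb0 negbK; apply: eq_in_has => t; rewrite mem_iota add0n => /andP[_ tp].
  rewrite divnMDl // divn_small // addn0 modnMDl modn_small // andbC; congr (_ && _).
  by have [_ /andP[h _]] := vf_range vf tp; rewrite -[in LHS](prednK h) eqSS.
split; first exact: place_valid.
move=> i j; rewrite !place_utility.
have bE k : bundle_value I (u aSol) (fun t => (u aAg t).-1) i k = bundle I u i k.
  rewrite bundleE; apply: eq_bigl => t; have [_ /andP[h _]] := vf_range vf (ltn_ord t).
  by rewrite -[in RHS](prednK h) eqSS.
rewrite !bE mulrDl mul1r [(eps * _)%R]mulrC; have := vf_envy vf (ltn_ord i) (ltn_ord j).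
have [le|/ltnW le] := leqP (bundle I u i j) (bundle I u i i).
  move=> h; have : (0 <= (bundle I u i i)%:R * eps)%R by apply: le_trans h; rewrite ler0n.
  move=> h0; apply: (@le_trans _ _ (bundle I u i i)%:R%R); first by rewrite ler_nat.
  by rewrite lerDl.
by rewrite natrB // lerBlDl.
Qed.

Lemma ev_out u c : ev eps I u [:: c] (tbool (tex RP
    (tmul (teq (TCell aAg (TVar 1)) (tadd (tdiv (TVar 0) tm) (tc 1)))
          (teq (TCell aSol (TVar 1)) (tmod (TVar 0) tm))))) =
   has (fun t => (u aAg t == (c %/ m).+1) && (u aSol t == c %% m)) (iota 0 p).
Proof.
rewrite ev_tbool; congr nat_of_bool; apply/holds_texP/hasP => [[t tp]|[t]].
  rewrite (holds_tand _ _ (teq _ _)) !holds_teq ev_tadd ev_tdiv ev_tmod /= addn1 => h.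
  by exists t; rewrite // mem_iota add0n.
rewrite mem_iota add0n => /andP[_ tp] h; exists t => //.
by rewrite (holds_tand _ _ (teq _ _)) !holds_teq ev_tadd ev_tdiv ev_tmod /= addn1.
Qed.

Lemma wp_fill_out X u (Q : state -> Prop) : large_bound I X -> (forall a i, u a i <= X) ->
  (forall u', same_but [:: aOut] u u' -> (forall c, c < n * m -> u' aOut c =
     has (fun t => (u aAg t == (c %/ m).+1) && (u aSol t == c %% m)) (iota 0 p)) -> Q u') ->
  wp eps I X fill_out [::] u Q.
Proof.
move=> ZX bu hQ.
apply: (@wp_fill R eps I X (RMul RN RM) aOut _ [::] u (fun c => 
  has (fun t => (u aAg t == (c %/ m).+1) && (u aSol t == c %% m)) (iota 0 p) : nat)) => //.
- exact: nmX.
- by move=> u' c _ sb; rewrite ev_out !sb.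
- by move=> c _; apply: leq_trans (leq_b1 _) _; apply: ltnW; apply: X1 ZX.
Qed.

End Sound.

(** * The complete program and its run *)

(** Without agents there are no types, so the exponent [|A| p^2] vanishes and the time bound pays
    for no search. The answer is then read off [p] directly. *)
Definition ef_program : com :=
  If (Deref (Cst 1))
    (Seq (cstmt 0 init) (Seq (while_cell aGo raiseK) (Seq (cstmt 0 count_codes)
    (Seq (while_cell aGo step)
      (If (cell aFound (Cst 0)) (Seq (cstmt 0 fill_out) (emit aOut))
        (Store (Cst 0) (Cst 0)))))))
    (Store (Cst 0) (Bin Leq (Deref (Cst 2)) (Cst 0))).

Definition prog_size := ssz init + ssz raiseK + ssz count_codes + ssz step + ssz fill_out.

Section Run.
Variables (R : realType) (eps : R) (w : nat) (I : instance) (X S K0 : nat).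
Local Notation m := (items I).
Local Notation n := (agents I).
Local Notation p := (nat_of_ord (budget I)).
Local Notation Z := (m + n + 2).
Hypothesis eps_gt0 : (0 < eps)%R.
Hypothesis ZX : large_bound I X.
Hypothesis X32 : 32 <= X.
Hypothesis baseX : base I <= X.
Hypothesis inputX : forall b, input_memory I b <= X.
Hypothesis fitw : X.+2 ^ S.+2 <= 2 ^ w.
Hypothesis sizeS : prog_size < S.
Hypothesis K0X : K0 <= X.
Hypothesis codesX : ncodes I K0 <= X.

Definition precise_at K := ((2 * p)%:R <= (K - p)%:R * eps)%R.

Hypothesis K0_precise : forall K, K0 <= K -> precise_at K.

Lemma input_represents : represents I (fun _ _ => 0) [::] (input_memory I).
Proof.
split=> // a i _; rewrite /input_memory nth_default //.
by rewrite size_input_words /ad leq_addr.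
Qed.

Lemma ev_precise u : ev eps I u [::] (tnot tprecise) = ~~ precise_at (u aK 0).
Proof.
by rewrite ev_tnot /tprecise holds_teps.
Qed.

Definition run_time := (K0 + ncodes I K0 + 10) * (Z ^ (16 * S) + 300) + (n * m).+1 * 300.

Lemma ncodes_le K : K <= K0 -> ncodes I K <= X.
Proof. by move=> h; apply: leq_trans codesX; apply: ncodes_mono. Qed.

Lemma run_correct : 0 < n -> exists t M,
  [/\ exec eps w ef_program (input_memory I) t M, t <= run_time & correct_output eps I M].
Proof.
move=> n0.
have [s1 s2 s3 s4 s5] : [/\ ssz init < S, ssz raiseK < S, ssz count_codes < S, ssz step < S & ssz fill_out < S].
  move: sizeS; rewrite /prog_size.
  move: (ssz init) (ssz raiseK) (ssz count_codes) (ssz step) (ssz fill_out) => *.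
  by split; lia.
have S1 : 1 < S by apply: leq_ltn_trans s1.
have ltS k : k < S -> Z ^ (16 * k) <= Z ^ (16 * S).
  by move=> h; rewrite leq_pexp2l ?addn2 // leq_mul2l /= ltnW.
have x1X : 1 <= X by lia.
have [wf1 wf2 wf3 wf4 wf5] := and5P wf_prog.
have nil l : nth 0 [::] l <= X by rewrite nth_nil.
have bu0 (a i : nat) : (fun _ _ => 0 : nat) a i <= X by [].
have r0 := input_represents.
have wp1 : wp eps I X init [::] (fun _ _ => 0) (fun u => [/\ u aK 0 = 0, u aGo 0 = ~~ precise_at 0,
    u aFound 0 = 0, u aX 0 = 0 & forall i, i < n -> u aRep i = rep_of I i]).
  apply: wp_seq.
    by apply: (wp_find_reps eps ZX bu0 (Q := fun u => forall i, i < n -> u aRep i = rep_of I i)) => u' _.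
  move=> u1 b1 h1 f1; have k1 : u1 aK 0 = 0 by rewrite f1.
  split=> //; first by rewrite ev_precise; apply: leq_trans x1X; apply: leq_b1.
  by rewrite ev_precise k1; split=> //; rewrite /setc /= f1.
have [k1 [M1 [u1 [e1 t1 r1 b1 [K1 G1 F1 Xc1 R1]]]]] := cstmt_correct (S := S) ZX X32 baseX inputX fitw S1 bu0 nil wf1 s1 (ltnW s1) r0 wp1.
(* Round [i] has [K = i]. From [K0] on the test succeeds, so a guard that is on forces [i < K0]. *)
pose Inv2 i u := [/\ u aK 0 = i, i <= K0, u aGo 0 = ~~ precise_at i, u aFound 0 = 0 /\ u aX 0 = 0 &
  forall i, i < n -> u aRep i = rep_of I i].
have step2 i u : (forall a j, u a j <= X) -> Inv2 i u -> u aGo 0 != 0 ->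
    i < K0 /\ wp eps I X raiseK [::] u (Inv2 i.+1).
  move=> bu [hk hi hg [hf hx] hr] go.
  have ik : i < K0.
    by rewrite ltn_neqAle hi andbT; apply: contraNneq go => e; rewrite hg e K0_precise.
  split=> //; apply: (@wp_seq _ _ _ _ _ _ _ _ (fun u' => u' aK 0 = i.+1)).
    have e : ev eps I u [::] (tadd (reg aK) (tc 1)) = i.+1 by rewrite ev_tadd /= hk addn1.
    by split; rewrite ?e //; apply: leq_trans ik K0X.
  move=> u' b' hk' f'; split=> //; first by rewrite ev_precise; apply: leq_trans x1X; apply: leq_b1.
  rewrite ev_precise hk'; split; rewrite /setc //=; first by split; rewrite f'.
  by move=> j hj; rewrite f' // hr.
have inv2 : Inv2 0 u1 by split.
have [k2 [M2 [u2 [e2 t2 r2 b2 [G2 [K [K2 KK0 P2 [F2 Xc2] R2]]]]]]] :=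
  exec_while ZX X32 baseX inputX fitw S1 (isT : aGo < 30) wf2 s2 step2 b1 r1 inv2.
have prec : precise_at K by move: G2; rewrite P2; case: (precise_at K).
have cX := ncodes_le KK0.
have rd2 : ready I K u2 by split.
have wp3 : wp eps I X count_codes [::] u2 (fun u => [/\ ready I K u, u aQ 0 = ncodes I K, u aGo 0 = 1,
    u aFound 0 = 0 & u aX 0 = 0]).
  apply: (wp_count_codes eps ZX cX b2 rd2) => u' sb hq hg; split=> //; rewrite ?sb //.
  by split; [rewrite sb|move=> i hi; rewrite sb // R2].
have [k3 [M3 [u3 [e3 t3 r3 b3 [rd3 Q3 G3 F3 X3]]]]] := cstmt_correct (S := S) ZX X32 baseX inputX fitw S1 b2 nil wf3 s3 (ltnW s3) r2 wp3.
(* The last clause carries a negative answer: as long as nothing has been found, no code below [i]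
   describes a solution. *)
pose Inv4 i u := [/\ ready I K u, u aQ 0 = ncodes I K, u aX 0 = i /\ i <= ncodes I K,
   u aGo 0 = (u aFound 0 == 0) && (i < ncodes I K) &
   (0 < u aFound 0 -> verified eps I u) /\ forall y, y < i -> code_of I K y -> 0 < u aFound 0].
have step4 i u : (forall a j, u a j <= X) -> Inv4 i u -> u aGo 0 != 0 ->
    i < ncodes I K /\ wp eps I X step [::] u (Inv4 i.+1).
  move=> bu [hr hq [hx hi] hg [hs hc]] go.
  have {go} : (u aFound 0 == 0) && (i < ncodes I K) by move: go; rewrite hg; case: (_ && _).
  case/andP => f0 iq; split=> //.
  apply: (wp_step eps_gt0 prec ZX inputX bu hr hx); first by rewrite hq.
  move=> u' hr' hq' hx' hg' hs' hc'; rewrite hq in hq' hg'.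
  split=> //; split=> // y; rewrite ltnS leq_eqVlt => /orP[/eqP->//|lt].
  by move=> /(hc _ lt); rewrite (eqP f0).
have inv4 : Inv4 0 u3.
  by split; rewrite ?F3 ?G3 ?ncodes_gt0 //; split.
have [k4 [M4 [u4 [e4 t4 r4 b4 [G4 [x [rd4 Q4 [X4 xQ] go4 [snd cmp]]]]]]]] :=
  exec_while ZX X32 baseX inputX fitw S1 (isT : aGo < 30) wf4 s4 step4 b3 r3 inv4.
have n_val : eval eps w (input_memory I) (Deref (Cst 1)) = Some n.
  have [_ h1 _] := input_ok0 (let: And3 h _ _ := r0 in h).
  rewrite /= (fitX ZX X32 baseX fitw S1) //= h1 (fitX ZX X32 baseX fitw S1) //.
  by rewrite !leqW // ltnW // (nX ZX).
have f_val : eval eps w M4 (cell aFound (Cst 0)) = Some (u4 aFound 0).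
  have [i4 h4 _] := r4; rewrite -(h4 aFound 0) //; apply: (eval_reg eps ZX X32 baseX fitw S1) => //; first exact: input_dims.
  by rewrite h4 //; apply: (XS (X := X)); [apply: ltnW|rewrite !leqW].
have nc : ncodes I K <= ncodes I K0 by apply: ncodes_mono.
have pre t5 M5 : exec eps w (If (cell aFound (Cst 0)) (Seq (cstmt 0 fill_out) (emit aOut))
        (Store (Cst 0) (Cst 0))) M4 t5 M5 ->
    t5 <= Z ^ (16 * S) + (n * m).+1 * 300 + 100 -> 
    exists2 t, exec eps w ef_program (input_memory I) t M5 & t <= run_time.
  move=> e5 t5le; exists ((cost (Deref (Cst 1)) + (k1 + (k2 + (k3 + (k4 + t5))))).+1).
    apply: ExecIfTrue n_val _ _; first by rewrite -lt0n.
    by apply: ExecSeq e1 _; apply: ExecSeq e2 _; apply: ExecSeq e3 _; apply: ExecSeq e4 e5.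
  have z1 := ltS _ s1; have z2 := ltS _ s2; have z3 := ltS _ s3; have z4 := ltS _ s4.
  rewrite /run_time -/(cost _); change (cost (Deref (Cst 1))) with 2.
  move: (Z ^ (16 * S)) z1 z2 z3 z4 t5le => A z1 z2 z3 z4 t5le.
  have {}t2 : k2 <= K0.+1 * (A + 30) by apply: leq_trans t2 _; rewrite leq_mul2l leq_add2r z2 orbT.
  have {}t4 : k4 <= (ncodes I K0).+1 * (A + 30) by apply: leq_trans t4 _; apply: leq_mul; rewrite ?ltnS ?leq_add2r.
  move: (ncodes I K0) t4 => D t4.
  have {}t1 := leq_trans t1 z1; have {}t3 := leq_trans t3 z3.
  clear -t1 t2 t3 t4 t5le; nia.
have [f0|fpos] := posnP (u4 aFound 0).
  have e5 : exec eps w (If (cell aFound (Cst 0)) (Seq (cstmt 0 fill_out) (emit aOut))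
      (Store (Cst 0) (Cst 0))) M4 (cost (cell aFound (Cst 0)) + (cost (Cst 0) + cost (Cst 0)).+1).+1 (upd M4 0 0).
    apply: ExecIfFalse; first by rewrite f_val f0.
    by apply: ExecStore; rewrite /= (fitX ZX X32 baseX fitw S1).
  have [|t et tle] := pre _ _ e5.
    have -> : (cost (cell aFound (Cst 0)) + (cost (Cst 0) + cost (Cst 0)).+1).+1 = 24 by [].
    by apply: leq_trans (leq_addl _ _).
  exists t, (upd M4 0 0); split=> //; right; split=> // -[Pi [va ef]].
  have xE : x = ncodes I K.
    apply/eqP; rewrite eqn_leq xQ leqNgt; apply/negP => lt.
    by move: go4; rewrite G4 f0 eqxx lt.
  have [y yQ cy] := code_exists K va ef.
  by have := cmp y _ cy; rewrite xE f0 => /(_ yQ).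
have vf := snd fpos.
have wp5 : wp eps I X fill_out [::] u4 (fun u => forall c, c < n * m -> u aOut c =
     has (fun t => (u4 aAg t == (c %/ m).+1) && (u4 aSol t == c %% m)) (iota 0 p)).
  by apply: wp_fill_out => // u' _.
have [k5 [M5 [u5 [e5 t5 r5 b5 h5]]]] := cstmt_correct (S := S) ZX X32 baseX inputX fitw S1 b4 nil wf5 s5 (ltnW s5) r4 wp5.
have nmX' : n * m <= X by apply: nmX.
have [k6 [M6 [e6 t6 out0 out]]] := exec_emit eps ZX X32 baseX fitw S1 (isT : aOut < 30) nmX' r5 b5.
have [||t et tle] := pre (cost (cell aFound (Cst 0)) + (k5 + k6)).+1 M6.
- apply: ExecIfTrue f_val _ _; first by rewrite -lt0n.
  exact: ExecSeq e5 e6.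
- have -> : cost (cell aFound (Cst 0)) = 20 by [].
  have := leq_trans t5 (ltS _ s5); move: t6 (Z ^ _); clear; lia.
exists t, M6; split=> //; left; split=> //.
by apply: (verified_output vf) => c cL; rewrite out // h5.
Qed.

End Run.

(** * Running time and word length *)

Lemma prod_periodic a b (f : nat -> nat) : 0 < b ->
  \prod_(z < a * b) f (z %% b) = (\prod_(j < b) f j) ^ a.
Proof.
move=> b0; rewrite -!(big_mkord xpredT) /= -(big_mkord xpredT (fun z => f (z %% b))).
elim: a => [|a IH]; first by rewrite mul0n big_nil.
rewrite mulSnr (big_cat_nat (leq0n _) (leq_addr _ _)) /= {}IH expnSr; congr (_ * _).
rewrite -{1}[a * b]add0n big_addn addKn big_nat [RHS]big_nat; apply: eq_bigr => i /andP[_ ib].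
by rewrite addnC modnMDl modn_small.
Qed.

Section Types.
Variable I : instance.
Local Notation m := (items I).
Local Notation n := (agents I).
Local Notation p := (nat_of_ord (budget I)).
Local Notation rep_of := (rep_of I).

Definition reps := [set b : 'I_n | rep_of b == b].

Lemma card_reps : #|reps| <= #|agent_types I|.
Proof.
pose F (b : 'I_n) := [set y in [set: 'I_n] | valuation b == valuation y].
have Finj : {in reps &, injective F}.
  move=> b b'; rewrite !inE => /eqP rb /eqP rb' /setP /(_ b').
  rewrite !inE eqxx /= => /eqP e; apply: val_inj; rewrite /= -rb -rb'.
  apply: rep_of_eq => v hv; have := nvalE b (Ordinal hv); have := nvalE b' (Ordinal hv).
  by rewrite /= => -> ->; rewrite e.
rewrite -(card_in_imset Finj); apply/subset_leq_card/subsetP => x /imsetP[b _ ->].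
by apply/imsetP; exists b; rewrite ?inE.
Qed.

Lemma card_types_gt0 : 0 < n -> 0 < #|agent_types I|.
Proof.
move=> n0; apply: leq_trans card_reps; rewrite card_gt0; apply/set0Pn.
have [rn _] := rep_ofP n0; exists (Ordinal rn); rewrite inE /=; apply/eqP; exact: rep_of_idem.
Qed.

Lemma ncodesE K : ncodes I K =
  hash_range p m * (ncolors p * p * (2 * (K + 1)) ^ #|reps|) ^ p.
Proof.
rewrite /ncodes; congr (_ * _).
have -> : \prod_(i < p * (n + 2)) radix I K i = \prod_(z < p * (n + 2)) radix I K (z %% (n + 2)).
  by apply: eq_bigr => i _; rewrite /radix modn_mod.
rewrite prod_periodic ?addn2 //; congr (_ ^ _).
rewrite 2!big_ord_recl /= /radix addn2 !modn_small //= mulnA; congr (_ * _).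
rewrite (eq_bigr (fun b : 'I_n => if b \in reps then 2 * (K + 1) else 1)).
  by rewrite -big_mkcond prod_nat_const.
move=> b _; rewrite modn_small; last by rewrite /bump /= !ltnS.
by rewrite inE /bump /= !add1n subn2 /=.
Qed.

(** By [p < 2 ^ p], factors polynomial in [p] become powers of 2 with exponent linear in [p], which
    a base of at least 2 can absorb. *)
Lemma colors_le : 0 < p -> ncolors p * p <= 2 ^ (6 * p).
Proof.
move=> p0; have p2 := ltn_expl p (isT : 1 < 2).
have e2 : 2 <= 2 ^ p by rewrite -{1}(expn1 2) leq_pexp2l.
rewrite mulnC expnM; rewrite mulnC -expnM; rewrite (_ : 6 * p = p + p + p + (p + p + p)); last by lia.
rewrite !expnD; move: (2 ^ p) p2 e2 => E p2 e2.
have h1 : p * p * p <= E * E * E by rewrite !leq_mul // ltnW.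
have h2 : 8 <= E * E * E by apply: leq_trans (leq_mul (leq_mul e2 e2) e2).
apply: (@leq_trans (5 * (p * p * p))); first by rewrite /ncolors; nia.
by rewrite mulnC leq_mul //; apply: leq_trans h2.
Qed.

Lemma hash_range_le : hash_range p m <= (m + n + 2) ^ 5.
Proof.
have := budget_le I; rewrite /hash_range /ncolors.
have mz : m.+1 <= m + n + 2 by lia.
move: (nat_of_ord _) (m + n + 2) mz => q z mz qm.
have h1 : 2 * q + 1 <= z * z by nia.
rewrite (_ : z ^ 5 = z * z * (z * z) * z); last by rewrite !expnS expn0 muln1 !mulnA.
rewrite leq_mul //; apply: leq_trans (leq_mul h1 h1); nia.
Qed.

End Types.

(** * Precision and number of codes against the time bound *)

Section RealBounds.
Variables (R : realType) (eps : R) (I : instance).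
Local Notation m := (items I).
Local Notation n := (agents I).
Local Notation p := (nat_of_ord (budget I)).
Local Notation k := #|agent_types I|.
Local Notation Z := (m + n + 2).
Local Open Scope ring_scope.

Hypothesis eps_gt0 : 0 < eps.
Hypothesis n_gt0 : (0 < n)%N.

Definition tbase := Num.max 2 (eps^-1 * log2 (p%:R / eps)).

Lemma tbase2 : 2 <= tbase. Proof. by rewrite le_max lexx. Qed.

Lemma tbase1 : 1 <= tbase. Proof. by apply: le_trans tbase2; rewrite ler1n. Qed.

(** If [eps > 1/2] then [1 + 1/eps < 3], and the base is at least 2. Otherwise [p / eps >= 2], so
    the logarithm is at least 1, the base is at least [1/eps], and [1 + b <= b^2] for [b >= 2]. *)
Lemma tbase_inv : (0 < p)%N -> 1 + eps^-1 <= tbase ^+ 2.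
Proof.
move=> p0; have h2 := tbase2.
have [lt|le] := ltP 2^-1 eps.
  have : eps^-1 < 2 by rewrite invf_plt ?posrE.
  by nra.
have hinv : eps^-1 <= tbase.
  rewrite le_max; apply/orP; right; apply: ler_peMr; first by rewrite invr_ge0 ltW.
  rewrite /log2 ler_pdivlMr ?ln_gt0 ?ltr1n // mul1r ler_ln ?posrE ?divr_gt0 ?ltr0n //.
  rewrite ler_pdivlMr //; apply: (@le_trans _ _ 1); last by rewrite ler1n.
  by rewrite mulrC -ler_pdivlMr // div1r.
nra.
Qed.

(** A value from which on the test [2 p <= (K - p) eps] succeeds, hence an upper bound for the [K]
    at which the program stops. *)
Definition precision := (p + Num.truncn ((2 * p)%:R / eps) + 1)%N.

Lemma precisionP K : (precision <= K)%N -> (2 * p)%:R <= (K - p)%:R * eps.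
Proof.
move=> h; rewrite -ler_pdivrMr //; apply: (@le_trans _ _ (Num.truncn ((2 * p)%:R / eps)).+1%:R).
  by apply: ltW; apply: truncnS_gt.
by rewrite ler_nat; move: h; rewrite /precision; lia.
Qed.

(** The left side is at most [6 p (1 + 1/eps)]. The factor [6 p] is at most [2 ^ (4 p)], the other
    one costs the exponent 2, and [4 p + 2 <= 6 p]. *)
Lemma precision_le : (0 < p)%N -> (2 * (precision + 1))%:R <= tbase ^+ (6 * p).
Proof.
move=> p0.
have h1 : (2 * (precision + 1))%:R <= (6 * p)%:R * (1 + eps^-1).
  have : (Num.truncn ((2 * p)%:R / eps))%:R <= (2 * p)%:R / eps :> R.
    by rewrite truncn_le mulr_ge0 // invr_ge0 ltW.
  have : (4 <= 4 * p)%N by lia.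
  rewrite -(ler_nat R) /precision !(natrM, natrD) => a b.
  have h : 0 <= p%:R * eps^-1 by rewrite mulr_ge0 // invr_ge0 ltW.
  by nra.
apply: le_trans h1 _.
have h2 : (6 * p)%:R <= tbase ^+ (4 * p).
  apply: (@le_trans _ _ (2 ^ (4 * p))%N%:R).
    rewrite ler_nat; have p2 := ltn_expl p (isT : (1 < 2)%N).
    apply: (@leq_trans (2 ^ (3 + p))); last by rewrite leq_pexp2l //; lia.
    by rewrite expnD; lia.
  by rewrite natrX lerXn2r ?nnegrE ?tbase2 // (le_trans _ tbase1).
apply: (@le_trans _ _ (tbase ^+ (4 * p) * tbase ^+ 2)).
  by apply: ler_pM => //; [rewrite addr_ge0 // invr_ge0 ltW|apply: tbase_inv].
by rewrite -exprD ler_weXn2l ?tbase1 //; lia.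
Qed.

(** A slot costs the exponent [6 p] for color and parent and [6 p k] for the levels, over [p] slots;
    as [k >= 1] in the presence of agents, the sum is at most [12 k p^2]. *)
Definition weight := tbase ^+ (12 * (k * p ^ 2)).

Lemma weight_ge1 : 1 <= weight. Proof. by rewrite exprn_ege1 // tbase1. Qed.

Lemma kpp a : (a * (p * p) <= a * (k * p ^ 2))%N.
Proof. by rewrite leq_mul2l mulnn leq_pmull ?orbT // card_types_gt0. Qed.

Lemma precision_weight : precision%:R <= 2 * weight.
Proof.
have [p0|p0] := posnP p.
  rewrite /precision p0 muln0 mul0r truncn0 addn0 add0n.
  by have := weight_ge1; lra.
have := precision_le p0; rewrite natrM natrD.
have : tbase ^+ (6 * p) <= weight.
  rewrite /weight ler_weXn2l ?tbase1 //; apply: leq_trans (kpp 12).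
  by rewrite leq_mul // leq_pmull.
have : 0 <= precision%:R :> R by [].
lra.
Qed.

Lemma ncodes_weight : (ncodes I precision)%:R <= (Z ^ 5)%:R * weight.
Proof.
rewrite ncodesE natrM; apply: ler_pM => //.
  rewrite ler_nat; exact: hash_range_le.
have [p0|p0] := posnP p; first by rewrite p0 expn0 weight_ge1.
rewrite natrX natrM.
have h1 : (ncolors p * p)%:R <= tbase ^+ (6 * p).
  apply: (@le_trans _ _ (2 ^ (6 * p))%N%:R); first by rewrite ler_nat colors_le.
  by rewrite natrX lerXn2r ?nnegrE ?tbase2 // (le_trans _ tbase1).
have h2 : ((2 * (precision + 1)) ^ #|reps I|)%:R <= tbase ^+ (6 * p * k).
  rewrite natrX; apply: (@le_trans _ _ (tbase ^+ (6 * p) ^+ #|reps I|)).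
    by rewrite lerXn2r ?nnegrE ?precision_le // exprn_ge0 // (le_trans _ tbase1).
  by rewrite -exprM ler_weXn2l ?tbase1 // leq_mul2l card_reps orbT.
apply: (@le_trans _ _ ((tbase ^+ (6 * p) * tbase ^+ (6 * p * k)) ^+ p)).
  rewrite lerXn2r ?nnegrE ?mulr_ge0 ?exprn_ge0 ?(le_trans _ tbase1) //.
  by apply: ler_pM.
rewrite -exprD -exprM /weight ler_weXn2l ?tbase1 //.
by have := kpp 6; nia.
Qed.

End RealBounds.

(** * The constants of the theorem *)

Unset Implicit Arguments.
Local Open Scope ring_scope.

(** The constant 4400 covers [13 * 301 + 300]: 13 collects the rounds of both searches, 301 the cost
    of a round, 300 the copying of the output. *)
Lemma run_arith (F : realFieldType) (pr nc P z nm W : F) :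
  1 <= W -> 0 <= nc -> pr <= 2 * W -> nc <= z * W -> 1 <= P -> 1 <= z -> nm <= z ->
  (pr + nc + 10) * (P + 300) + nm * 300 <= 4400 * (P * z * W).
Proof.
move=> W1 nc0 hpr hnc P1 z1 hnm.
have a1 : W <= z * W by rewrite ler_peMl // (le_trans _ W1).
have a2 : z <= z * W by rewrite ler_peMr // (le_trans _ z1).
have h1 : pr + nc + 10 <= 13 * (z * W) by lra.
have h2 : P + 300 <= 301 * P by lra.
have h3 : z * W <= P * (z * W) by rewrite ler_peMl //; lra.
have h4 : (pr + nc + 10) * (P + 300) <= 13 * (z * W) * (P + 300) by rewrite ler_wpM2r //; lra.
have h5 : 13 * (z * W) * (P + 300) <= 13 * (z * W) * (301 * P) by rewrite ler_wpM2l //; lra.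
have -> : P * z * W = P * (z * W) by rewrite mulrA.
have h6 : 13 * (z * W) * (301 * P) = 3913 * (P * (z * W)) by ring.
lra.
Qed.

Section Resources.
Variables (R : realType) (eps : R) (I : instance) (w S C : nat).
Local Notation m := (items I).
Local Notation n := (agents I).
Local Notation p := (nat_of_ord (budget I)).
Local Notation Z := (m + n + 2)%N.
Local Notation G := (maxn 1 m * maxn 1 n)%N.

Hypothesis eps_gt0 : 0 < eps.
Hypothesis n_gt0 : (0 < n)%N.
Hypothesis S_gt0 : (0 < S)%N.
Hypothesis sizeC : (4400 * 4 ^ (16 * S + 20) <= C)%N.
Hypothesis wok : word_length_ok C eps I w.

(** The [X] of the run. It covers the input numbers, the ranges, the counter [K] and the codes; 64
    secures [32 <= X]. *)
Definition word_bound := (max_val I + Z ^ 8 + precision eps I + ncodes I (precision eps I) + 64)%N.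

Lemma C_ge e : (e <= 16 * S + 20)%N -> (4400 * 4 ^ e <= C)%N.
Proof. by move=> h; apply: leq_trans sizeC; rewrite leq_mul2l leq_pexp2l ?orbT. Qed.

Lemma S_le_C : (16 * S + 20 <= C)%N.
Proof.
apply: leq_trans (leq_trans (ltnW (ltn_expl _ (isT : 1 < 4)%N)) _) sizeC.
by rewrite leq_pmull.
Qed.

(** The proof measures time in powers of [m + n + 2], the theorem in powers of
    [max(1, m) max(1, n)]. The former base is at most 4 times the latter, so [C] has to absorb
    [4 ^ e] as a factor and [e] as an exponent. *)
Lemma budget_time (a e : nat) : (e <= 16 * S + 20)%N -> (a <= 4400)%N ->
  a%:R * ((Z ^ e)%:R * weight eps I) <= time_bound C eps I.
Proof.
move=> he ha; rewrite /time_bound -/(tbase eps I).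
have ZG : (Z <= 4 * G)%N.
  have h : (m <= maxn 1 m)%N by rewrite leq_maxr.
  have h' : (n <= maxn 1 n)%N by rewrite leq_maxr.
  have h1 : (1 <= maxn 1 m)%N by rewrite leq_maxl.
  have h2 : (1 <= maxn 1 n)%N by rewrite leq_maxl.
  move: (maxn 1 m) (maxn 1 n) h h' h1 h2 => x y *; nia.
have G1 : (0 < G)%N by rewrite muln_gt0 !leq_maxl.
have Cge : (e <= C)%N by apply: leq_trans S_le_C.
have hZ : (a * Z ^ e <= C * G ^ C)%N.
  apply: (@leq_trans (4400 * 4 ^ e * G ^ e)).
    by rewrite -mulnA -expnMn leq_mul //; case: (e) => // e'; rewrite leq_exp2r.
  by apply: leq_mul; [apply: C_ge|rewrite leq_pexp2l].
have hW : weight eps I <= tbase eps I ^+ (C * (#|agent_types I| * p ^ 2)).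
  rewrite /weight ler_weXn2l ?tbase1 // leq_mul2r; apply/orP; right.
  by apply: leq_trans S_le_C; lia.
rewrite mulrA -natrM mulrAC -natrM; apply: ler_pM => //.
  by apply: le_trans (weight_ge1 eps I).
by rewrite ler_nat.
Qed.

Lemma time_ge1 : 1 <= time_bound C eps I.
Proof.
apply: le_trans (budget_time 1 0 (leq0n _) isT); rewrite mul1r expn0 mul1r.
exact: weight_ge1.
Qed.

Lemma word_bound_le : (word_bound.+2)%:R <= (max_val I).+1%:R * time_bound C eps I.
Proof.
have T1 := time_ge1.
have W1 := weight_ge1 eps I.
have h1 := budget_time 100 8 (leq_trans (isT : 8 <= 20)%N (leq_addl _ _)) isT.
have h2 := precision_weight eps_gt0 n_gt0.
have h3 := ncodes_weight eps_gt0 n_gt0.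
rewrite -addn2 /word_bound; move: h2 h3.
set pr := precision _ _; set nc := ncodes _ _; clearbody nc; clearbody pr => h2 h3; rewrite !natrD.
have z8 : (Z ^ 5 <= Z ^ 8)%N by rewrite leq_pexp2l // addn2.
have z1 : (1 <= Z ^ 8)%N by rewrite expn_gt0 addn2.
move: z8 z1; rewrite -!(ler_nat R).
move: (Z ^ 5)%N%:R (Z ^ 8)%N%:R h1 h3 => z5 z8 h1 h3 le58 z81.
rewrite -(natr1 (max_val I)).
have U0 : 0 <= (max_val I)%:R :> R by [].
move: (max_val I)%:R U0 => U U0.
have a1 : z5 * weight eps I <= z8 * weight eps I by rewrite ler_wpM2r // (le_trans _ W1).
have a2 : weight eps I <= z8 * weight eps I by rewrite ler_peMl // (le_trans _ W1).
have a3 : z8 <= z8 * weight eps I by rewrite ler_peMr // (le_trans _ z81).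
have a4 : U <= U * time_bound C eps I by rewrite ler_peMr.
have -> : (U + 1) * time_bound C eps I = U * time_bound C eps I + time_bound C eps I by rewrite mulrDl mul1r.
have a5 : 1 <= z8 * weight eps I by apply: le_trans a2.
lra.
Qed.

Lemma word_fits : (word_bound.+2 ^ S.+2 <= 2 ^ w)%N.
Proof.
rewrite -(ler_nat R) !natrX; apply: le_trans wok.
have h := word_bound_le.
apply: (@le_trans _ _ (((max_val I).+1%:R * time_bound C eps I) ^+ S.+2)).
  by rewrite lerXn2r ?nnegrE // (le_trans _ h).
apply: ler_weXn2l; last by have := S_le_C; lia.
by apply: le_trans h; rewrite ler1n.
Qed.

Lemma run_time_le : (run_time I S (precision eps I))%:R <= time_bound C eps I.
Proof.
have W1 := weight_ge1 eps I; have W0 : 0 <= weight eps I by apply: le_trans W1.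
have h1 := budget_time 4400 (16 * S + 5) (leq_add (leqnn _) (isT : 5 <= 20)%N) isT.
apply: le_trans h1; rewrite expnD natrM.
have h2 := precision_weight eps_gt0 n_gt0.
have h3 := ncodes_weight eps_gt0 n_gt0.
have z1 : (1 <= Z ^ (16 * S))%N by rewrite expn_gt0 addn2.
have z2 : ((n * m).+1 <= Z ^ 5)%N.
  apply: (@leq_trans (Z ^ 2)); last by rewrite leq_pexp2l // addn2.
  by rewrite expnS expn1; nia.
have z3 : (1 <= Z ^ 5)%N by rewrite expn_gt0 addn2.
rewrite /run_time; move: h2 h3 z1 z2 z3.
set pr := precision _ _; set nc := ncodes _ _; clearbody nc; clearbody pr.
move: (Z ^ 5)%N (Z ^ (16 * S))%N => z5 zS.
rewrite -!(ler_nat R) => h2 h3 z1 z2 z3.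
by rewrite natrD !natrM !natrD; apply: run_arith.
Qed.

End Resources.

(** * Input values, the case without agents, conclusion *)

Lemma input_memory_le (I : instance) b :
  (input_memory I b <= max_val I + (items I + agents I + 2))%N.
Proof.
rewrite /input_memory; case: (ltnP b (size (input_words I))) => h; last by rewrite nth_default.
have hp := budget_le I.
move: (mem_nth 0%N h); rewrite /input_words !mem_cat !inE => /orP[/or3P[]/eqP->|/orP[]]; try lia.
  case/allpairsP => -[x y] [_ _ ->] /=; apply: leq_trans (leq_b1 _) _; lia.
case/allpairsP => -[i v] [_ _ ->] /=; apply: leq_trans _ (leq_addr _ _).
apply: leq_trans (bigop.leq_bigmax i).
exact: (@bigop.leq_bigmax _ (fun v => valuation i v) v).
Qed.

(** An empty family of bundles has 0 items, so a valid allocation exists exactly if [p = 0], and the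
    conditions on agents are vacuous. Time and word length are covered by [C * max(1, m)] alone. *)
Lemma run_no_agents (R : realType) (eps : R) (I : instance) (w C : nat) :
  agents I = 0%N -> (100 <= C)%N -> word_length_ok C eps I w ->
  exists t M, [/\ exec eps w ef_program (input_memory I) t M, t%:R <= time_bound C eps I
    & correct_output eps I M].
Proof.
move=> n0 C100 wok.
have hT : (C * maxn 1 (items I) <= C * (maxn 1 (items I) * maxn 1 (agents I)) ^ C)%N.
  rewrite leq_mul2l n0 muln1; apply/orP; right.
  by rewrite -{1}(expn1 (maxn 1 _)) leq_pexp2l ?leq_maxl //; apply: leq_trans C100.
have T_ge : (C * maxn 1 (items I))%:R <= time_bound C eps I.
  rewrite /time_bound -/(tbase eps I).
  apply: (@le_trans _ _ (C%:R * ((maxn 1 (items I) * maxn 1 (agents I)) ^ C)%:R)).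
    by rewrite -natrM ler_nat.
  rewrite mulrAC; apply: ler_peMr; first by rewrite mulr_ge0.
  by rewrite exprn_ege1 // tbase1.
have T1 : 1 <= time_bound C eps I.
  apply: le_trans T_ge; rewrite ler1n muln_gt0 leq_maxl andbT; exact: leq_trans C100.
have wT : (C * maxn 1 (items I) <= 2 ^ w)%N.
  rewrite -(ler_nat R) natrX; apply: le_trans wok; apply: le_trans T_ge _.
  have h : time_bound C eps I <= (max_val I).+1%:R * time_bound C eps I.
    by rewrite ler_peMl ?ler1n // (le_trans _ T1).
  apply: le_trans h _; rewrite -{1}[_ * _]expr1; apply: ler_weXn2l; last exact: leq_trans C100.
  by apply: mulr_ege1; rewrite ?ler1n.
have m1 : (1 <= maxn 1 (items I))%N by rewrite leq_maxl.
have mm : (items I <= maxn 1 (items I))%N by rewrite leq_maxr.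
have fitb x : (x <= items I + 2)%N -> fit w x = Some x.
  move=> h; rewrite /fit (leq_trans _ wT) //.
  by move: (maxn 1 _) m1 mm => M *; nia.
have hp := budget_le I.
have [_ h1 h2] := input_ok0 (fun b _ => erefl (input_memory I b)).
exists ((cost (Deref (Cst 1)) + (cost (Cst 0) + cost (Bin Leq (Deref (Cst 2)) (Cst 0))).+1).+1),
  (upd (input_memory I) 0 (budget I <= 0)%N); split.
- apply: ExecIfFalse; first by rewrite /= fitb ?addn2 //= h1 n0 fitb.
  apply: ExecStore; first by rewrite /= fitb.
  rewrite /= (fitb 2) ?leq_addl //= h2 (fitb 0) //=.
  rewrite fitb /=; last by apply: leq_trans hp (leq_addr _ _).
  by rewrite fitb // (leq_trans (leq_b1 _)) // addn2.
- apply: le_trans T_ge; rewrite ler_nat /=.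
  by move: (maxn 1 _) m1 => M *; nia.
- have noI (P : 'I_(agents I) -> Prop) (i : 'I_(agents I)) : P i by have := ltn_ord i; rewrite [X in (_ < X)%N]n0.
  have total (Pi : allocation I) : (\sum_i #|Pi i| = 0)%N by rewrite big1 // => i _; apply: (noI (fun i => #|Pi i| = 0%N)).
  have [p0|p0] := posnP (budget I).
    left; split; first by rewrite /upd /= p0.
    split; last by move=> i; apply: (noI (fun i => forall j, _)).
    split; first by move=> i; apply: (noI (fun i => forall j, _)).
      by rewrite total.
    by move=> i; apply: (noI (fun i => connected_bundle _)).
  right; split; first by rewrite /upd /= leqNgt p0.
  by case=> Pi [[_ h _] _]; rewrite total in h; rewrite -h in p0.
Qed.

Theorem theorem2 (R : realType) :
  exists (P : com) (C : nat),
  forall (I : instance) (eps : R) (w : nat),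
    0 < eps -> word_length_ok C eps I w ->
    exists (t : nat) (M : memory),
      [/\ exec eps w P (input_memory I) t M,
          t%:R <= time_bound C eps I
        & correct_output eps I M].
Proof.
(* Both constants are kept abstract: in unary notation [4 ^ (16 * S + 20)] must never be
   computed. *)
have [S sizeS] : exists S, (prog_size < S)%N by exists prog_size.+1.
have [C sizeC] : exists C, (4400 * 4 ^ (16 * S + 20) <= C)%N by exists (4400 * 4 ^ (16 * S + 20))%N.
exists ef_program, C => I eps w eps_gt0 wok.
have S_gt0 : (0 < S)%N by apply: leq_ltn_trans sizeS.
have [n0|n_gt0] := posnP (agents I).
  apply: run_no_agents wok => //; apply: leq_trans sizeC.
  by apply: (@leq_trans 4400) => //; rewrite leq_pmulr // expn_gt0.
have Z2 : (2 <= items I + agents I + 2)%N by rewrite addn2.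
have [zX zUX prX ncX X32] : [/\ ((items I + agents I + 2) ^ 8 <= word_bound R eps I)%N,
    (max_val I + (items I + agents I + 2) ^ 8 <= word_bound R eps I)%N,
    (precision eps I <= word_bound R eps I)%N,
    (ncodes I (precision eps I) <= word_bound R eps I)%N & (32 <= word_bound R eps I)%N].
  rewrite /word_bound; move: (ncodes I _) => nc; move: (precision eps I) => pr.
  by move: (max_val I) ((items I + agents I + 2) ^ 8)%N => U z8; split; lia.
have sqX : ((items I + agents I + 2) * (items I + agents I + 2) <= word_bound R eps I)%N.
  by apply: (leq_trans _ zX); rewrite mulnn leq_pexp2l // ltnW.
have baseX : (base I <= word_bound R eps I)%N by apply: (leq_trans _ sqX); rewrite /base; nia.
have inX b : (input_memory I b <= word_bound R eps I)%N.
  apply: leq_trans (input_memory_le I b) _; apply: (leq_trans _ zUX); rewrite leq_add2l.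
  move: (items I + agents I + 2)%N Z2 => z z2.
  by rewrite -{1}(expn1 z) leq_pexp2l // ltnW.
have [t [M [ex ht out]]] := run_correct eps_gt0 zX X32 baseX inX
  (word_fits R eps I w S C eps_gt0 n_gt0 S_gt0 sizeC wok) sizeS prX ncX
  (precisionP eps_gt0 n_gt0) n_gt0.
exists t, M; split=> //.
have h : (run_time I S (precision eps I))%:R <= time_bound C eps I by apply: run_time_le.
by apply: le_trans h; rewrite ler_nat.
Qed.
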